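(* Let $G$ be a connected distance-regular graph with degree $k$. Then $G$ is globally rigid (in the Euclidean plane $\mathbb{R}^2$) if and only if $k\geq 4$ or $G$ is a complete graph.
   Context: All graphs are finite and simple. For a graph $G=(V,E)$ with graph distance $d$, and non-negative integers $i,j$ and vertices $x,y$, let $D_{i,j}(x,y)=\{z\in V: d(x,z)=i,\ d(y,z)=j\}$. $G$ is distance-regular if for all non-negative integers $i,j,k$ there is an integer $a_{i,j,k}$ with $|D_{i,j}(x,y)|=a_{i,j,k}$ for all $x,y$ with $d(x,y)=k$ (such graphs are regular). A realisation of $G$ is a map $p:V\to\mathbb{R}^2$; realisations $p,q$ are equivalent if $\|p(x)-p(y)\|=\|q(x)-q(y)\|$ for all edges $xy$, and congruent if this holds for all pairs of vertices. A realisation is globally rigid if every equivalent realisation is congruent to it; it is generic if its coordinates are algebraically independent over $\mathbb{Q}$. A graph is globally rigid if it has a globally rigid generic realisation. *)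

(* Defs.v *)
From mathcomp Require Import all_boot all_algebra.
From mathcomp Require Import Rstruct.
From mathcomp Require Import mpoly.
From Stdlib Require Import Reals.
Set Implicit Arguments. Unset Strict Implicit. Unset Printing Implicit Defensive.
Import GRing.Theory Num.Theory.

Definition simple_graph (T : finType) (e : rel T) : Prop :=
  ssrbool.symmetric e /\ ssrbool.irreflexive e.

Definition connected_graph (T : finType) (e : rel T) : Prop :=
  forall x y : T, connect e x y.

Fixpoint gball (T : finType) (e : rel T) (x : T) (n : nat) : {set T} :=
  match n with
  | 0 => [set x]
  | n'.+1 => gball e x n' :|: [set z | [exists w in gball e x n', e w z]]
  end.

(* Graph distance: the least n with y in the n-ball of x.  For a connected
   graph this is the usual distance (always < #|T|). *)
Definition gdist (T : finType) (e : rel T) (x y : T) : nat :=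
  find (fun n => y \in gball e x n) (iota 0 #|T|).

Definition Dij (T : finType) (e : rel T) (i j : nat) (x y : T) : {set T} :=
  [set z | (gdist e x z == i) && (gdist e y z == j)].

Definition distance_regular (T : finType) (e : rel T) : Prop :=
  forall i j k : nat, exists a : nat,
    forall x y : T, gdist e x y = k -> #|Dij e i j x y| = a.

Definition complete_graph (T : finType) (e : rel T) : Prop :=
  forall x y : T, x != y -> e x y.

Definition realisation (T : finType) := T -> (R * R)%type.

Local Open Scope ring_scope.

Definition enorm (u v : R * R) : R :=
  Num.sqrt ((u.1 - v.1) ^+ 2 + (u.2 - v.2) ^+ 2).

Definition equivalent_real (T : finType) (e : rel T) (p q : realisation T) : Prop :=
  forall x y : T, e x y -> enorm (p x) (p y) = enorm (q x) (q y).

Definition congruent_real (T : finType) (p q : realisation T) : Prop :=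
  forall x y : T, enorm (p x) (p y) = enorm (q x) (q y).

Definition globally_rigid_real (T : finType) (e : rel T) (p : realisation T) : Prop :=
  forall q : realisation T, equivalent_real e p q -> congruent_real p q.

Definition coord_of (T : finType) (p : realisation T) (c : T * 'I_2) : R :=
  if val c.2 == 0%N then (p c.1).1 else (p c.1).2.

Definition generic_real (T : finType) (p : realisation T) : Prop :=
  forall P : {mpoly rat[#|{: T * 'I_2}|]}, P != 0 ->
    (map_mpoly (@ratr R) P).@[fun i => coord_of p (enum_val i)] != 0.

Definition globally_rigid_graph (T : finType) (e : rel T) : Prop :=
  exists p : realisation T, generic_real p /\ globally_rigid_real e p.

(* Main.v *)
(** Sufficiency.  If every vertex-deleted subgraph of [G] is generically
    infinitesimally rigid, then [G] is globally rigid (Tanigawa): by induction a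
    generic placement of [G - v], with the neighbours of [v] pairwise joined, is
    globally rigid; [G - v] itself has only finitely many equivalent placements,
    so a sufficiently general position of [v] excludes all those that change a
    distance between neighbours of [v].  By Laman's theorem, [G - v] is
    rigid unless its edges are covered by vertex sets [X] with
    [Sum (2 |X| - 3) < 2 (n - 1) - 3], and counting edges at the vertices rules
    this out as soon as all nontrivial edge cuts of [G] are large.  Cuts of a
    distance-regular graph are large because the flow that sends one unit from
    each vertex to all others along geodesics loads all edges evenly (Brouwer
    and Haemers).

    Necessity.  Let [k <= 3] and [G] not complete.  If [|E| < 2 n - 3], a generic
    [p] has a nontrivial infinitesimal flex [c].  Were [p] globally rigid, it
    would be locally the only solution of the length equations (with an edge
    pinned); minimising [- <c, x>] plus a large multiple of the squared length
    errors near [p] then shows that [c] is a combination of gradients of the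
    equations at points near [p].  This is impossible, since the rank of these
    gradients is maximal at [p] and [c] is orthogonal to them there.  Otherwise
    [G] is [K_{3,3}], with parts [a_i] and [b_j].  Put [b_0] at the origin and
    [b_1] at [(t, 0)]; then each [a_i] is determined up to a sign, and [b_2]
    exists iff a Gram determinant vanishes.  At a generic placement this
    determinant changes sign; since the choices of signs are glued
    into a loop at the extreme values of [t], it vanishes somewhere else. *)

(* The definition asks for one generic realisation that is globally rigid. Sufficiency therefore
   constructs a realisation, keeping countably many polynomial conditions nonzero, while necessity
   has to defeat every generic one. All uses of genericity rest on one principle: a rational
   polynomial in the coordinates that is nonzero at some realisation is nonzero at every generic
   one; rank conditions enter as minors or Gram determinants.

   Degree five is the delicate case of sufficiency. The edge count wants cuts of at least [3k/2]
   edges. Parity gives this for [k = 4] and the flow estimates for [k >= 6], but for [k = 5] only 6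
   edges are obtained instead of 8, and the sets of the cover are trimmed before counting.

   For [k <= 3] and [G] not complete, [k n / 2 >= 2 n - 3] leaves only [k = 3], [n = 6]: [K_{3,3}]
   and the triangular prism, whose edges lie in different numbers of triangles. [K_{3,3}] has
   exactly [2 n - 3] edges and is generically infinitesimally rigid, so no flex is available and the
   second realisation has to be found globally, by following a closed curve. *)
Require Import Defs.
From Stdlib Require Reals Lra Ranalysis5 Classical.
From mathcomp Require all_boot all_order all_algebra boolp Rstruct.
From mathcomp Require classical_sets reals topology normedtype derive.

(** * A second placement of the bipartite linkage *)

Module BipartiteLoop.
Import Reals Lra Ranalysis5 Classical.
Local Open Scope R_scope.

Lemma cpt_const (c a : R) : continuity_pt (fun _ => c) a.
Proof. apply continuity_pt_const. intros x y. reflexivity. Qed.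
Lemma cpt_id (a : R) : continuity_pt (fun t => t) a.
Proof. exact (derivable_continuous_pt id a (derivable_pt_id a)). Qed.
Lemma cpt_plus f g (a : R) : continuity_pt f a -> continuity_pt g a -> continuity_pt (fun t => f t + g t) a.
Proof. exact (continuity_pt_plus f g a). Qed.
Lemma cpt_minus f g (a : R) : continuity_pt f a -> continuity_pt g a -> continuity_pt (fun t => f t - g t) a.
Proof. exact (continuity_pt_minus f g a). Qed.
Lemma cpt_mult f g (a : R) : continuity_pt f a -> continuity_pt g a -> continuity_pt (fun t => f t * g t) a.
Proof. exact (continuity_pt_mult f g a). Qed.
Lemma cpt_div f g (a : R) : continuity_pt f a -> continuity_pt g a -> g a <> 0 ->
  continuity_pt (fun t => f t / g t) a.
Proof. intros. apply (continuity_pt_div f g a); assumption. Qed.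
Lemma cpt_abs f (a : R) : continuity_pt f a -> continuity_pt (fun t => Rabs (f t)) a.
Proof. intros H. apply (continuity_pt_comp f Rabs a H). apply Rcontinuity_abs. Qed.
Lemma cpt_sqrt f (a : R) : continuity_pt f a -> 0 <= f a -> continuity_pt (fun t => sqrt (f t)) a.
Proof. intros H H0. apply (continuity_pt_comp f sqrt a H). apply continuity_pt_sqrt, H0. Qed.

(** The minimum, written through [Rabs] so that its continuity follows from that of its
    arguments. *)
Definition dmin (a b : R) := (a + b - Rabs (a - b)) / 2.

Lemma dmin_pos a b : 0 < a -> 0 < b -> 0 < dmin a b.
Proof. intros; unfold dmin, Rabs; destruct (Rcase_abs (a - b)); lra. Qed.
Lemma dmin_le a b : dmin a b <= a /\ dmin a b <= b.
Proof. intros; unfold dmin, Rabs; destruct (Rcase_abs (a - b)); lra. Qed.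
Lemma dmin_eq0 a b : dmin a b = 0 -> 0 <= a /\ 0 <= b /\ (a = 0 \/ b = 0).
Proof.
unfold dmin, Rabs; destruct (Rcase_abs (a - b)); intros.
- assert (a = 0) by lra. repeat split; [lra|lra|left; lra].
- assert (b = 0) by lra. repeat split; [lra|lra|right; lra].
Qed.

Lemma same_sign_interval f a b : a <= b -> (forall t, a <= t <= b -> continuity_pt f t) ->
  (forall t, a <= t <= b -> f t <> 0) -> 0 < f a * f b.
Proof.
intros ab cf nz.
destruct (Rtotal_order (f a) 0) as [fa|[fa|fa]]; [|exfalso; apply (nz a); lra|];
 destruct (Rtotal_order (f b) 0) as [fb|[fb|fb]]; try (exfalso; apply (nz b); lra).
- nra.
- destruct (Req_dec a b) as [e|ne]; [subst; lra|].
  destruct (IVT_interv f a b cf ltac:(lra) fa fb) as [z [hz fz]]. exfalso. apply (nz z); assumption.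
- destruct (Req_dec a b) as [e|ne]; [subst; lra|].
  destruct (IVT_interv (fun t => 0 - f t) a b) as [z [hz fz]]; try lra.
  + intros t ht. apply cpt_minus; [apply cpt_const | apply cf; assumption].
  + exfalso. apply (nz z); [assumption | lra].
- nra.
Qed.

Lemma derivative_sign_change f t0 l : derivable_pt_lim f t0 l -> f t0 = 0 -> l <> 0 ->
  exists r, 0 < r /\ forall h, h <> 0 -> Rabs h < r -> 0 < f (t0 + h) * (l * h).
Proof.
intros D f0 l0. destruct (D (Rabs l) (Rabs_pos_lt l l0)) as [r hr].
exists r; split; [apply cond_pos|]. intros h h0 hr'.
specialize (hr h h0 hr'). rewrite f0, Rminus_0_r in hr.
(* The difference quotient lies within [Rabs l] of [l], hence has the sign of [l]. *)
assert (E : f (t0 + h) * (l * h) = (f (t0 + h) / h * l) * (h * h)) by (field; exact h0).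
rewrite E. apply Rmult_lt_0_compat; [|nra].
revert hr. generalize (f (t0 + h) / h). intros s hr.
unfold Rabs in hr. destruct (Rcase_abs l), (Rcase_abs (s - l)); nra.
Qed.

Lemma dl_const c a : derivable_pt_lim (fun _ => c) a 0.
Proof. exact (derivable_pt_lim_const c a). Qed.
Lemma dl_id a : derivable_pt_lim (fun t => t) a 1.
Proof. exact (derivable_pt_lim_id a). Qed.
Lemma dl_plus f g a l m : derivable_pt_lim f a l -> derivable_pt_lim g a m ->
  derivable_pt_lim (fun t => f t + g t) a (l + m).
Proof. exact (derivable_pt_lim_plus f g a l m). Qed.
Lemma dl_minus f g a l m : derivable_pt_lim f a l -> derivable_pt_lim g a m ->
  derivable_pt_lim (fun t => f t - g t) a (l - m).
Proof. exact (derivable_pt_lim_minus f g a l m). Qed.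
Lemma dl_mult f g a l m : derivable_pt_lim f a l -> derivable_pt_lim g a m ->
  derivable_pt_lim (fun t => f t * g t) a (l * g a + f a * m).
Proof. exact (derivable_pt_lim_mult f g a l m). Qed.
Lemma dl_div f g a l m : derivable_pt_lim f a l -> derivable_pt_lim g a m -> g a <> 0 ->
  derivable_pt_lim (fun t => f t / g t) a ((l * g a - m * f a) / Rsqr (g a)).
Proof. exact (derivable_pt_lim_div f g a l m). Qed.
Lemma dl_sqrt f a l : derivable_pt_lim f a l -> 0 < f a ->
  derivable_pt_lim (fun t => sqrt (f t)) a (/ (2 * sqrt (f a)) * l).
Proof. intros H H0. apply (derivable_pt_lim_comp f sqrt a l). exact H. apply derivable_pt_lim_sqrt, H0. Qed.

Inductive I3 := i0 | i1 | i2.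
Definition eq3 (i j : I3) : bool :=
  match i, j with i0, i0 | i1, i1 | i2, i2 => true | _, _ => false end.

Section Loop.
Variables (t0 u w : R) (x y : I3 -> R).
Hypothesis t0_pos : 0 < t0.
Hypothesis y_neq0 : forall i, y i <> 0.
Hypothesis x0_mid : 2 * x i0 <> t0.

(** Twice the signed area of a triangle; the three abscissas come before the three ordinates. *)
Definition crs (a b c a' b' c' : R) := (b - a) * (c' - a') - (b' - a') * (c - a).
Hypothesis cr01 : crs u (x i0) (x i1) w (y i0) (y i1) <> 0.
Hypothesis cr02 : crs u (x i0) (x i2) w (y i0) (y i2) <> 0.
Hypothesis cr012 : crs (x i0) (x i1) (x i2) (y i0) (y i1) (y i2) <> 0.

Let p0 i := x i * x i + y i * y i.
Let p1 i := (x i - t0) * (x i - t0) + y i * y i.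
Let p2 i := (x i - u) * (x i - u) + (y i - w) * (y i - w).

(** The velocity of the point [(x i, y i)] when the centre [(t, 0)] moves at unit speed and the
    distances to it and to the origin stay fixed. Then [rho i] is half the rate of change of the
    squared distance to [(u, w)] held still. *)
Definition vx i := (t0 - x i) / t0.
Definition vy i := - (x i * (t0 - x i)) / (t0 * y i).
Definition rho i := (x i - u) * vx i + (y i - w) * vy i.

(* Vanishes iff the velocities [vx], [vy] of the first three points extend to
   the point [(u, w)] without changing its distances to them. *)
Hypothesis rigid : crs u (x i1) (x i2) w (y i1) (y i2) * rho i0 +
  crs u (x i2) (x i0) w (y i2) (y i0) * rho i1 + crs u (x i0) (x i1) w (y i0) (y i1) * rho i2 <> 0.

(* Two centres are at the origin and at [(t, 0)]; [(X i t, Y s i t)] has the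
   original distances [p0 i], [p1 i] (squared) to them, on the side [s i].
   [g] is the Gram matrix forced on the vectors from the third centre, and
   [H s t = 0] implies that these vectors exist in the plane. *)
Let X i t := (t * t + p0 i - p1 i) / (2 * t).
Let h i t := p0 i - X i t * X i t.
Let Y (s : I3 -> R) i t := s i * sqrt (h i t).
Let g s i j t :=
  (p2 i + p2 j - ((X i t - X j t) * (X i t - X j t) + (Y s i t - Y s j t) * (Y s i t - Y s j t))) / 2.
Let m01 s t := p2 i0 * p2 i1 - g s i0 i1 t * g s i0 i1 t.
Let m02 s t := p2 i0 * p2 i2 - g s i0 i2 t * g s i0 i2 t.
Let det s t := p2 i0 * p2 i1 * p2 i2 + 2 * (g s i0 i1 t * g s i1 i2 t * g s i0 i2 t)
  - p2 i0 * (g s i1 i2 t * g s i1 i2 t) - p2 i1 * (g s i0 i2 t * g s i0 i2 t)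
  - p2 i2 * (g s i0 i1 t * g s i0 i1 t).
Let H s t := dmin (dmin (m01 s t) (m02 s t)) (det s t).

(** The triangle with sides [t], [sqrt (p0 i)], [sqrt (p1 i)] exists for [t] between [M i] and
    [P i], and is flat at both ends. *)
Let P i := sqrt (p0 i) + sqrt (p1 i).
Let M i := Rabs (sqrt (p0 i) - sqrt (p1 i)).

Lemma p0_pos i : 0 < p0 i.
Proof.
unfold p0. assert (a := Rsqr_pos_lt _ (y_neq0 i)). assert (b := Rle_0_sqr (x i)). unfold Rsqr in *. lra.
Qed.
Lemma p1_pos i : 0 < p1 i.
Proof.
unfold p1. assert (a := Rsqr_pos_lt _ (y_neq0 i)). assert (b := Rle_0_sqr (x i - t0)). unfold Rsqr in *. lra.
Qed.

(** Heron's formula: both sides are sixteen times the squared area of that triangle. *)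
Lemma h_factor i t : 0 < t -> 4 * (t * t) * h i t = (t * t - M i * M i) * (P i * P i - t * t).
Proof.
intros tp. unfold h, X.
assert (a0 := sqrt_sqrt (p0 i) (Rlt_le _ _ (p0_pos i))).
assert (a1 := sqrt_sqrt (p1 i) (Rlt_le _ _ (p1_pos i))).
assert (MM : M i * M i = (sqrt (p0 i) - sqrt (p1 i)) * (sqrt (p0 i) - sqrt (p1 i))).
{ unfold M. rewrite <- Rabs_mult. apply Rabs_pos_eq, Rle_0_sqr. }
rewrite MM. unfold P.
revert a0 a1. generalize (sqrt (p0 i)) (sqrt (p1 i)). intros r s <- <-. field. lra.
Qed.

Lemma X_t0 i : X i t0 = x i.
Proof. unfold X, p0, p1. field. lra. Qed.

Lemma h_t0 i : h i t0 = y i * y i.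
Proof. unfold h. rewrite X_t0. unfold p0. ring. Qed.

Lemma M_nonneg i : 0 <= M i. Proof. apply Rabs_pos. Qed.

Lemma P_pos i : 0 < P i.
Proof. unfold P. assert (a := sqrt_lt_R0 _ (p0_pos i)). assert (b := sqrt_lt_R0 _ (p1_pos i)). lra. Qed.

(** As [y i] is nonzero, the triangle at [t0] is not flat, so the triangle inequalities are
    strict. *)
Lemma MP_t0 i : M i < t0 < P i.
Proof.
assert (f := h_factor i t0 t0_pos). rewrite h_t0 in f.
assert (yy : 0 < y i * y i) by (apply Rsqr_pos_lt, y_neq0).
assert (pos : 0 < (t0 * t0 - M i * M i) * (P i * P i - t0 * t0)).
{ assert (tt := Rmult_lt_0_compat _ _ t0_pos t0_pos). rewrite <- f. apply Rmult_lt_0_compat; lra. }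
assert (MP : M i <= P i).
{ unfold M, P. assert (a := sqrt_pos (p0 i)). assert (b := sqrt_pos (p1 i)).
  unfold Rabs; destruct (Rcase_abs _); lra. }
assert (m0 := M_nonneg i). assert (q0 := P_pos i).
split; apply Rnot_le_lt; intro.
- assert (q1 : t0 * t0 <= M i * M i) by (apply Rmult_le_compat; lra).
  assert (q2 : M i * M i <= P i * P i) by (apply Rmult_le_compat; lra).
  revert pos q1 q2. generalize (M i * M i) (P i * P i) (t0 * t0). clear. intros; nra.
- assert (q1 : P i * P i <= t0 * t0) by (apply Rmult_le_compat; lra).
  assert (q2 : M i * M i <= P i * P i) by (apply Rmult_le_compat; lra).
  revert pos q1 q2. generalize (M i * M i) (P i * P i) (t0 * t0). clear. intros; nra.
Qed.

Lemma exists_tmax : exists k, forall i, P k <= P i.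
Proof.
destruct (Rle_dec (P i0) (P i1)), (Rle_dec (P i0) (P i2)), (Rle_dec (P i1) (P i2));
 first [exists i0; intros [| |]; lra | exists i1; intros [| |]; lra | exists i2; intros [| |]; lra].
Qed.

Lemma exists_tmin : exists k, forall i, M i <= M k.
Proof.
destruct (Rle_dec (M i0) (M i1)), (Rle_dec (M i0) (M i2)), (Rle_dec (M i1) (M i2));
 first [exists i0; intros [| |]; lra | exists i1; intros [| |]; lra | exists i2; intros [| |]; lra].
Qed.

(** This keeps the whole range of [t] away from zero, where [X i] would divide by zero. *)
Lemma M0_pos : 0 < M i0.
Proof.
destruct (M_nonneg i0) as [|e]; [assumption|exfalso]. symmetry in e.
unfold M in e. apply x0_mid.
assert (e' : sqrt (p0 i0) = sqrt (p1 i0)).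
{ destruct (Req_dec (sqrt (p0 i0) - sqrt (p1 i0)) 0) as [z|z]; [lra|].
  apply Rabs_no_R0 in z. contradiction. }
assert (e2 : p0 i0 = p1 i0).
{ rewrite <- (sqrt_sqrt (p0 i0)), <- (sqrt_sqrt (p1 i0)), e'; auto using Rlt_le, p0_pos, p1_pos. }
unfold p0, p1 in e2. nra.
Qed.

Section Ends.
Variables (kmax kmin : I3).
Hypothesis kmaxP : forall i, P kmax <= P i.
Hypothesis kminP : forall i, M i <= M kmin.
(** On [[ta, tb]] all three points exist; at either end one of them is collinear with the first two
    centres, and its sign no longer matters. *)
Let ta := M kmin.
Let tb := P kmax.

Lemma ta_pos : 0 < ta.
Proof. unfold ta. assert (a := kminP i0). assert (b := M0_pos). lra. Qed.

Lemma t0_between : ta < t0 < tb.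
Proof. unfold ta, tb. split; [apply (MP_t0 kmin) | apply (MP_t0 kmax)]. Qed.

Lemma h_nonneg i t : ta <= t <= tb -> 0 <= h i t.
Proof.
intros [h1 h2]. assert (tp : 0 < t) by (assert (a := ta_pos); lra).
assert (f := h_factor i t tp).
assert (a := kminP i). assert (b := kmaxP i). assert (c := M_nonneg i). unfold ta, tb in *.
assert (M i * M i <= t * t) by (apply Rmult_le_compat; lra).
assert (t * t <= P i * P i) by (apply Rmult_le_compat; lra).
assert (0 <= (t * t - M i * M i) * (P i * P i - t * t)) by (apply Rmult_le_pos; lra).
assert (tt := Rmult_lt_0_compat _ _ tp tp).
apply (Rmult_le_reg_l (4 * (t * t))); lra.
Qed.

Lemma h_tb : h kmax tb = 0.
Proof.
assert (tp : 0 < tb) by (assert (a := t0_between); assert (b := ta_pos); lra).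
assert (f := h_factor kmax tb tp). unfold tb in *.
replace (P kmax * P kmax - P kmax * P kmax) with 0 in f by ring.
rewrite Rmult_0_r in f. destruct (Rmult_integral _ _ f); nra.
Qed.

Lemma h_ta : h kmin ta = 0.
Proof.
assert (tp := ta_pos). assert (f := h_factor kmin ta tp). unfold ta in *.
replace (M kmin * M kmin - M kmin * M kmin) with 0 in f by ring.
rewrite Rmult_0_l in f. destruct (Rmult_integral _ _ f); nra.
Qed.

Lemma cont_X i t : 0 < t -> continuity_pt (X i) t.
Proof.
intros tp. unfold X. apply cpt_div; [| |lra].
- apply cpt_minus; [|apply cpt_const]. apply cpt_plus; [|apply cpt_const].
  apply cpt_mult; apply cpt_id.
- apply cpt_mult; [apply cpt_const | apply cpt_id].
Qed.

Lemma cont_Y s i t : ta <= t <= tb -> continuity_pt (Y s i) t.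
Proof.
intros ht. assert (tp : 0 < t) by (assert (a := ta_pos); lra).
unfold Y. apply cpt_mult; [apply cpt_const|].
apply (cpt_sqrt (h i)); [|apply h_nonneg, ht].
unfold h. apply cpt_minus; [apply cpt_const|]. apply cpt_mult; apply cont_X, tp.
Qed.

Lemma cont_g s i j t : ta <= t <= tb -> continuity_pt (g s i j) t.
Proof.
intros ht. assert (tp : 0 < t) by (assert (a := ta_pos); lra).
unfold g. apply cpt_div; [|apply cpt_const|lra]. apply cpt_minus; [apply cpt_const|].
apply cpt_plus; apply cpt_mult; apply cpt_minus; first [apply cont_X, tp | apply cont_Y, ht].
Qed.

Lemma cont_H s t : ta <= t <= tb -> continuity_pt (H s) t.
Proof.
intros ht.
assert (dm : forall f k, continuity_pt f t -> continuity_pt k t ->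
  continuity_pt (fun t => dmin (f t) (k t)) t).
{ intros f k cf ck. unfold dmin. apply cpt_div; [|apply cpt_const|lra].
  apply cpt_minus; [apply cpt_plus; assumption|]. apply cpt_abs. apply cpt_minus; assumption. }
unfold H. apply dm; [apply dm|]; unfold m01, m02, det;
repeat first [apply cpt_const | apply cont_g, ht | apply cpt_minus | apply cpt_plus | apply cpt_mult].
Qed.

Definition flip (k : I3) (s : I3 -> R) i := if eq3 i k then - s i else s i.

Lemma g_ext s s' i j t : (forall i, s i * sqrt (h i t) = s' i * sqrt (h i t)) -> g s i j t = g s' i j t.
Proof. intros E. unfold g, Y. rewrite !E. reflexivity. Qed.

Lemma H_ext s s' t : (forall i, s i * sqrt (h i t) = s' i * sqrt (h i t)) -> H s t = H s' t.
Proof. intros E. unfold H, m01, m02, det. rewrite !(g_ext s s' _ _ t E). reflexivity. Qed.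

Lemma H_flip k s t : h k t = 0 -> H (flip k s) t = H s t.
Proof.
intros E. apply H_ext. intros i. unfold flip.
destruct i, k; simpl; try reflexivity; rewrite E, sqrt_0; ring.
Qed.

(** The sign of [y i]: [eps] is the sign pattern of the original placement. *)
Let eps i := y i / sqrt (y i * y i).

Lemma eps_sqr i : eps i * eps i = 1.
Proof.
unfold eps. assert (p : 0 < y i * y i) by (apply Rsqr_pos_lt, y_neq0).
assert (q := sqrt_lt_R0 _ p). assert (r := sqrt_sqrt _ (Rlt_le _ _ p)).
replace (y i / sqrt (y i * y i) * (y i / sqrt (y i * y i))) with
  ((y i * y i) / (sqrt (y i * y i) * sqrt (y i * y i))) by (field; lra).
rewrite r. field. apply y_neq0.
Qed.

Lemma Y_t0 i : Y eps i t0 = y i.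
Proof.
unfold Y, eps. rewrite h_t0.
assert (p : 0 < y i * y i) by (apply Rsqr_pos_lt, y_neq0).
assert (q := sqrt_lt_R0 _ p). field. lra.
Qed.

Lemma g_t0 i j : g eps i j t0 = (x i - u) * (x j - u) + (y i - w) * (y j - w).
Proof. unfold g, p2. rewrite !X_t0, !Y_t0. field. Qed.

Lemma m01_t0 : 0 < m01 eps t0.
Proof.
unfold m01. rewrite g_t0. unfold p2.
match goal with |- _ < ?a => replace a with
  (crs u (x i0) (x i1) w (y i0) (y i1) * crs u (x i0) (x i1) w (y i0) (y i1))
  by (unfold crs; ring) end.
apply Rsqr_pos_lt, cr01.
Qed.

Lemma m02_t0 : 0 < m02 eps t0.
Proof.
unfold m02. rewrite g_t0. unfold p2.
match goal with |- _ < ?a => replace a with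
  (crs u (x i0) (x i2) w (y i0) (y i2) * crs u (x i0) (x i2) w (y i0) (y i2))
  by (unfold crs; ring) end.
apply Rsqr_pos_lt, cr02.
Qed.

Lemma det_t0 : det eps t0 = 0.
Proof. unfold det. rewrite !g_t0. unfold p2. ring. Qed.

Lemma dl_X i : derivable_pt_lim (X i) t0 (vx i).
Proof.
unfold X. replace (vx i) with
 (((1 * t0 + t0 * 1 + 0 - 0) * (2 * t0) - (0 * t0 + 2 * 1) * (t0 * t0 + p0 i - p1 i)) / Rsqr (2 * t0)).
2:{ unfold vx, p0, p1, Rsqr. field. lra. }
apply (dl_div (fun t => t * t + p0 i - p1 i) (fun t => 2 * t)); [| |lra].
- apply dl_minus; [|apply dl_const]. apply dl_plus; [|apply dl_const].
  apply (dl_mult (fun t => t) (fun t => t)); apply dl_id.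
- apply (dl_mult (fun _ => 2) (fun t => t)); [apply dl_const | apply dl_id].
Qed.

Lemma dl_Y i : derivable_pt_lim (Y eps i) t0 (vy i).
Proof.
assert (p : 0 < y i * y i) by (apply Rsqr_pos_lt, y_neq0).
assert (q := sqrt_lt_R0 _ p). assert (r := sqrt_sqrt _ (Rlt_le _ _ p)).
unfold Y. replace (vy i) with
 (0 * sqrt (h i t0) + eps i * (/ (2 * sqrt (h i t0)) * (0 - (vx i * X i t0 + X i t0 * vx i)))).
2:{ rewrite h_t0, X_t0. unfold eps, vy, vx.
    set (sq := sqrt (y i * y i)) in *.
    transitivity (- (x i * (t0 - x i)) * y i / (t0 * (sq * sq))). field; lra.
    rewrite r. field. split; [apply y_neq0 | lra]. }
apply (dl_mult (fun _ => eps i) (fun t => sqrt (h i t))); [apply dl_const|].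
apply (dl_sqrt (h i)); [|rewrite h_t0; exact p].
unfold h. apply dl_minus; [apply dl_const|]. apply dl_mult; apply dl_X.
Qed.

Let dg i j := - ((x i - x j) * (vx i - vx j) + (y i - y j) * (vy i - vy j)).

Lemma dl_g i j : derivable_pt_lim (g eps i j) t0 (dg i j).
Proof.
unfold g. replace (dg i j) with
 (((0 - (((vx i - vx j) * (X i t0 - X j t0) + (X i t0 - X j t0) * (vx i - vx j)) +
   ((vy i - vy j) * (Y eps i t0 - Y eps j t0) + (Y eps i t0 - Y eps j t0) * (vy i - vy j)))) * 2 - 0 *
   (p2 i + p2 j -
     ((X i t0 - X j t0) * (X i t0 - X j t0) + (Y eps i t0 - Y eps j t0) * (Y eps i t0 - Y eps j t0)))) / Rsqr 2).
2:{ rewrite !X_t0, !Y_t0. unfold dg, Rsqr. field. }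
apply (dl_div (fun t => p2 i + p2 j -
  ((X i t - X j t) * (X i t - X j t) + (Y eps i t - Y eps j t) * (Y eps i t - Y eps j t)))
  (fun _ => 2)); [|apply dl_const|lra].
apply dl_minus; [apply dl_const|].
apply dl_plus; [apply (dl_mult (fun t => X i t - X j t) (fun t => X i t - X j t)) |
  apply (dl_mult (fun t => Y eps i t - Y eps j t) (fun t => Y eps i t - Y eps j t))];
  apply dl_minus; first [apply dl_X | apply dl_Y].
Qed.

Lemma dl_det : exists l, l <> 0 /\ derivable_pt_lim (det eps) t0 l.
Proof.
eexists; split; cycle 1.
- unfold det. apply dl_minus; [apply dl_minus; [apply dl_minus; [apply dl_plus|]|]|].
  + apply dl_const.
  + apply (dl_mult (fun _ => 2)); [apply dl_const|].
    apply (dl_mult (fun t => g eps i0 i1 t * g eps i1 i2 t)); [|apply dl_g].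
    apply dl_mult; apply dl_g.
  + apply (dl_mult (fun _ => p2 i0)); [apply dl_const|]. apply dl_mult; apply dl_g.
  + apply (dl_mult (fun _ => p2 i1)); [apply dl_const|]. apply dl_mult; apply dl_g.
  + apply (dl_mult (fun _ => p2 i2)); [apply dl_const|]. apply dl_mult; apply dl_g.
- cbv beta. rewrite !g_t0.
  (* The derivative equals [-2] times the product of the expressions in [rigid] and [cr012]. *)
  intro E. apply (Rmult_integral_contrapositive_currified _ _ rigid cr012).
  rewrite <- (Rmult_0_r (- (1 / 2))), <- E. unfold dg, rho, crs, p2.
  generalize (vx i0) (vx i1) (vx i2) (vy i0) (vy i1) (vy i2). intros. field.
Qed.

(** Near [t0] both [m01] and [m02] are positive, so [H eps] has the sign of [det eps], which has a
    simple zero there. *)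
Lemma H_sign_change : exists a b, ta <= a < t0 /\ t0 < b <= tb /\ H eps a * H eps b < 0 /\
  (forall t, a <= t < t0 -> H eps t <> 0) /\ (forall t, t0 < t <= b -> H eps t <> 0).
Proof.
destruct dl_det as [l [l0 Dl]].
destruct (derivative_sign_change _ _ _ Dl det_t0 l0) as [r [r0 hr]].
assert (bt := t0_between).
assert (near : forall s, continuity_pt s t0 -> 0 < s t0 ->
  exists d, 0 < d /\ forall t, Rabs (t - t0) < d -> 0 < s t).
{ intros s cs s0. destruct (cs (s t0) s0) as [d [d0 hd]]. exists d. split; [exact d0|].
  intros t ht. destruct (Req_dec t t0) as [->|n]; [exact s0|].
  assert (q : R_dist (s t) (s t0) < s t0).
  { apply hd. split; [split; [exact I | intro; apply n; auto] | exact ht]. }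
  unfold R_dist, Rabs in q. destruct (Rcase_abs _) in q; lra. }
assert (ht0 : ta <= t0 <= tb) by lra.
destruct (near (m01 eps)) as [d1 [d10 hd1]].
{ unfold m01. apply cpt_minus; [apply cpt_const|]. apply cpt_mult; apply cont_g, ht0. }
{ apply m01_t0. }
destruct (near (m02 eps)) as [d2 [d20 hd2]].
{ unfold m02. apply cpt_minus; [apply cpt_const|]. apply cpt_mult; apply cont_g, ht0. }
{ apply m02_t0. }
assert (sg : forall k, k <> 0 -> Rabs k < r -> Rabs k < d1 -> Rabs k < d2 -> 0 < H eps (t0 + k) * (l * k)).
{ intros k k0 kr k1 k2. assert (hk := hr k k0 kr).
  assert (q1 := hd1 (t0 + k)). assert (q2 := hd2 (t0 + k)).
  replace (t0 + k - t0) with k in q1, q2 by ring. specialize (q1 k1). specialize (q2 k2).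
  destruct (Rlt_or_le 0 (det eps (t0 + k))) as [dp|dn].
  - assert (0 < H eps (t0 + k)) by (unfold H; auto using dmin_pos).
    apply Rmult_lt_0_compat; [assumption|]. apply (Rmult_lt_reg_l (det eps (t0 + k))); lra.
  - assert (H eps (t0 + k) <= det eps (t0 + k)) by (unfold H; apply dmin_le).
    assert (n : l * k < 0).
    { apply Rnot_le_lt. intro n. assert (q := Rmult_le_compat_r _ _ _ n dn). lra. }
    assert (q := Rmult_le_compat_neg_l (l * k) _ _ (Rlt_le _ _ n) H0). lra. }
set (d := Rmin (Rmin (Rmin r d1) (Rmin d2 (t0 - ta))) (tb - t0)).
assert (dr : d <= r /\ d <= d1 /\ d <= d2 /\ d <= t0 - ta /\ d <= tb - t0 /\ 0 < d).
{ unfold d. repeat split; try (repeat apply Rmin_glb_lt; lra);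
  unfold Rmin; repeat destruct (Rle_dec _ _); lra. }
exists (t0 - d / 2), (t0 + d / 2).
assert (small : forall k, k <> 0 -> Rabs k <= d / 2 -> 0 < H eps (t0 + k) * (l * k)).
{ intros k k0 kd. apply sg; [exact k0|lra..]. }
repeat split; try lra.
- assert (a1 := small (- (d / 2))). assert (a2 := small (d / 2)).
  rewrite Rabs_Ropp, Rabs_pos_eq in a1 by lra. rewrite Rabs_pos_eq in a2 by lra.
  specialize (a1 ltac:(lra) ltac:(lra)). specialize (a2 ltac:(lra) ltac:(lra)).
  replace (t0 - d / 2) with (t0 + - (d / 2)) by ring.
  revert a1 a2. generalize (H eps (t0 + - (d / 2))) (H eps (t0 + d / 2)). intros A B a1 a2.
  assert (l2 : 0 < l * l) by (apply Rsqr_pos_lt, l0).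
  assert (0 < A * (l * - (d / 2)) * (B * (l * (d / 2)))) by (apply Rmult_lt_0_compat; assumption).
  assert (E : A * (l * - (d / 2)) * (B * (l * (d / 2))) = - (A * B) * (l * l * (d / 2 * (d / 2)))) by ring.
  assert (q : 0 < l * l * (d / 2 * (d / 2))).
  { apply Rmult_lt_0_compat; [exact l2|apply Rmult_lt_0_compat; lra]. }
  apply Ropp_lt_cancel, (Rmult_lt_reg_r _ _ _ q). lra.
- intros t ht E. assert (q := small (t - t0)). replace (t0 + (t - t0)) with t in q by ring.
  rewrite E, Rmult_0_l in q. rewrite Rabs_left in q by lra. specialize (q ltac:(lra) ltac:(lra)). lra.
- intros t ht E. assert (q := small (t - t0)). replace (t0 + (t - t0)) with t in q by ring.
  rewrite E, Rmult_0_l in q. rewrite Rabs_right in q by lra. specialize (q ltac:(lra) ltac:(lra)). lra.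
Qed.

(** Each sign pattern gives an arc over [[ta, tb]]. At [tb] the sign of [kmax] can be flipped
    without changing [H], and at [ta] that of [kmin]; so two or four arcs form a closed curve, on
    which a continuous function cannot change sign exactly once. At [t = t0] the last disjunct
    excludes the original placement and its mirror image. *)
Lemma second_zero : exists s t, ta <= t <= tb /\ H s t = 0 /\ (forall i, s i * s i = 1) /\
  (t <> t0 \/ exists i j, s i = eps i /\ s j = - eps j).
Proof.
apply NNPP. intro none. assert (bt := t0_between).
assert (nz : forall s, (forall i, s i * s i = 1) -> (exists i j, s i = eps i /\ s j = - eps j) ->
  forall t, ta <= t <= tb -> H s t <> 0).
{ intros s s1 sij t ht E. apply none. exists s, t. auto. }
assert (fl1 : forall k s, (forall i, s i * s i = 1) -> forall i, flip k s i * flip k s i = 1).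
{ intros k s s1 i. unfold flip. destruct (eq3 i k); rewrite <- (s1 i); ring. }
destruct H_sign_change as [a [b [ha [hb [sc [na nb]]]]]].
assert (sa : 0 < H eps ta * H eps a).
{ apply same_sign_interval; [lra| |].
  - intros t ht. apply cont_H. lra.
  - intros t ht E. apply none. exists eps, t.
    split; [lra|split; [exact E|split; [apply eps_sqr|left; intro; lra]]]. }
assert (sb : 0 < H eps b * H eps tb).
{ apply same_sign_interval; [lra| |].
  - intros t ht. apply cont_H. lra.
  - intros t ht E. apply none. exists eps, t.
    split; [lra|split; [exact E|split; [apply eps_sqr|left; intro; lra]]]. }
assert (opp : H eps ta * H eps tb < 0).
{ revert sa sb sc. generalize (H eps ta) (H eps a) (H eps b) (H eps tb). clear. intros; nra. }
assert (e1 := H_flip kmax eps tb h_tb).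
assert (e2 := H_flip kmin eps ta h_ta).
assert (const : forall s, (forall i, s i * s i = 1) -> (exists i j, s i = eps i /\ s j = - eps j) ->
   0 < H s ta * H s tb).
{ intros s s1 sij. apply same_sign_interval; [lra| |].
  - intros t ht. apply cont_H, ht.
  - intros t ht. apply nz; assumption. }
assert (other : forall k, exists i, eq3 i k = false)
  by (intros [| |]; [exists i1|exists i0|exists i0]; reflexivity).
assert (self : forall k, eq3 k k = true) by (intros [| |]; reflexivity).
assert (c1 : 0 < H (flip kmax eps) ta * H (flip kmax eps) tb).
{ apply const; [apply fl1, eps_sqr|]. destruct (other kmax) as [i hi]. exists i, kmax.
  unfold flip. rewrite hi, self. auto. }
(* If the same point is extreme at both ends, two arcs already close up. *)
destruct (eq3 kmin kmax) eqn:ek.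
- assert (kk : kmin = kmax) by (destruct kmin, kmax; simpl in ek; congruence).
  rewrite kk in e2. rewrite e1, e2 in c1. lra.
- assert (c2 : 0 < H (flip kmin eps) ta * H (flip kmin eps) tb).
  { apply const; [apply fl1, eps_sqr|]. destruct (other kmin) as [i hi]. exists i, kmin.
    unfold flip. rewrite hi, self. auto. }
  assert (c3 : 0 < H (flip kmin (flip kmax eps)) ta * H (flip kmin (flip kmax eps)) tb).
  { apply const; [apply fl1, fl1, eps_sqr|].
    (* The index outside [kmin] and [kmax] keeps its sign, so the doubly flipped pattern is not the
       mirror image of [eps]. *)
    assert (third : exists i, eq3 i kmin = false /\ eq3 i kmax = false).
    { destruct kmin, kmax; simpl in ek; try discriminate;
      first [exists i0; split; reflexivity | exists i1; split; reflexivity | exists i2; split; reflexivity]. }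
    destruct third as [i [hi1 hi2]]. exists i, kmin. unfold flip. rewrite hi1, hi2, self, ek. auto. }
  assert (e3 := H_flip kmin (flip kmax eps) ta h_ta).
  assert (e4 : H (flip kmin (flip kmax eps)) tb = H (flip kmin eps) tb).
  { apply H_ext. intros i. unfold flip. destruct (eq3 i kmin), (eq3 i kmax) eqn:ei; try reflexivity;
    (assert (i = kmax) by (destruct i, kmax; simpl in ei; congruence); subst i; rewrite h_tb, sqrt_0; ring). }
  rewrite e1 in c1. rewrite e3, e4 in c3. rewrite e2 in c2.
  revert opp c1 c2 c3. generalize (H eps ta) (H eps tb) (H (flip kmax eps) ta) (H (flip kmin eps) tb).
  clear. intros A B C D o q1 q2 q3.
  assert (r1 := Rmult_lt_0_compat _ _ (Rmult_lt_0_compat _ _ q1 q3) q2).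
  assert (E : C * B * (C * D) * (A * D) = (A * B) * ((C * D) * (C * D))) by ring.
  assert (r2 := Rle_0_sqr (C * D)). unfold Rsqr in r2. nra.
Qed.

(** A vanishing determinant alone would not make the Gram matrix positive semidefinite; this is why
    [H] is a minimum. At a zero of [H] the two minors are nonnegative and [det] vanishes, so the
    vectors can be written down, the first one on the horizontal axis and the sign [e] of [c]
    deciding the side of the third. *)
Lemma gram_vectors s t : H s t = 0 -> exists v v' : I3 -> R, forall i j,
  (v i - v j) * (v i - v j) + (v' i - v' j) * (v' i - v' j) =
  (X i t - X j t) * (X i t - X j t) + (Y s i t - Y s j t) * (Y s i t - Y s j t) /\
  v i * v i + v' i * v' i = p2 i.
Proof.
intros E. unfold H in E. apply dmin_eq0 in E. destruct E as [E1 [E2 E3]].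
assert (q1 := dmin_le (m01 s t) (m02 s t)).
assert (m1 : 0 <= m01 s t) by lra. assert (m2 : 0 <= m02 s t) by lra.
assert (g0 : 0 < p2 i0).
{ unfold p2. unfold crs in cr01.
  assert (a := Rle_0_sqr (x i0 - u)). assert (b := Rle_0_sqr (y i0 - w)). unfold Rsqr in *.
  destruct (Req_dec (x i0) u) as [e1|n1]; [destruct (Req_dec (y i0) w) as [e2|n2]|].
  - exfalso. apply cr01. rewrite e1, e2. ring.
  - assert (q := Rsqr_pos_lt (y i0 - w) ltac:(lra)). unfold Rsqr in q. lra.
  - assert (q := Rsqr_pos_lt (x i0 - u) ltac:(lra)). unfold Rsqr in q. lra. }
set (c := p2 i0 * g s i1 i2 t - g s i0 i1 t * g s i0 i2 t).
assert (id : p2 i0 * det s t = m01 s t * m02 s t - c * c) by (unfold det, m01, m02, c; ring).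
assert (cc : c * c = m01 s t * m02 s t).
{ destruct E3 as [E3|E3].
  - apply dmin_eq0 in E3. destruct E3 as [_ [_ E3]].
    assert (mm : m01 s t * m02 s t = 0) by (destruct E3 as [->| ->]; ring).
    assert (0 <= p2 i0 * det s t) by (apply Rmult_le_pos; lra).
    assert (c2 := Rle_0_sqr c). unfold Rsqr in c2. lra.
  - rewrite E3, Rmult_0_r in id. lra. }
set (r0 := sqrt (p2 i0)). assert (r0p : 0 < r0) by (apply sqrt_lt_R0, g0).
assert (r00 : r0 * r0 = p2 i0) by (apply sqrt_sqrt; lra).
assert (s1 := sqrt_sqrt _ m1). assert (s2 := sqrt_sqrt _ m2).
set (a1 := sqrt (m01 s t)) in *. set (a2 := sqrt (m02 s t)) in *.
assert (sgn : exists e, e * e = 1 /\ e * (a1 * a2) = c).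
{ assert (z : (a1 * a2 - c) * (a1 * a2 + c) = 0).
  { transitivity (a1 * a1 * (a2 * a2) - c * c); [ring|]. rewrite s1, s2, cc. ring. }
  destruct (Rmult_integral _ _ z); [exists 1 | exists (-1)]; split; lra. }
destruct sgn as [e [ee ec]].
set (v := fun i => match i with i0 => r0 | i1 => g s i0 i1 t / r0 | i2 => g s i0 i2 t / r0 end).
set (v' := fun i => match i with i0 => 0 | i1 => a1 / r0 | i2 => e * a2 / r0 end).
assert (n1 : g s i0 i1 t / r0 * (g s i0 i1 t / r0) + a1 / r0 * (a1 / r0) = p2 i1).
{ replace (_ + _) with ((g s i0 i1 t * g s i0 i1 t + a1 * a1) / (r0 * r0)) by (field; lra).
  rewrite s1, r00. unfold m01. field. lra. }
assert (n2 : g s i0 i2 t / r0 * (g s i0 i2 t / r0) + e * a2 / r0 * (e * a2 / r0) = p2 i2).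
{ replace (_ + _) with ((g s i0 i2 t * g s i0 i2 t + e * e * (a2 * a2)) / (r0 * r0)) by (field; lra).
  rewrite ee, s2, r00. unfold m02. field. lra. }
assert (n12 : g s i0 i1 t / r0 * (g s i0 i2 t / r0) + a1 / r0 * (e * a2 / r0) = g s i1 i2 t).
{ replace (_ + _) with ((g s i0 i1 t * g s i0 i2 t + e * (a1 * a2)) / (r0 * r0)) by (field; lra).
  rewrite ec, r00. unfold c. field. lra. }
assert (n01 : r0 * (g s i0 i1 t / r0) = g s i0 i1 t) by (field; lra).
assert (n02 : r0 * (g s i0 i2 t / r0) = g s i0 i2 t) by (field; lra).
assert (gs : forall i j, g s i j t = g s j i t) by (intros; unfold g; field).
assert (gii : forall i, g s i i t = p2 i) by (intros; unfold g; field).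
assert (dot : forall i j, v i * v j + v' i * v' j = g s i j t).
{ intros [| |] [| |]; unfold v, v'; rewrite ?gii, ?(gs i1 i0), ?(gs i2 i0), ?(gs i2 i1); lra. }
exists v, v'. intros i j. split; [|rewrite dot; apply gii].
transitivity (v i * v i + v' i * v' i + (v j * v j + v' j * v' j) - 2 * (v i * v j + v' i * v' j)); [ring|].
rewrite !dot, !gii. unfold g. field.
Qed.

Lemma second_placement_between : exists t (A B v v' : I3 -> R), 0 < t /\
  (forall i, A i * A i + B i * B i = p0 i) /\
  (forall i, (A i - t) * (A i - t) + B i * B i = p1 i) /\
  (forall i, v i * v i + v' i * v' i = p2 i) /\
  (forall i j, (v i - v j) * (v i - v j) + (v' i - v' j) * (v' i - v' j) =
    (A i - A j) * (A i - A j) + (B i - B j) * (B i - B j)) /\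
  (t <> t0 \/ exists i j, (A i - A j) * (A i - A j) + (B i - B j) * (B i - B j) <>
    (x i - x j) * (x i - x j) + (y i - y j) * (y i - y j)).
Proof.
destruct second_zero as [s [t [ht [Hst [s1 ne]]]]].
destruct (gram_vectors s t Hst) as [v [v' hv]].
assert (tp := ta_pos).
assert (norm : forall i, X i t * X i t + Y s i t * Y s i t = p0 i).
{ intros i. unfold Y. assert (q := sqrt_sqrt _ (h_nonneg i t ht)).
  transitivity (X i t * X i t + (s i * s i) * (sqrt (h i t) * sqrt (h i t))); [ring|].
  rewrite s1, q. unfold h. ring. }
exists t, (fun i => X i t), (fun i => Y s i t), v, v'.
split; [lra|]. split; [exact norm|]. split; [|split; [|split]].
- intros i. transitivity (X i t * X i t + Y s i t * Y s i t - 2 * t * X i t + t * t); [ring|].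
  rewrite norm. unfold X. field. lra.
- intros i. apply (hv i i).
- intros i j. apply (hv i j).
- destruct (Req_dec t t0) as [->|n]; [|left; exact n]. destruct ne as [ne|[i [j [ei ej]]]].
  { exfalso. apply ne. reflexivity. }
  right. exists i, j. rewrite !X_t0. assert (Yi := Y_t0 i). assert (Yj := Y_t0 j). unfold Y in *.
  rewrite ei, ej, Yi. replace (- eps j * sqrt (h j t0)) with (- y j) by (rewrite <- Yj; ring).
  intro E. apply (Rmult_integral_contrapositive_currified _ _ (y_neq0 i) (y_neq0 j)). lra.
Qed.
End Ends.

Lemma second_placement_aux : exists t (A B v v' : I3 -> R), 0 < t /\
  (forall i, A i * A i + B i * B i = x i * x i + y i * y i) /\
  (forall i, (A i - t) * (A i - t) + B i * B i = (x i - t0) * (x i - t0) + y i * y i) /\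
  (forall i, v i * v i + v' i * v' i = (x i - u) * (x i - u) + (y i - w) * (y i - w)) /\
  (forall i j, (v i - v j) * (v i - v j) + (v' i - v' j) * (v' i - v' j) =
    (A i - A j) * (A i - A j) + (B i - B j) * (B i - B j)) /\
  (t <> t0 \/ exists i j, (A i - A j) * (A i - A j) + (B i - B j) * (B i - B j) <>
    (x i - x j) * (x i - x j) + (y i - y j) * (y i - y j)).
Proof.
destruct exists_tmax as [kmax hmax]. destruct exists_tmin as [kmin hmin].
exact (second_placement_between kmax kmin hmax hmin).
Qed.
End Loop.

(** The rigidity hypothesis speaks of velocities: the origin is at rest, the centre [(t0, 0)] has
    velocity [(1, 0)] and the third centre has velocity [(c, d)]. *)
Lemma second_placement (t0 u w : R) (x y : I3 -> R) :
  0 < t0 -> (forall i, y i <> 0) -> x i0 + x i0 <> t0 ->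
  crs u (x i0) (x i1) w (y i0) (y i1) <> 0 ->
  crs u (x i0) (x i2) w (y i0) (y i2) <> 0 ->
  crs (x i0) (x i1) (x i2) (y i0) (y i1) (y i2) <> 0 ->
  (forall (a b : I3 -> R) (c d : R), (forall i, x i * a i + y i * b i = 0) ->
    (forall i, (x i - t0) * (a i - 1) + y i * b i = 0) ->
    (forall i, (x i - u) * (a i - c) + (y i - w) * (b i - d) = 0) -> False) ->
  exists t (A B v v' : I3 -> R), 0 < t /\
  (forall i, A i * A i + B i * B i = x i * x i + y i * y i) /\
  (forall i, (A i - t) * (A i - t) + B i * B i = (x i - t0) * (x i - t0) + y i * y i) /\
  (forall i, v i * v i + v' i * v' i = (x i - u) * (x i - u) + (y i - w) * (y i - w)) /\
  (forall i j, (v i - v j) * (v i - v j) + (v' i - v' j) * (v' i - v' j) =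
    (A i - A j) * (A i - A j) + (B i - B j) * (B i - B j)) /\
  (t <> t0 \/ exists i j, (A i - A j) * (A i - A j) + (B i - B j) * (B i - B j) <>
    (x i - x j) * (x i - x j) + (y i - y j) * (y i - y j)).
Proof.
intros tp y0 x0 c01 c02 c012 rig.
apply second_placement_aux; try assumption; [intro; apply x0; lra|]. intro S.
set (r := rho t0 u w x y) in S. set (k := crs u (x i0) (x i1) w (y i0) (y i1)) in *.
(* Cramer's rule for the velocity of the third centre that preserves its distances to the first two
   points; [S] then preserves the third distance. *)
set (c := (r i0 * (y i1 - w) - r i1 * (y i0 - w)) / k).
set (d := ((x i0 - u) * r i1 - (x i1 - u) * r i0) / k).
assert (rc : forall i, r i = (x i - u) * c + (y i - w) * d).
{ intros i. apply (Rmult_eq_reg_l k); [|exact c01].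
  transitivity ((x i - u) * (r i0 * (y i1 - w) - r i1 * (y i0 - w)) +
    (y i - w) * ((x i0 - u) * r i1 - (x i1 - u) * r i0)).
  2:{ unfold c, d. field. exact c01. }
  destruct i; [unfold k, crs; ring | unfold k, crs; ring|].
  unfold k, crs in *. lra. }
apply (rig (vx t0 x) (vy t0 x y) c d); intros i.
- unfold vx, vy. field. split; [apply y0|lra].
- unfold vx, vy. field. split; [apply y0|lra].
- assert (q := rc i). unfold r, rho in q. lra.
Qed.
End BipartiteLoop.

(** * Minima on compact sets *)

Module CompactMin.
Import Rdefinitions all_boot all_order all_algebra.
Import Rstruct boolp classical_sets reals topology normedtype derive.
Import Order.TTheory GRing.Theory Num.Theory numFieldNormedType.Exports.
Local Open Scope ring_scope.
Local Open Scope classical_set_scope.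
Bind Scope ring_scope with R.

(** Closedness and continuity are spelled out in the sup norm, so that later parts need no topology;
    the extreme value theorem is transported from row vectors. *)
Lemma continuous_min_on_compact (R' : realType) n (K : ('I_n -> R') -> Prop) (F : ('I_n -> R') -> R') M :
  (exists x, K x) -> (forall x, K x -> forall i, `|x i| <= M) ->
  (forall x, (forall d, 0 < d -> exists2 y, K y & forall i, `|y i - x i| < d) -> K x) ->
  (forall x r, 0 < r -> exists2 d, 0 < d &
     forall y, (forall i, `|y i - x i| < d) -> `|F y - F x| < r) ->
  exists2 x, K x & forall y, K y -> F x <= F y.
Proof.
move=> [x0 Kx0] bK clK cF.
pose f (v : 'rV[R']_n) := fun i => v ord0 i.
have fK (x : 'I_n -> R') : f (\row_i x i) = x by apply: funext => i; rewrite /f mxE.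
pose A : set 'rV[R']_n := [set v | K (f v)].
have [||v0|c cA cmin] := @EVT_min_rV R' n (F \o f) A.
- by exists (\row_i x0 i); rewrite /A /= fK.
- have Mnco : compact [set v : 'rV[R']_n | forall i, `[(- M), M]%classic (v ord0 i)].
    apply: (@rV_compact _  _ (fun=> `[(- M), M]%classic)).
    by move=> _; apply: segment_compact.
  apply: subclosed_compact Mnco _ => [v clv|v Kv i]; last first.
    by rewrite /= in_itv /= -ler_norml; apply: bK Kv i.
  apply: clK => d d0; have [w [Kw vw]] := clv _ (nbhsx_ballx v d d0).
  exists (f w) => // i; case: vw => _ /(_ ord0 i).
  by rewrite /ball /= distrC.
- move: v0; apply: continuous_subspaceT => v B /nbhs_ballP[r /= r0 rB].
  have [d d0 dP] := cF (f v) r r0; apply/nbhs_ballP; exists d => // w vw; apply: rB.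
  rewrite /ball /= distrC; apply: dP => i; case: vw => _ /(_ ord0 i).
  by rewrite /ball /= distrC.
exists (f c); first by rewrite inE in cA.
move=> y Ky; have := cmin (\row_i y i); rewrite /= fK; apply.
by rewrite inE /A /= fK.
Qed.

Lemma continuous_min_on_compactR n (K : ('I_n -> R) -> Prop) (F : ('I_n -> R) -> R) (M : R) :
  (exists x, K x) -> (forall x, K x -> forall i, `|x i| <= M) ->
  (forall x, (forall d, 0 < d -> exists2 y, K y & forall i, `|y i - x i| < d) -> K x) ->
  (forall x r, 0 < r -> exists2 d, 0 < d &
     forall y, (forall i, `|y i - x i| < d) -> `|F y - F x| < r) ->
  exists2 x, K x & forall y, K y -> F x <= F y.
Proof. exact: (@continuous_min_on_compact (R : realType)). Qed.
End CompactMin.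

From Stdlib Require Import Rdefinitions Raxioms.
From mathcomp Require Import all_boot all_order all_algebra.
From mathcomp Require Import perm boolp Rstruct mpoly ring lra zify.
Set Implicit Arguments. Unset Strict Implicit. Unset Printing Implicit Defensive.
Import Order.TTheory GRing.Theory Num.Theory BipartiteLoop CompactMin.
Local Open Scope ring_scope.
Bind Scope ring_scope with R.

(** * Rational polynomials at real points *)

Definition ratrP : {rmorphism rat -> {poly R}} := (polyC \o @ratr R).

Section RatPoly.
Variable n : nat.
Implicit Types (P Q : {mpoly rat[n]}) (x h : 'I_n -> R).

Definition rev P x : R := mmap (@ratr R) x P.

Lemma revE P x : (map_mpoly (@ratr R) P).@[x] = rev P x.
Proof.
rewrite /rev; elim/mpolyind: P => [|c m P _ _ IH]; first by rewrite !raddf0.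
by rewrite !raddfD /= IH map_mpolyZ map_mpolyX mevalZ mevalX mmapZ mmapX.
Qed.

Lemma eq_rev P x y : x =1 y -> rev P x = rev P y.
Proof.
by move=> xy; apply: eq_bigr => m _; rewrite (mmap1_eq m xy).
Qed.

Definition restrict P x h : {poly R} :=
  mmap ratrP (fun i => (x i)%:P + h i *: 'X) P.

Lemma horner_mmap (g : 'I_n -> {poly R}) P t :
  (mmap ratrP g P).[t] = rev P (fun i => (g i).[t]).
Proof.
rewrite /rev /mmap horner_sum; apply: eq_bigr => m _.
by rewrite hornerM hornerC horner_prod; congr (_ * _); apply: eq_bigr => i _; rewrite horner_exp.
Qed.
End RatPoly.

Lemma restrictE n (P : {mpoly rat[n]}) x h t :
  (restrict P x h).[t] = rev P (fun i => x i + t * h i).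
Proof. by rewrite horner_mmap; apply: eq_rev => i; rewrite !hornerE mulrC. Qed.

Lemma poly_eq0_on_reals (p : {poly R}) : (forall t, p.[t] = 0) -> p = 0.
Proof.
move=> p0; apply: (@roots_geq_poly_eq0 _ p [seq i%:R | i <- iota 0 (size p)]).
- by apply/allP => _ /mapP[i _ ->]; apply/rootP.
- by rewrite map_inj_uniq ?iota_uniq // => i j /eqP; rewrite eqr_nat => /eqP.
- by rewrite size_map size_iota.
Qed.

Lemma poly_roots_list (p : {poly R}) :
  p != 0 -> exists s : seq R, forall t, p.[t] = 0 -> t \in s.
Proof.
have [k] := ubnP (size p); elim: k p => // k IH p szp p0.
have [[a /factor_theorem[q pE]]|nr] := EM (exists a, root p a); last first.
  by exists [::] => t /rootP rt; case: nr; exists t.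
have q0 : q != 0 by apply: contra_neq p0; rewrite pE => ->; rewrite mul0r.
have [|s sP] := IH q _ q0.
  by move: szp; rewrite pE size_Mmonic ?monicXsubC // size_XsubC addn2.
exists (a :: s) => t; rewrite pE hornerM hornerXsubC => /eqP.
by rewrite mulf_eq0 subr_eq0 inE orbC => /orP[->//|/eqP/sP->]; rewrite orbT.
Qed.

(** * Avoiding countably many real numbers *)

Section Uncountable.
Variable u : nat -> R.

(** Cantor's nested intervals: the next interval is the outer quarter lying on the other side of the
    midpoint from [u k']. *)
Fixpoint avoid_itv (k : nat) : R * R :=
  if k is k'.+1 then
    let: (a, b) := avoid_itv k' in
    if u k' <= (a + b) / 2 then ((a + b *+ 3) / 4, b) else (a, (a *+ 3 + b) / 4)
  else (0, 1).

Lemma avoid_itv_lt k : (avoid_itv k).1 < (avoid_itv k).2.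
Proof.
by elim: k => [|k] /=; [lra | case: (avoid_itv k) => a b /=; case: ifP => _ /=; lra].
Qed.

Lemma avoid_itvS k : (avoid_itv k).1 <= (avoid_itv k.+1).1 /\
  (avoid_itv k.+1).2 <= (avoid_itv k).2.
Proof.
by move: (avoid_itv_lt k) => /=; case: (avoid_itv k) => a b /=; case: ifP => _ /=; lra.
Qed.

Lemma avoid_itv_nest k j : (k <= j)%N -> (avoid_itv k).1 <= (avoid_itv j).1 /\
  (avoid_itv j).2 <= (avoid_itv k).2.
Proof.
move=> /subnK <-; elim: (j - k)%N => [|i [IH1 IH2]]; first by rewrite add0n.
by rewrite addSn; have [? ?] := avoid_itvS (i + k); split; [apply: le_trans IH1 _|apply: le_trans IH2].
Qed.

Lemma avoid_itv_cross k j : (avoid_itv k).1 <= (avoid_itv j).2.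
Proof.
have [kj|jk] := leqP k j.
  by have [le1 _] := avoid_itv_nest kj; apply: le_trans le1 (ltW (avoid_itv_lt j)).
by have [_ le2] := avoid_itv_nest (ltnW jk); apply: le_trans (ltW (avoid_itv_lt k)) le2.
Qed.

Lemma reals_uncountable : exists x : R, forall k, x <> u k.
Proof.
have [||x [xub xlub]] := completeness (fun y => exists k, y = (avoid_itv k).1).
- by exists 1 => _ [k ->]; apply/RleP; exact: (avoid_itv_cross k 0).
- by exists 0, 0%N.
exists x => k xk.
have h1 : (avoid_itv k.+1).1 <= x by apply/RleP/xub; exists k.+1.
have h2 : x <= (avoid_itv k.+1).2.
  by apply/RleP/xlub => _ [j ->]; apply/RleP/avoid_itv_cross.
have := avoid_itv_lt k; move: h1 h2; rewrite xk /=.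
by case: (avoid_itv k) => a b /=; case: ifPn => /=; rewrite -?ltNge; lra.
Qed.
End Uncountable.

(** Finite root sets indexed by a countable type are listed in one sequence; padding it with zeros
    only excludes one more value. *)
Lemma avoid_roots (I : countType) (g : I -> {poly R}) :
  (forall i, g i != 0) -> exists t, forall i, (g i).[t] != 0.
Proof.
move=> g0.
have [rs rsP] : {rs : I -> seq R & forall i t, (g i).[t] = 0 -> t \in rs i}.
  by apply: (@choice I (seq R)
    (fun i s => forall t, (g i).[t] = 0 -> t \in s)) => i; apply: poly_roots_list.
pose u k := if unpickle k is Some (i, j) then nth 0 (rs i) j else 0 : R.
have [x xP] := reals_uncountable u; exists x => i; apply/eqP => /rsP xr.
by apply: (xP (pickle (i, index x (rs i)))); rewrite /u pickleK nth_index.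
Qed.

(** Codes in a countable type let [avoid_roots] handle all rational polynomials at once. *)
Section MPolyCountable.
Variable n : nat.
Definition mpoly_code (P : {mpoly rat[n]}) : seq ('X_{1..n} * rat) :=
  [seq (m, P@_m) | m <- msupp P].
Definition mpoly_decode (s : seq ('X_{1..n} * rat)) : {mpoly rat[n]} :=
  \sum_(c <- s) c.2 *: 'X_[c.1].
Lemma mpoly_codeK : cancel mpoly_code mpoly_decode.
Proof. by move=> P; rewrite /mpoly_decode big_map /= -mpolyE. Qed.
End MPolyCountable.


Section ChainRule.
Variables (n : nat) (g : 'I_n -> {poly R}).
Local Notation ev := (mmap ratrP g).

Lemma deriv_mmap (P : {mpoly rat[n]}) :
  (ev P)^`() = \sum_i ev (P^`M(i)) * (g i)^`().
Proof.
elim/mpolyind: P => [|c m P _ _ IH].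
  by rewrite !raddf0 big1 // => i _; rewrite !raddf0 mul0r.
rewrite mmapD derivD IH. rewrite mmapZ /= derivM derivC mul0r add0r.
under [RHS]eq_bigr => i _ do rewrite mderivD mmapD mulrDl mderivZ mmapZ -mulrA.
rewrite big_split /= -mulr_sumr; congr (_ * _ + _).
have [k] := ubnP (mdeg m); elim: k m => // k IHm m mk.
have [/eqP m0|] := boolP (mdeg m == 0)%N.
  move/eqP: m0; rewrite mdeg_eq0 => /eqP ->; rewrite mpolyX0.
  rewrite rmorph1 derivC big1 // => i _; rewrite -mpolyC1 mderivC.
  by rewrite rmorph0 mul0r.
rewrite mdegE sum_nat_eq0 negb_forall => /existsP[i]; rewrite implyTb => mi.
have mE : m = (U_(i) + (m - U_(i)))%MM by rewrite addmC submK // lep1mP.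
have IHm' : (ev 'X_[m - U_(i)])^`() =
   \sum_j ev 'X_[m - U_(i)]^`M(j) * (g j)^`().
  by apply: IHm; move: mk; rewrite [in mdeg m]mE mdegD mdeg1.
rewrite mE mpolyXD rmorphM /= derivM IHm' mmapX mmap1U.
under [RHS]eq_bigr => j _ do rewrite mderivM rmorphD !rmorphM /= mulrDl.
rewrite big_split /=; congr (_ + _); last first.
  by rewrite mulr_sumr; apply: eq_bigr => j _; rewrite (mmapX g ratrP) mmap1U mulrA.
rewrite (bigD1 i) //= big1 ?addr0 => [|j ji].
  rewrite mderivX (mmapZ g ratrP) mnm1E eqxx rmorph1 mul1r.
  by rewrite -{2}[U_(i)%MM]add0m addmK mpolyX0 (rmorph1 (mmap ratrP g)) mul1r mulrC.
by rewrite mderivX mnm1E eq_sym (negPf ji) scale0r (mmap0 g ratrP) !mul0r.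
Qed.
End ChainRule.

Lemma msize_mderiv n (P : {mpoly rat[n]}) i : P != 0 -> (msize P^`M(i) < msize P)%N.
Proof.
move=> P0; rewrite [msize P]mpolySpred // ltnS msizeE.
apply/bigmax_leqP_seq => m; rewrite mcoeff_msupp mcoeff_deriv => H _.
have : (m + U_(i))%MM \in msupp P.
  by rewrite mcoeff_msupp; apply: contra_neq H => ->; rewrite mul0rn.
by move/msize_mdeg_lt; rewrite mdegD mdeg1; case: (msize P) => // d; rewrite addn1.
Qed.

Lemma mderiv_all0 n (P : {mpoly rat[n]}) :
  (forall i, P^`M(i) = 0) -> P = (P@_0%MM)%:MP.
Proof.
move=> dP; apply/mpolyP => m; rewrite mcoeffC.
have [->|m0] := eqVneq m 0%MM; first by rewrite mulr1.
rewrite mulr0; move: m0; rewrite -mdeg_eq0 mdegE sum_nat_eq0 negb_forall.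
case/existsP => i; rewrite implyTb => mi.
have mE : m = ((m - U_(i)) + U_(i))%MM by rewrite submK // lep1mP.
have := mcoeff_deriv i (m - U_(i))%MM P; rewrite dP mcoeff0 -mE => /esym/eqP.
by rewrite mulrn_eq0 /= => /eqP.
Qed.

(** Induction on the size: if [P] vanishes at all real points, so do its partial derivatives, which
    are therefore zero, and [P] is constant. *)
Lemma mpoly_nonzero_point n (P : {mpoly rat[n]}) : P != 0 -> exists x, rev P x != 0.
Proof.
move=> P0; apply: contrapT => nx; move/eqP: P0; apply.
have {nx} : forall x, rev P x = 0.
  by move=> x; apply/eqP; apply: contrapT => /negP h; apply: nx; exists x.
have [k] := ubnP (msize P); elim: k P => // k IH P mk Pz.
have [//|P0] := eqVneq P 0.
have dP i : P^`M(i) = 0.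
  apply: IH; first by apply: leq_trans (msize_mderiv i P0) _.
  move=> x; pose h (j : 'I_n) : R := (j == i)%:R.
  have r0 : restrict P x h = 0.
    by apply: poly_eq0_on_reals => t; rewrite restrictE.
  have := congr1 (fun p => (p^`()).[0]) r0; rewrite /= derivC hornerC.
  rewrite /restrict deriv_mmap horner_sum (bigD1 i) //= big1 ?addr0.
    rewrite hornerM horner_mmap derivD derivC derivZ derivX add0r hornerZ hornerC.
    rewrite /h eqxx !mulr1 => <-; apply: eq_rev => j.
    by rewrite !hornerE.
  move=> j ji; rewrite hornerM derivD derivC derivZ derivX /h (negPf ji) scale0r.
  by rewrite add0r hornerC mulr0.
have := Pz (fun _ => 0); rewrite (mderiv_all0 dP) /rev mmapC => /eqP.
by rewrite fmorph_eq0 => /eqP ->.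
Qed.

Lemma msize_mul_bound n (p q : {mpoly rat[n]}) d e :
  (msize p <= d.+1)%N -> (msize q <= e.+1)%N -> (msize (p * q) <= (d + e).+1)%N.
Proof.
move=> pd qe; have [->|p0] := eqVneq p 0; first by rewrite mul0r msize0.
have [->|q0] := eqVneq q 0; first by rewrite mulr0 msize0.
by rewrite msizeM //; move: (msize p) (msize q) pd qe => a b; lia.
Qed.

Lemma msize_exp_bound n (p : {mpoly rat[n]}) d k :
  (msize p <= d.+1)%N -> (msize (p ^+ k) <= (k * d).+1)%N.
Proof.
move=> pd; elim: k => [|k IH]; first by rewrite expr0 msize1.
by rewrite exprS mulSn; apply: msize_mul_bound.
Qed.

Lemma msize_prod_bound n (I : finType) (F : I -> {mpoly rat[n]}) d :
  (forall i, msize (F i) <= d.+1)%N -> (msize (\prod_i F i) <= (#|I| * d).+1)%N.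
Proof.
move=> Fd; rewrite cardE -(big_enum _ _ predT) /=.
elim: (enum I) => [|i s IH]; first by rewrite big_nil msize1.
by rewrite big_cons /= mulSn; apply: msize_mul_bound.
Qed.

Lemma card_bmultinom n K : (#|{: 'X_{1..n < K}}| <= K ^ n)%N.
Proof.
have lt (m : 'X_{1..n < K}) i : (m i < K)%N.
  by apply: leq_ltn_trans (bmdeg m); rewrite mdegE (bigD1 i) //= leq_addr.
pose f (m : 'X_{1..n < K}) : {ffun 'I_n -> 'I_K} := [ffun i => Ordinal (lt m i)].
have f_inj : injective f.
  move=> m1 m2 /ffunP e; apply/val_inj/mnmP => i.
  by have := e i; rewrite !ffunE => /(congr1 val).
by have := leq_card f f_inj; rewrite card_ffun !card_ord.
Qed.

(* There are more monomials of bounded degree in the [n.+1] polynomials than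
   monomials in the [n] variables for them to span. *)
Lemma algebraically_dependent n (h : 'I_n.+1 -> {mpoly rat[n]}) :
  exists D, exists l : {ffun 'I_n.+1 -> 'I_D.+1} -> rat,
    (exists a, l a != 0) /\ \sum_a l a *: \prod_i h i ^+ a i = 0.
Proof.
pose d := (\max_i msize (h i)).+1.
have hd i : (msize (h i) <= d.+1)%N by apply/leqW/leqW/leq_bigmax.
(* All products have degree below [K <= (n.+1 * d).+1 * D], so at most [D ^ n.+1] monomials face
   [D.+1 ^ n.+1] products. *)
pose D := ((n.+1 * d).+1 ^ n)%N.
pose I := {ffun 'I_n.+1 -> 'I_D.+1}.
pose K := (n.+1 * (D * d)).+1.
pose prd (a : I) := \prod_i h i ^+ a i.
have prdK a : (msize (prd a) <= K)%N.
  have := @msize_prod_bound n 'I_n.+1 (fun i => h i ^+ a i) (D * d)%N.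
  rewrite card_ord; apply => i.
  apply: leq_trans (msize_exp_bound _ (hd i)) _.
  by rewrite ltnS leq_mul2r -ltnS ltn_ord orbT.
pose J := 'X_{1..n < K}.
have cardIJ : (#|{: J}| < #|{: I}|)%N.
  apply: leq_ltn_trans (card_bmultinom n K) _.
  rewrite card_ffun !card_ord.
  apply: (@leq_ltn_trans (((n.+1 * d).+1 * D) ^ n)%N).
    have D0 : (0 < D)%N by rewrite expn_gt0.
    have : (K <= (n.+1 * d).+1 * D)%N by rewrite /K (mulnC D) mulnA mulSn -add1n leq_add2r.
    by case: (n) => // n'; rewrite leq_exp2r.
  rewrite expnMn -/D -expnS.
  have D1 : (D < D.+1)%N by [].
  by rewrite ltn_exp2r.
pose A := \matrix_(i < #|{: I}|, j < #|{: J}|)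
  (prd (enum_val i))@_(val (enum_val j : J)).
have kA : kermx A != 0.
  rewrite -mxrank_eq0 mxrank_ker -lt0n subn_gt0.
  by apply: leq_ltn_trans (rank_leq_col A) cardIJ.
have [i ri] : exists i, row i (kermx A) != 0.
  apply: contrapT => nr; move/eqP: kA; apply; apply/row_matrixP => i.
  by rewrite row0; apply: contrapT => /eqP h0; apply: nr; exists i.
have rA : row i (kermx A) *m A = 0 by rewrite -row_mul mulmx_ker row0.
exists D, (fun a => row i (kermx A) 0 (enum_rank a)); split.
  apply: contrapT => na; move/eqP: ri; apply; apply/rowP => j; rewrite [RHS]mxE.
  apply/eqP; apply: contrapT => /negP h0; apply: na; exists (enum_val j).
  by rewrite enum_valK.
set S := \sum_a _.
have SK : (msize S <= K)%N.
  apply: leq_trans (msize_sum _ _ _) _; apply/bigmax_leqP => a _.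
  by apply: leq_trans (msizeZ_le _ _) _; apply: prdK.
apply/mpolyP => m; rewrite mcoeff0.
have [mK|Km] := ltnP (mdeg m) K; last first.
  by apply: memN_msupp_eq0; apply: msize_mdeg_ge; apply: leq_trans SK Km.
have /rowP/(_ (enum_rank (BMultinom mK : J))) := rA; rewrite !mxE => <-.
rewrite raddf_sum /= (reindex (@enum_val I predT)) /=; last first.
  by exists enum_rank => a _; [rewrite enum_valK | rewrite enum_rankK].
apply: eq_bigr => j _; rewrite mcoeffZ enum_valK [A _ _]mxE enum_rankK.
by [].
Qed.

Definition generic_vec n (x : 'I_n -> R) := forall P : {mpoly rat[n]}, P != 0 -> rev P x != 0.

Lemma deriv_restrict n (P : {mpoly rat[n]}) x h :
  (restrict P x h)^`().[0] = \sum_i rev P^`M(i) x * h i.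
Proof.
rewrite /restrict deriv_mmap horner_sum; apply: eq_bigr => i _.
rewrite hornerM horner_mmap derivD derivC derivZ derivX add0r hornerZ hornerC mulr1.
by congr (_ * _); apply: eq_rev => j; rewrite !hornerE.
Qed.

(** * Finite fibres of polynomial maps at generic points *)

Section FiniteFibre.
Variables (n : nat) (F : 'I_n -> {mpoly rat[n]}) (x : 'I_n -> R).
Hypothesis x_gen : generic_vec x.
Hypothesis jac : forall h : 'I_n -> R,
  (forall j, \sum_i rev (F j)^`M(i) x * h i = 0) -> forall i, h i = 0.

Lemma rev_comp (c : {mpoly rat[n]}) y :
  rev (c \mPo [tuple F j | j < n]) y = rev c (fun j => rev (F j) y).
Proof.
rewrite /rev; elim/mpolyind: c => [|a m c _ _ IH]; first by rewrite !raddf0.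
rewrite comp_mpolyD !mmapD comp_mpolyZ !mmapZ IH comp_mpolyX mmapX; congr (_ * _ + _).
rewrite (rmorph_prod (mmap (@ratr R) y)); apply: eq_bigr => j _.
by rewrite tnth_mktuple (rmorphXn (mmap (@ratr R) y)).
Qed.

Lemma jac_left (l : 'I_n -> R) :
  (forall i, \sum_j rev (F j)^`M(i) x * l j = 0) -> forall j, l j = 0.
Proof.
move=> lP; pose M : 'M[R]_n := \matrix_(i, j) rev (F j)^`M(i) x.
have Mu : M \in unitmx.
  rewrite -row_free_unit -kermx_eq0; apply/eqP/row_matrixP => i; rewrite row0.
  have : row i (kermx M) *m M = 0 by rewrite -row_mul mulmx_ker row0.
  move: (row i _) => v vM; apply/rowP => j; rewrite [RHS]mxE.
  apply: (jac (h := fun j => v 0 j)) => k.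
  have /rowP/(_ k) := vM; rewrite !mxE => hk; rewrite -[RHS]hk. apply: eq_bigr => i' _.
  by rewrite mxE mulrC.
have Ml : M *m (\col_j l j) = 0.
  by apply/colP => i; rewrite !mxE -[RHS](lP i); apply: eq_bigr => j _; rewrite !mxE.
move=> j; have := mulKmx Mu (\col_j l j); rewrite Ml mulmx0 => /colP/(_ j).
by rewrite !mxE.
Qed.

(** Since [x] is generic, [c] composed with [F] is the zero polynomial. By the chain rule the
    invertible Jacobian kills the gradient of [c] at the values of [F], so by induction on the size
    all partial derivatives of [c] are zero, and [c] is a constant with value zero. *)
Lemma values_independent (c : {mpoly rat[n]}) :
  rev c (fun j => rev (F j) x) = 0 -> c = 0.
Proof.
have [k] := ubnP (msize c); elim: k c => // k IH c ck c0.
have [//|cn0] := eqVneq c 0.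
have cF0 y : rev c (fun j => rev (F j) y) = 0.
  rewrite -rev_comp; suff -> : c \mPo [tuple F j | j < n] = 0 by rewrite /rev raddf0.
  by apply/eqP; apply: contraTT isT => /x_gen; rewrite rev_comp c0 eqxx.
have dc j : c^`M(j) = 0.
  apply: IH; first by apply: leq_trans (msize_mderiv j cn0) _.
  move: j; apply: jac_left => i; pose h (j : 'I_n) : R := (j == i)%:R.
  pose g j := restrict (F j) x h.
  have g0 : mmap ratrP g c = 0.
    apply: poly_eq0_on_reals => t; rewrite horner_mmap -[RHS](cF0 (fun i => x i + t * h i)).
    by apply: eq_rev => j; rewrite /g restrictE.
  have := congr1 (fun p => (p^`()).[0]) g0; rewrite /= derivC hornerC.
  rewrite deriv_mmap horner_sum => E0; rewrite -[RHS]E0; apply: eq_bigr => j _.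
  rewrite hornerM horner_mmap deriv_restrict mulrC; congr (_ * _).
    by apply: eq_rev => j'; rewrite /g restrictE; apply: eq_rev => i'; rewrite mul0r addr0.
  rewrite (bigD1 i) //= /h eqxx mulr1 big1 ?addr0 // => i' /negPf ->.
  by rewrite mulr0.
move: c0; rewrite (mderiv_all0 dc) /rev mmapC => /eqP.
by rewrite fmorph_eq0 => /eqP ->.
Qed.

(** The variable ['X_i] and the [n] polynomials [F j] satisfy an algebraic relation. Substituting
    for the [F j] their values at [x] leaves a one-variable polynomial [G] that vanishes at [y i]
    for every [y] of the fibre. *)
Lemma finite_fibre1 (i : 'I_n) : exists s : seq R, forall y,
  (forall j, rev (F j) y = rev (F j) x) -> y i \in s.
Proof.
pose h (j : 'I_n.+1) := if unlift ord0 j is Some k then F k else 'X_i.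
have [D [l [[a la] lsum]]] := algebraically_dependent h.
pose Fx j := rev (F j) x.
pose w (b : {ffun 'I_n.+1 -> 'I_D.+1}) := \prod_j Fx j ^+ b (lift ord0 j).
pose G : {poly R} := \sum_(b : {ffun 'I_n.+1 -> 'I_D.+1}) (ratr (l b) * w b) *: 'X^(b ord0).
(* Its coefficient in degree [a ord0] is a nonzero polynomial [c] at the values of [F], which are
   independent. *)
have G0 : G != 0.
  pose mon (b : {ffun 'I_n.+1 -> 'I_D.+1}) : 'X_{1..n} :=
    [multinom (b (lift ord0 j) : nat) | j < n].
  pose c : {mpoly rat[n]} := \sum_(b : {ffun 'I_n.+1 -> 'I_D.+1} | b ord0 == a ord0) l b *: 'X_[mon b].
  have c0 : c != 0.
    apply: contra_neq la => /(congr1 (mcoeff (mon a))); rewrite mcoeff0 raddf_sum /=.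
    rewrite (bigD1 a) //= mcoeffZ mcoeffX eqxx mulr1 big1 ?addr0 // => b.
    case/andP => /eqP b0 ba; rewrite mcoeffZ mcoeffX; case: eqP => [e|]; last by rewrite mulr0.
    case/eqP: ba; apply/ffunP => j; case: (unliftP ord0 j) => [k ->|-> //].
    by apply/val_inj; have /mnmP/(_ k) := e; rewrite !mnmE.
  apply: contra_neq c0 => /(congr1 (fun p : {poly R} => p`_(a ord0))).
  rewrite coef0 coef_sum => Ga; apply: values_independent.
  rewrite /rev raddf_sum /= -[RHS]Ga big_mkcond /=; apply: eq_bigr => b _.
  rewrite coefZ coefXn eq_sym val_eqE.
  case: ifP => _; last by rewrite mulr0.
  by rewrite mmapZ mmapX mulr1; congr (_ * _); apply: eq_bigr => j _; rewrite mnmE.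
have [s sP] := poly_roots_list G0; exists s => y yx; apply: sP.
have := congr1 (fun P => rev P y) lsum; rewrite /rev mmap0 raddf_sum /= => <-.
rewrite horner_sum; apply: eq_bigr => b _; rewrite hornerZ hornerXn mmapZ -mulrA; congr (_ * _).
rewrite (rmorph_prod (mmap (@ratr R) y)) big_ord_recl /= mulrC; congr (_ * _).
  rewrite (rmorphXn (mmap (@ratr R) y)) /h unlift_none.
  by congr (_ ^+ _); rewrite -[RHS]/(rev _ y) /rev mmapX mmap1U.
apply: eq_bigr => j _; rewrite (rmorphXn (mmap (@ratr R) y)) /h liftK.
by congr (_ ^+ _); apply/esym/yx.
Qed.

Lemma finite_fibre : exists s : seq R, forall y,
  (forall j, rev (F j) y = rev (F j) x) -> forall i, y i \in s.
Proof.
have [rs rsP] := choice finite_fibre1.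
exists (flatten [seq rs i | i <- enum 'I_n]) => y yx i.
by apply/flattenP; exists (rs i); [apply: map_f; rewrite mem_enum | apply: rsP].
Qed.
End FiniteFibre.

(** The coordinates are fixed one at a time, so that each nonzero polynomial remains nonzero
    somewhere in the other coordinates; each choice avoids the roots of countably many one-variable
    polynomials. *)
Lemma generic_vec_exists n : exists x : 'I_n -> R, generic_vec x.
Proof.
suff [x xP] : exists x : 'I_n -> R, forall P : {mpoly rat[n]}, P != 0 ->
    exists2 y, (forall i : 'I_n, (i < n)%N -> y i = x i) & rev P y != 0.
  exists x => P /xP[y yx]; rewrite (@eq_rev _ _ y x) // => i; exact: yx.
suff: forall k, (k <= n)%N -> exists x : 'I_n -> R, forall P : {mpoly rat[n]}, P != 0 ->
    exists2 y, (forall i : 'I_n, (i < k)%N -> y i = x i) & rev P y != 0.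
  by apply.
elim=> [_|k IH kn].
  by exists (fun _ => 0) => P /mpoly_nonzero_point[y yP]; exists y.
have [x xP] := IH (ltnW kn); pose j := Ordinal kn.
have [Y YP] : {Y : seq ('X_{1..n} * rat) -> 'I_n -> R & forall c, mpoly_decode c != 0 ->
   (forall i : 'I_n, (i < k)%N -> Y c i = x i) /\ rev (mpoly_decode c) (Y c) != 0}.
  apply: (@choice _ _ (fun c y => mpoly_decode c != 0 ->
     (forall i : 'I_n, (i < k)%N -> y i = x i) /\ rev (mpoly_decode c) y != 0)) => c.
  have [->|c0] := eqVneq (mpoly_decode c) 0; first by exists x.
  by have [y yx yc] := xP _ c0; exists y.
pose base c i := if i == j then 0 else Y c i.
pose dj (i : 'I_n) : R := (i == j)%:R.
pose g c : {poly R} := if mpoly_decode c == 0 then 1 else restrict (mpoly_decode c) (base c) dj.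
have [c|t tP] := @avoid_roots _ g.
  rewrite /g; case: ifPn => [_|c0]; first exact: oner_neq0.
  have [_] := YP _ c0; apply: contra_neq => /(congr1 (fun p => p.[Y c j])).
  rewrite restrictE horner0 => <-; apply: eq_rev => i; rewrite /base /dj.
  by case: eqP => [->|_]; rewrite ?add0r ?mulr1 ?mulr0 ?addr0.
exists (fun i => if i == j then t else x i) => P P0.
pose c := mpoly_code P; have cP : mpoly_decode c = P := mpoly_codeK P.
exists (fun i => if i == j then t else Y c i).
  have [|yx _] := YP c; first by rewrite cP.
  move=> i ik; case: eqP => // /eqP ij; apply: yx.
  by rewrite ltn_neqAle -ltnS ik andbT.
have := tP c; rewrite /g cP (negPf P0) restrictE; apply: contra_neq => <-.
by apply: eq_rev => i; rewrite /base /dj; case: eqP => _; rewrite ?add0r ?mulr1 ?mulr0 ?addr0.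
Qed.

(** An abscissa is chosen first, such that no [Z j] vanishes identically on its vertical line, and
    then an ordinate. *)
Lemma avoid_plane (J : countType) (Z : J -> R -> R -> R) :
  (forall j y, exists g : {poly R}, forall x, Z j x y = g.[x]) ->
  (forall j x, exists g : {poly R}, forall y, Z j x y = g.[y]) ->
  (forall j, exists x y, Z j x y != 0) ->
  exists x y, forall j, Z j x y != 0.
Proof.
move=> Z1 Z2 Z0.
have [X0 XP] := choice Z0; have [Y0 YP] := choice XP.
have [g gP] := choice (fun j => Z1 j (Y0 j)).
have [j|x xP] := @avoid_roots J g.
  by apply: contra_neq (YP j) => g0; rewrite gP g0 horner0.
have [h hP] := choice (fun j => Z2 j x).
have [j|y yP] := @avoid_roots J h.
  by have := xP j; apply: contra_neq => h0; rewrite -gP hP h0 horner0.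
by exists x, y => j; rewrite hP.
Qed.

(** * Generic realisations and infinitesimal rigidity *)

(** Injectivity is witnessed by one square minor, whose nonvanishing is a polynomial condition and
    passes to generic points. *)
Lemma select_rows n (I : finType) (a : I -> 'I_n -> R) :
  (forall h : 'I_n -> R, (forall r, \sum_i a r i * h i = 0) -> forall i, h i = 0) ->
  exists f : 'I_n -> I, (\matrix_(j < n, i < n) a (f j) i) \in unitmx.
Proof.
move=> ker; pose A : 'M[R]_(#|I|, n) := \matrix_(r, i) a (enum_val r) i.
have Afull : row_full A.
  rewrite /row_full -mxrank_tr -/(row_free A^T) -kermx_eq0; apply/eqP/row_matrixP => i; rewrite row0.
  have : row i (kermx A^T) *m A^T = 0 by rewrite -row_mul mulmx_ker row0.
  move: (row i _) => v vA; apply/rowP => j; rewrite [RHS]mxE.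
  apply: (ker (fun j => v 0 j)) => r.
  have /rowP/(_ (enum_rank r)) := vA; rewrite !mxE => hr; rewrite -[RHS]hr.
  by apply: eq_bigr => i' _; rewrite !mxE enum_rankK mulrC.
exists (fun j => enum_val (fullrankfun Afull j)).
have := fullrowsub_unit Afull; congr (_ \in unitmx).
by apply/matrixP => i j; rewrite !mxE.
Qed.

Lemma kernel_unitmx n (M : 'M[R]_n) (h : 'I_n -> R) : M \in unitmx ->
  (forall j, \sum_i M j i * h i = 0) -> forall i, h i = 0.
Proof.
move=> Mu hP i; have Mh : M *m (\col_i h i) = 0.
  by apply/colP => j; rewrite !mxE -[RHS](hP j); apply: eq_bigr => k _; rewrite mxE.
by have := mulKmx Mu (\col_i h i); rewrite Mh mulmx0 => /colP/(_ i); rewrite !mxE.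
Qed.

Section Realisations.
Variable T : finType.
Implicit Types (p q m : realisation T) (W : {set T}) (e : rel T).
Local Notation N := #|{: T * 'I_2}|.

Definition vec p (i : 'I_N) : R := coord_of p (enum_val i).
Definition unvec (h : 'I_N -> R) : realisation T :=
  fun x => (h (enum_rank (x, ord0)), h (enum_rank (x, ord_max))).

Lemma ord2E (k : 'I_2) : k = ord0 \/ k = ord_max.
Proof. by case: k => [[|[|//]] ?]; [left|right]; apply/val_inj. Qed.

Lemma unvecK h : vec (unvec h) =1 h.
Proof.
move=> i; rewrite /vec /coord_of /unvec; case E: (enum_val i) => [x k] /=.
by case: (ord2E k) E => -> /= <-; rewrite enum_valK.
Qed.

Lemma vec_rank p x : vec p (enum_rank (x, ord0)) = (p x).1 /\
  vec p (enum_rank (x, ord_max)) = (p x).2.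
Proof. by rewrite /vec !enum_rankK. Qed.

Lemma genericE p : generic_real p <-> generic_vec (vec p).
Proof. by split=> g P P0; have := g P P0; rewrite revE. Qed.

Lemma generic_exists : exists p : realisation T, generic_real p.
Proof.
have [x xg] := generic_vec_exists N; exists (unvec x); apply/genericE => P /xg.
by rewrite (eq_rev P (unvecK x)).
Qed.

Definition polyfun (F : realisation T -> R) :=
  exists P : {mpoly rat[N]}, forall p, F p = rev P (vec p).

Lemma polyfun_rev P : polyfun (fun p => rev P (vec p)).
Proof. by exists P. Qed.

Lemma polyfunC (c : rat) : polyfun (fun _ => ratr c).
Proof. by exists c%:MP => p; rewrite /rev mmapC. Qed.

Lemma polyfun0 : polyfun (fun _ => 0).
Proof. by exists 0 => p; rewrite /rev mmap0. Qed.

Lemma polyfun1 : polyfun (fun _ => 1).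
Proof. by exists 1 => p; rewrite /rev rmorph1. Qed.

Lemma polyfunX1 x : polyfun (fun p => (p x).1).
Proof.
exists 'X_(enum_rank (x, ord0)) => p; rewrite /rev mmapX mmap1U.
by case: (vec_rank p x).
Qed.

Lemma polyfunX2 x : polyfun (fun p => (p x).2).
Proof.
exists 'X_(enum_rank (x, ord_max)) => p; rewrite /rev mmapX mmap1U.
by case: (vec_rank p x).
Qed.

Lemma polyfunD F G : polyfun F -> polyfun G -> polyfun (fun p => F p + G p).
Proof. by move=> [P FP] [Q GQ]; exists (P + Q) => p; rewrite FP GQ /rev mmapD. Qed.

Lemma polyfunN F : polyfun F -> polyfun (fun p => - F p).
Proof. by move=> [P FP]; exists (- P) => p; rewrite FP /rev mmapN. Qed.

Lemma polyfunB F G : polyfun F -> polyfun G -> polyfun (fun p => F p - G p).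
Proof. by move=> hF hG; apply: polyfunD => //; apply: polyfunN. Qed.

Lemma polyfunM F G : polyfun F -> polyfun G -> polyfun (fun p => F p * G p).
Proof.
move=> [P FP] [Q GQ]; exists (P * Q) => p.
by rewrite FP GQ /rev (rmorphM (mmap (@ratr R) (vec p))).
Qed.

Lemma polyfun_sum (I : Type) (s : seq I) (A : pred I) (F : I -> realisation T -> R) :
  (forall i, polyfun (F i)) -> polyfun (fun p => \sum_(i <- s | A i) F i p).
Proof.
move=> hF; elim: s => [|i s IH].
  by have [P PP] := polyfun0; exists P => p; rewrite big_nil -PP.
have [Q QP] : polyfun (fun p => F i p + \sum_(j <- s | A j) F j p) by apply: polyfunD.
case: IH => P PP; exists (if A i then Q else P) => p; rewrite big_cons.
by case: ifP => _; rewrite ?QP ?PP.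
Qed.

Lemma polyfun_prod (I : Type) (s : seq I) (F : I -> realisation T -> R) :
  (forall i, polyfun (F i)) -> polyfun (fun p => \prod_(i <- s) F i p).
Proof.
move=> hF; elim: s => [|i s IH].
  by have [P PP] := polyfun1; exists P => p; rewrite big_nil -PP.
have [Q QP] : polyfun (fun p => F i p * \prod_(j <- s) F j p) by apply: polyfunM.
by exists Q => p; rewrite big_cons QP.
Qed.

Lemma polyfun_det n (A : 'I_n -> 'I_n -> realisation T -> R) :
  (forall i j, polyfun (A i j)) -> polyfun (fun p => \det (\matrix_(i, j) A i j p)).
Proof.
move=> hA.
have [P PP] : polyfun (fun p => \sum_(s : 'S_n) ratr ((-1) ^+ s) * \prod_i A i (s i) p).
  by apply: polyfun_sum => s; apply: polyfunM; [apply: polyfunC | apply: polyfun_prod].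
exists P => p; rewrite -PP; apply: eq_bigr => s _; rewrite rmorphXn rmorphN1.
by congr (_ * _); apply: eq_bigr => i _; rewrite mxE.
Qed.

(** The principle through which genericity is used: a single witness [p0], however special,
    suffices. *)
Lemma generic_neq0 F p p0 : polyfun F -> generic_real p -> F p0 != 0 -> F p != 0.
Proof.
move=> [P FP] /genericE gp; rewrite !FP => h; apply: gp.
by apply: contra_neq h => ->; rewrite /rev mmap0.
Qed.

Definition moved p (t : R) m : realisation T :=
  fun x => ((p x).1 + t * (m x).1, (p x).2 + t * (m x).2).

Lemma vec_moved p t m i : vec (moved p t m) i = vec p i + t * vec m i.
Proof. by rewrite /vec /coord_of; case: ifP. Qed.

Lemma polyfun_line F p m : polyfun F -> exists g : {poly R}, forall t, F (moved p t m) = g.[t].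
Proof.
move=> [P FP]; exists (restrict P (vec p) (vec m)) => t; rewrite FP restrictE.
exact: eq_rev (vec_moved p t m).
Qed.

Definition gradient (P : {mpoly rat[N]}) p m := \sum_i rev P^`M(i) (vec p) * vec m i.

(** Squared lengths are quadratic along every line of realisations, so gradients can be read off an
    expansion in [t] instead of from partial derivatives. *)
Lemma gradient_quadratic P p m (A B C : R) :
  (forall t, rev P (vec (moved p t m)) = A + B * t + C * t ^+ 2) -> gradient P p m = B.
Proof.
move=> H; rewrite /gradient -deriv_restrict.
have -> : restrict P (vec p) (vec m) = A%:P + B *: 'X + C *: 'X^2.
  apply/eqP; rewrite -subr_eq0; apply/eqP/poly_eq0_on_reals => t.
  rewrite hornerD hornerN restrictE -(eq_rev P (vec_moved p t m)) H !hornerE.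
  by ring.
by rewrite !derivE !hornerE /=; ring.
Qed.

Definition dist2 (u v : R * R) := (u.1 - v.1) ^+ 2 + (u.2 - v.2) ^+ 2.

Lemma enorm_dist2 u v u' v' : enorm u v = enorm u' v' <-> dist2 u v = dist2 u' v'.
Proof.
have d0 a b : 0 <= dist2 a b by rewrite addr_ge0 ?sqr_ge0.
have enE a b : enorm a b = Num.sqrt (dist2 a b) by [].
rewrite !enE; split=> [/eqP|-> //].
by rewrite eqr_sqrt // => /eqP.
Qed.

Definition strain p m x y :=
  ((p x).1 - (p y).1) * ((m x).1 - (m y).1) + ((p x).2 - (p y).2) * ((m x).2 - (m y).2).

Definition flex p m W e := forall x y, x \in W -> y \in W -> e x y -> strain p m x y = 0.

(** The infinitesimal isometries: a translation by [(a, b)] plus a rotation of speed [c]. *)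
Definition trivial_flex p m W := exists a b c : R, forall x, x \in W ->
  (m x).1 = a - c * (p x).2 /\ (m x).2 = b + c * (p x).1.

Definition infrigid p W e := forall m, flex p m W e -> trivial_flex p m W.

Definition edge_poly x y : {mpoly rat[N]} :=
  ('X_(enum_rank (x, ord0)) - 'X_(enum_rank (y, ord0))) ^+ 2 +
  ('X_(enum_rank (x, ord_max)) - 'X_(enum_rank (y, ord_max))) ^+ 2.

Lemma revX i p : rev 'X_i (vec p) = vec p i.
Proof. by rewrite /rev mmapX mmap1U. Qed.

Lemma edge_polyE x y p : rev (edge_poly x y) (vec p) = dist2 (p x) (p y).
Proof.
have revM2 P : rev (P ^+ 2) (vec p) = rev P (vec p) ^+ 2.
  exact: (rmorphXn (mmap (@ratr R) (vec p))).
have revB P Q : rev (P - Q) (vec p) = rev P (vec p) - rev Q (vec p).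
  exact: (mmapB (vec p) (@ratr R)).
rewrite /edge_poly {1}/rev mmapD -!/(rev _ _) !revM2 !revB !revX.
by have [-> ->] := vec_rank p x; have [-> ->] := vec_rank p y.
Qed.

Lemma gradient_edge x y p m : gradient (edge_poly x y) p m = 2 * strain p m x y.
Proof.
apply: (@gradient_quadratic _ _ _ (dist2 (p x) (p y)) _ (dist2 (m x) (m y))) => t.
by rewrite edge_polyE /dist2 /strain /moved /=; ring.
Qed.

Lemma gradientX i p m : gradient 'X_i p m = vec m i.
Proof.
apply: (@gradient_quadratic _ _ _ (vec p i) _ 0%R) => t.
by rewrite revX vec_moved; ring.
Qed.

Lemma gradient0 p m : gradient 0 p m = 0.
Proof. by rewrite /gradient big1 // => i _; rewrite mderiv0 /rev mmap0 mul0r. Qed.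

(* Squared lengths of the edges inside [W], together with three coordinates
   of [w1], [w2] killing the isometries and all coordinates outside [W]. *)
Definition pinned W (w1 w2 : T) (c : T * 'I_2) :=
  [|| c == (w1, ord0), c == (w1, ord_max), c == (w2, ord0) | c.1 \notin W].

Definition system W e w1 w2 (r : (T * T) + (T * 'I_2)) : {mpoly rat[N]} :=
  match r with
  | inl (x, y) => if [&& x \in W, y \in W & e x y] then edge_poly x y else 0
  | inr c => if pinned W w1 w2 c then 'X_(enum_rank c) else 0
  end.

Definition rigid_system p W e w1 w2 := forall m,
  (forall r, gradient (system W e w1 w2 r) p m = 0) -> forall i, vec m i = 0.

Lemma system_flexP p m W e w1 w2 :
  (forall r, gradient (system W e w1 w2 r) p m = 0) <->
  [/\ flex p m W e, (m w1).1 = 0, (m w1).2 = 0, (m w2).1 = 0 &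
    forall x, x \notin W -> (m x).1 = 0 /\ (m x).2 = 0].
Proof.
split=> [H|[mf m1 m2 m3 mo] [[x y]|[x k]] /=]; last first.
- case: ifP => [|_]; last by rewrite gradient0.
  rewrite gradientX /vec enum_rankK /coord_of /pinned /= !xpair_eqE.
  case: (ord2E k) => -> /=; rewrite ?andbF ?orbF ?andbT ?orFb => h.
    case/or3P: h => [/eqP ->|/eqP ->|/mo[]] //.
  by case/orP: h => [/eqP ->|/mo[]].
- case: ifP => [/and3P[xW yW exy]|_]; last by rewrite gradient0.
  by rewrite gradient_edge mf // mulr0.
have Hc c : pinned W w1 w2 c -> coord_of m c = 0.
  by move=> cp; have := H (inr c); rewrite /= cp gradientX /vec enum_rankK.
split.
- move=> x y xW yW exy; have := H (inl (x, y)); rewrite /= xW yW exy gradient_edge => /eqP.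
  by rewrite mulf_eq0 pnatr_eq0 => /eqP.
- by have := Hc (w1, ord0); apply; rewrite /pinned eqxx.
- by have := Hc (w1, ord_max); apply; rewrite /pinned eqxx orbT.
- by have := Hc (w2, ord0); apply; rewrite /pinned eqxx !orbT.
- move=> x xW; split.
    by have := Hc (x, ord0); apply; rewrite /pinned /= xW !orbT.
  by have := Hc (x, ord_max); apply; rewrite /pinned /= xW !orbT.
Qed.

(** Fixing [w1] kills the translations; as [w2] has a different height, fixing its abscissa then
    kills the rotations. *)
Lemma infrigid_system p W e w1 w2 : w1 \in W -> w2 \in W -> (p w1).2 != (p w2).2 ->
  infrigid p W e <-> rigid_system p W e w1 w2.
Proof.
move=> w1W w2W p12; split=> [ir m /system_flexP[mf m11 m12 m21 mo]|rs m mf].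
  have [a [b [c abc]]] := ir m mf.
  have c0 : c = 0.
    have [e1 _] := abc _ w1W; have [e2 _] := abc _ w2W.
    have : c * ((p w1).2 - (p w2).2) = 0 by rewrite mulrBr; lra.
    by move/eqP; rewrite mulf_eq0 subr_eq0 (negPf p12) orbF => /eqP.
  have [e1 e2] := abc _ w1W.
  have a0 : a = 0 by move: e1; rewrite c0 mul0r; lra.
  have b0 : b = 0 by move: e2; rewrite c0 mul0r; lra.
  have m0 x : (m x).1 = 0 /\ (m x).2 = 0.
    have [/abc[-> ->]|/mo //] := boolP (x \in W).
    by rewrite a0 b0 c0 !mul0r; split; ring.
  move=> i; rewrite /vec /coord_of; case: ifP => _; first by case: (m0 (enum_val i).1).
  by case: (m0 (enum_val i).1).
pose d := (p w1).2 - (p w2).2; have d0 : d != 0 by rewrite subr_eq0.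
(* The infinitesimal isometry that agrees with [m] in the three pinned coordinates. *)
pose c := - ((m w1).1 - (m w2).1) / d.
pose a := (m w1).1 + c * (p w1).2; pose b := (m w1).2 - c * (p w1).1.
pose m' : realisation T := fun x => if x \in W then
  ((m x).1 - (a - c * (p x).2), (m x).2 - (b + c * (p x).1)) else (0, 0).
have m'0 : forall i, vec m' i = 0.
  apply: rs; apply/system_flexP; split.
  - move=> x y xW yW exy; have := mf x y xW yW exy; rewrite /strain /m' xW yW /= => h.
    by rewrite -[RHS]h; ring.
  - by rewrite /m' w1W /= /a; ring.
  - by rewrite /m' w1W /= /b; ring.
  - rewrite /m' w2W /= /a; have cd : c * d = - ((m w1).1 - (m w2).1) by rewrite mulfVK.
    by move: cd; rewrite /d mulrBr; lra.
  - by move=> x /negPf xW; rewrite /m' xW.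
exists a, b, c => x xW; have [e1 e2] := vec_rank m' x.
by move: e1 e2; rewrite !m'0 /m' xW /= => e1 e2; split; lra.
Qed.

Lemma infrigid_transfer p p0 W e w1 w2 : generic_real p -> w1 \in W -> w2 \in W ->
  (p0 w1).2 != (p0 w2).2 -> infrigid p0 W e -> infrigid p W e.
Proof.
move=> gp w1W w2W p12 /(infrigid_system e w1W w2W p12) rs.
have pp12 : (p w1).2 - (p w2).2 != 0.
  apply: (@generic_neq0 (fun p => (p w1).2 - (p w2).2) p p0); rewrite ?subr_eq0 //.
  by apply: polyfunB; apply: polyfunX2.
rewrite subr_eq0 in pp12; apply/(infrigid_system e w1W w2W pp12).
have [h hP i|f fu] := @select_rows N _ (fun r i => rev (system W e w1 w2 r)^`M(i) (vec p0)).
  rewrite -(unvecK h i); apply: rs => r; rewrite -[RHS](hP r).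
  by apply: eq_bigr => j _; rewrite unvecK.
have : \det (\matrix_(j, i) rev (system W e w1 w2 (f j))^`M(i) (vec p)) != 0.
  apply: (@generic_neq0 (fun p => \det (\matrix_(j, i) rev (system W e w1 w2 (f j))^`M(i) (vec p))) p p0) => //.
  by apply: polyfun_det => i j; apply: polyfun_rev.
rewrite -unitfE -unitmxE => Mu m mP.
by apply: (kernel_unitmx (h := vec m) Mu) => j; rewrite -[RHS](mP (f j)); apply: eq_bigr => i _; rewrite mxE.
Qed.

(** Some square subsystem of the pinned equations has invertible Jacobian at [p], so [finite_fibre]
    applies. Outside [W] the placement [q] is replaced by [p] to satisfy the pins there. *)
Lemma finite_equivalents p W e w1 w2 : generic_real p -> w1 \in W -> w2 \in W ->
  (p w1).2 != (p w2).2 -> infrigid p W e -> exists s : seq R, forall q,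
  (forall x y, x \in W -> y \in W -> e x y -> dist2 (q x) (q y) = dist2 (p x) (p y)) ->
  q w1 = p w1 -> (q w2).1 = (p w2).1 ->
  forall x, x \in W -> (q x).1 \in s /\ (q x).2 \in s.
Proof.
move=> gp w1W w2W p12 /(infrigid_system e w1W w2W p12) rs.
have [h hP i|f fu] := @select_rows N _ (fun r i => rev (system W e w1 w2 r)^`M(i) (vec p)).
  rewrite -(unvecK h i); apply: rs => r; rewrite -[RHS](hP r).
  by apply: eq_bigr => j _; rewrite unvecK.
have [h hP|s sP] := @finite_fibre N (fun j => system W e w1 w2 (f j)) (vec p) ((genericE p).1 gp).
  by apply: (kernel_unitmx (h := h) fu) => j; rewrite -[RHS](hP j); apply: eq_bigr => i _; rewrite mxE.
exists s => q qe q1 q2 x xW; pose q' : realisation T := fun x => if x \in W then q x else p x.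
suff q's : forall i, vec q' i \in s.
  have [e1 e2] := vec_rank q' x; move: (q's (enum_rank (x, ord0))) (q's (enum_rank (x, ord_max))).
  by rewrite e1 e2 /q' xW.
apply: sP => j; case: (f j) => [[y z]|[y k]] /=.
  case: ifP => [/and3P[yW zW yz]|_]; last by rewrite /rev !mmap0.
  by rewrite !edge_polyE /q' yW zW qe.
case: ifP => [|_]; last by rewrite /rev !mmap0.
rewrite !revX /vec enum_rankK /coord_of /pinned /= !xpair_eqE /q'.
case: (ord2E k) => -> /=; rewrite ?andbF ?orbF ?andbT ?orFb => h.
  by case/or3P: h => [/eqP ->|/eqP ->|/negPf -> //]; rewrite ?w1W ?w2W ?q1.
by case/orP: h => [/eqP ->|/negPf -> //]; rewrite w1W q1.
Qed.
End Realisations.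

Definition upoly (f : R -> R) := exists g : {poly R}, forall x, f x = g.[x].

Lemma upolyC c : upoly (fun _ => c).
Proof. by exists c%:P => x; rewrite hornerC. Qed.
Lemma upolyX : upoly (fun x => x).
Proof. by exists 'X => x; rewrite hornerX. Qed.
Lemma upolyD f g : upoly f -> upoly g -> upoly (fun x => f x + g x).
Proof. by move=> [a fa] [b gb]; exists (a + b) => x; rewrite hornerD fa gb. Qed.
Lemma upolyN f : upoly f -> upoly (fun x => - f x).
Proof. by move=> [a fa]; exists (- a) => x; rewrite hornerN fa. Qed.
Lemma upolyM f g : upoly f -> upoly g -> upoly (fun x => f x * g x).
Proof. by move=> [a fa] [b gb]; exists (a * b) => x; rewrite hornerM fa gb. Qed.
Lemma upolyXn f n : upoly f -> upoly (fun x => f x ^+ n).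
Proof. by move=> [a fa]; exists (a ^+ n) => x; rewrite horner_exp fa. Qed.

Ltac upoly_tac := repeat first
  [ exact: upolyC | exact: upolyX | apply: upolyD | apply: upolyN | apply: upolyM | apply: upolyXn ].

Definition cross (a b c : R * R) :=
  (b.1 - a.1) * (c.2 - a.2) - (b.2 - a.2) * (c.1 - a.1).

Lemma dist2C u v : dist2 u v = dist2 v u.
Proof. by rewrite /dist2; ring. Qed.

Lemma dist2_eq0 u v : dist2 u v = 0 -> u = v.
Proof.
move=> /eqP; rewrite paddr_eq0 ?sqr_ge0 // !sqrf_eq0 !subr_eq0 => /andP[/eqP h1 /eqP h2].
by rewrite [u]surjective_pairing [v]surjective_pairing h1 h2.
Qed.

Lemma dist2xx u : dist2 u u = 0.
Proof. by rewrite /dist2 !subrr expr0n /= addr0. Qed.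

(* The inner product of two vectors is recovered from their inner products
   with a basis and the Gram matrix of that basis. *)
Lemma three_points_determine (a0 a1 a2 b0 b1 b2 x y z w : R * R) : cross a0 a1 a2 != 0 ->
  dist2 a0 a1 = dist2 b0 b1 -> dist2 a0 a2 = dist2 b0 b2 -> dist2 a1 a2 = dist2 b1 b2 ->
  dist2 x a0 = dist2 y b0 -> dist2 x a1 = dist2 y b1 -> dist2 x a2 = dist2 y b2 ->
  dist2 z a0 = dist2 w b0 -> dist2 z a1 = dist2 w b1 -> dist2 z a2 = dist2 w b2 ->
  dist2 x z = dist2 y w.
Proof.
pose dot (u v : R * R) := u.1 * v.1 + u.2 * v.2.
pose sub (u v : R * R) := (u.1 - v.1, u.2 - v.2).
have dotE o u v : dot (sub u o) (sub v o) = (dist2 u o + dist2 v o - dist2 u v) / 2.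
  by rewrite /dot /sub /dist2 /=; field.
have gram o u v s t : cross o u v ^+ 2 * dot (sub s o) (sub t o) =
    dot (sub s o) (sub u o) * (dot (sub v o) (sub v o) * dot (sub t o) (sub u o)
      - dot (sub u o) (sub v o) * dot (sub t o) (sub v o)) +
    dot (sub s o) (sub v o) * (dot (sub u o) (sub u o) * dot (sub t o) (sub v o)
      - dot (sub u o) (sub v o) * dot (sub t o) (sub u o)).
  by rewrite /cross /dot /sub /=; ring.
have gdet o u v : cross o u v ^+ 2 = dot (sub u o) (sub u o) * dot (sub v o) (sub v o)
    - dot (sub u o) (sub v o) ^+ 2.
  by rewrite /cross /dot /sub /=; ring.
move=> c0 h01 h02 h12 x0 x1 x2 z0 z1 z2.
have c2 : cross a0 a1 a2 ^+ 2 = cross b0 b1 b2 ^+ 2.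
  by rewrite !gdet !dotE !dist2xx h12 ![dist2 a1 a0]dist2C ![dist2 a2 a0]dist2C h01 h02
    ![dist2 b1 b0]dist2C ![dist2 b2 b0]dist2C.
have key : dot (sub x a0) (sub z a0) = dot (sub y b0) (sub w b0).
  have n0 : cross a0 a1 a2 ^+ 2 != 0 by rewrite sqrf_eq0.
  apply: (mulfI n0); rewrite gram {1}c2 gram !dotE !dist2xx h12 x0 x1 x2 z0 z1 z2.
  by rewrite ![dist2 a1 a0]dist2C ![dist2 a2 a0]dist2C h01 h02
    ![dist2 b1 b0]dist2C ![dist2 b2 b0]dist2C.
by move: key; rewrite !dotE x0 z0; lra.
Qed.

Section Generic.
Variable T : finType.
Implicit Types (p q m : realisation T) (W : {set T}) (e : rel T).

Lemma generic_neq1 p x y : generic_real p -> x != y -> (p x).1 != (p y).1.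
Proof.
move=> gp xy; rewrite -subr_eq0.
apply: (@generic_neq0 _ (fun p => (p x).1 - (p y).1) p (fun z => ((z == x)%:R, 0))) => //=.
  by apply: polyfunB; apply: polyfunX1.
by rewrite eqxx [y == x]eq_sym (negPf xy) subr0 oner_neq0.
Qed.

Lemma generic_neq2 p x y : generic_real p -> x != y -> (p x).2 != (p y).2.
Proof.
move=> gp xy; rewrite -subr_eq0.
apply: (@generic_neq0 _ (fun p => (p x).2 - (p y).2) p (fun z => (0, (z == x)%:R))) => //=.
  by apply: polyfunB; apply: polyfunX2.
by rewrite eqxx [y == x]eq_sym (negPf xy) subr0 oner_neq0.
Qed.

Lemma generic_cross p x y z : generic_real p -> x != y -> x != z -> y != z ->
  cross (p x) (p y) (p z) != 0.
Proof.
move=> gp xy xz yz.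
apply: (@generic_neq0 _ (fun p => cross (p x) (p y) (p z)) p
  (fun t => ((t == y)%:R, (t == z)%:R))) => //=; last first.
  rewrite /cross /= !eqxx (negPf xy) (negPf xz) (negPf yz) [z == y]eq_sym (negPf yz).
  by rewrite !subr0 mulr1 mulr0 subr0 oner_neq0.
by apply: polyfunB; apply: polyfunM; apply: polyfunB; (exact: polyfunX1 || exact: polyfunX2).
Qed.

Lemma strainxx p m x : strain p m x x = 0.
Proof. by rewrite /strain !subrr !mul0r addr0. Qed.

Lemma strainC p m x y : strain p m x y = strain p m y x.
Proof. by rewrite /strain; ring. Qed.

Lemma trivial_strain p m W x y : trivial_flex p m W -> x \in W -> y \in W -> strain p m x y = 0.
Proof.
by move=> [a [b [c abc]]] /abc[x1 x2] /abc[y1 y2]; rewrite /strain x1 x2 y1 y2; ring.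
Qed.

Lemma linear2_eq0 (a b c d u v : R) : a * d - b * c != 0 ->
  a * u + b * v = 0 -> c * u + d * v = 0 -> u = 0 /\ v = 0.
Proof.
move=> det h1 h2; split; apply: (mulfI det); rewrite mulr0.
  by transitivity (d * (a * u + b * v) - b * (c * u + d * v)); [ring | rewrite h1 h2; ring].
by transitivity (a * (c * u + d * v) - c * (a * u + b * v)); [ring | rewrite h1 h2; ring].
Qed.

Lemma complete_infrigid p W : generic_real p -> infrigid p W (fun _ _ => true).
Proof.
move=> gp; have [->|] := eqVneq W set0.
  by move=> m _; exists 0, 0, 0 => x; rewrite inE.
case/set0Pn => w1 w1W; have [->|] := eqVneq W [set w1].
  move=> m _; exists (m w1).1, (m w1).2, 0 => x; rewrite inE => /eqP ->.
  by rewrite !mul0r subr0 addr0.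
rewrite eqEsubset sub1set w1W andbT => /subsetPn[w2 w2W]; rewrite inE => w21.
have p12 : (p w1).2 != (p w2).2 by apply: generic_neq2 => //; rewrite eq_sym.
apply/(infrigid_system _ w1W w2W p12) => m /system_flexP[mf m11 m12 m21 mo].
have m22 : (m w2).2 = 0.
  have := mf _ _ w1W w2W isT; rewrite /strain m11 m12 m21 !subr0 mulr0 add0r sub0r => /eqP.
  by rewrite mulf_eq0 subr_eq0 (negPf p12) oppr_eq0 => /eqP.
have m0 x : (m x).1 = 0 /\ (m x).2 = 0.
  have [xW|/mo //] := boolP (x \in W).
  have [->|x1] := eqVneq x w1; first by [].
  have [->|x2] := eqVneq x w2; first by [].
  have := mf _ _ xW w2W isT; have := mf _ _ xW w1W isT.
  rewrite /strain m11 m12 m21 m22 !subr0; apply: linear2_eq0.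
  have := @generic_cross p x w1 w2 gp x1 x2; rewrite eq_sym => /(_ w21).
  by apply: contra_neq; rewrite /cross => h; rewrite -[RHS]h; ring.
by move=> i; rewrite /vec /coord_of; case: ifP => _; case: (m0 (enum_val i).1).
Qed.

(** Otherwise [v] alone could turn around [s]; as two further vertices stay at rest, this motion is
    not an isometry. *)
Lemma infrigid_nbr p W e v s : generic_real p -> ssrbool.symmetric e -> infrigid p W e ->
  (2 < #|W|)%N -> v \in W -> v != s ->
  exists x, [/\ x \in W, x != v, x != s & e v x].
Proof.
move=> gp se ir W3 vW vs; apply: contrapT => nx.
have {}nx x : x \in W -> x != v -> e v x -> x = s.
  by move=> xW xv vx; apply: contrapT => /eqP xs; apply: nx; exists x.
pose m : realisation T := fun x => if x == v then
  ((p s).2 - (p v).2, (p v).1 - (p s).1) else (0, 0).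
have mE x : x != v -> m x = (0, 0) by move=> /negPf xv; rewrite /m xv.
have mv : m v = ((p s).2 - (p v).2, (p v).1 - (p s).1) by rewrite /m eqxx.
have mf : flex p m W e.
  have aux y : y \in W -> e v y -> strain p m v y = 0.
    have [-> _ _|yv yW vy] := eqVneq y v; first exact: strainxx.
    by rewrite /strain mv mE // /= (nx y) //; ring.
  move=> x y xW yW exy; have [xv|xv] := eqVneq x v; first by rewrite xv aux -?xv.
  have [yv|yv] := eqVneq y v; first by rewrite strainC yv aux -?yv // se.
  by rewrite /strain !mE //= subrr !mulr0 addr0.
have [a [b [c abc]]] := ir m mf.
have [y yW yv] : exists2 y, y \in W & y != v.
  have : (0 < #|W :\ v|)%N by move: W3; rewrite (cardsD1 v) vW; lia.
  by case/card_gt0P => y; rewrite !inE => /andP[yv yW]; exists y.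
have [z zW [zv zy]] : exists2 z, z \in W & z != v /\ z != y.
  have : (0 < #|W :\ v :\ y|)%N by move: W3; rewrite (cardsD1 v) vW (cardsD1 y) !inE yv yW; lia.
  by case/card_gt0P => z; rewrite !inE => /and3P[zy zv zW]; exists z.
have [y1 y2] := abc _ yW; have [z1 z2] := abc _ zW; have [v1 v2] := abc _ vW.
rewrite (mE y yv) (mE z zv) mv /= in y1 y2 z1 z2 v1 v2.
have c0 : c = 0.
  have : c * ((p z).2 - (p y).2) = 0 by rewrite mulrBr; lra.
  by move/eqP; rewrite mulf_eq0 subr_eq0 (negPf (generic_neq2 gp zy)) orbF => /eqP.
have := generic_neq1 gp vs; rewrite -subr_eq0 v2 => /eqP; apply.
by move: y2; rewrite c0 !mul0r; lra.
Qed.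

Definition add_clique e v : rel T := fun x y => e x y || (e v x && e v y).

(** The clique makes the neighbours of [v] move by one infinitesimal isometry; [v] is carried along
    by it, which extends the flex to all of [W]. *)
Lemma infrigid_add_clique p W e v : generic_real p -> ssrbool.symmetric e -> v \in W ->
  infrigid p W e -> infrigid p (W :\ v) (add_clique e v).
Proof.
move=> gp se vW ir m mf.
have [|a [b [c abc]]] := @complete_infrigid p [set x in W :\ v | e v x] gp m.
  move=> x y; rewrite !inE => /andP[/andP[xv xW] vx] /andP[/andP[yv yW] vy] _.
  by apply: mf; rewrite ?inE ?xv ?yv // /add_clique vx vy orbT.
pose m2 : realisation T := fun x => if x == v then (a - c * (p v).2, b + c * (p v).1) else m x.
have m2E x : x != v -> m2 x = m x by move=> /negPf xv; rewrite /m2 xv.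
have m2v : m2 v = (a - c * (p v).2, b + c * (p v).1) by rewrite /m2 eqxx.
have aux y : y \in W -> e v y -> strain p m2 v y = 0.
  have [-> _ _|yv yW vy] := eqVneq y v; first exact: strainxx.
  have [|y1 y2] := abc y; first by rewrite !inE yv yW vy.
  by rewrite /strain m2v m2E // y1 y2 /=; ring.
have m2f : flex p m2 W e.
  move=> x y xW yW exy; have [xv|xv] := eqVneq x v; first by rewrite xv aux -?xv.
  have [yv|yv] := eqVneq y v; first by rewrite strainC yv aux -?yv // se.
  by rewrite /strain !m2E //; apply: mf; rewrite ?inE ?xv ?yv // /add_clique exy.
have [a' [b' [c' abc']]] := ir m2 m2f.
by exists a', b', c' => x; rewrite !inE => /andP[xv xW]; rewrite -(m2E x xv); apply: abc'.
Qed.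

Definition globrigid p W e := forall q : realisation T,
  (forall x y, x \in W -> y \in W -> e x y -> dist2 (q x) (q y) = dist2 (p x) (p y)) ->
  forall x y, x \in W -> y \in W -> dist2 (q x) (q y) = dist2 (p x) (p y).

Lemma exists_isometry (a b a' b' : R * R) : dist2 a b = dist2 a' b' -> a != b ->
  exists f : R * R -> R * R, [/\ forall x y, dist2 (f x) (f y) = dist2 x y, f a = a' & f b = b'].
Proof.
move=> dab ab; pose L := dist2 a b.
have L0 : L != 0 by apply: contra_neq ab => /dist2_eq0.
(* Cosine and sine of the rotation: the real and imaginary parts of [(b' - a') / (b - a)] in complex
   notation. *)
pose u := ((b.1 - a.1) * (b'.1 - a'.1) + (b.2 - a.2) * (b'.2 - a'.2)) / L.
pose v := ((b.1 - a.1) * (b'.2 - a'.2) - (b.2 - a.2) * (b'.1 - a'.1)) / L.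
have uv : u ^+ 2 + v ^+ 2 = 1.
  have -> : u ^+ 2 + v ^+ 2 = dist2 a b * dist2 a' b' / L ^+ 2.
    by rewrite /u /v /dist2; field.
  by rewrite -dab -/L; field.
exists (fun x => (a'.1 + u * (x.1 - a.1) - v * (x.2 - a.2), a'.2 + v * (x.1 - a.1) + u * (x.2 - a.2))).
split=> [x y||].
- transitivity ((u ^+ 2 + v ^+ 2) * dist2 x y); last by rewrite uv mul1r.
  by rewrite /dist2 /=; ring.
- by rewrite !subrr !mulr0 subr0 !addr0 -surjective_pairing.
- rewrite [RHS]surjective_pairing; congr (_, _); rewrite /u /v.
    by transitivity (a'.1 + (b'.1 - a'.1) * (L / L)); [rewrite /L /dist2; field; exact: L0|rewrite divff //; ring].
  by transitivity (a'.2 + (b'.2 - a'.2) * (L / L)); [rewrite /L /dist2; field; exact: L0|rewrite divff //; ring].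
Qed.
End Generic.

(** * Global rigidity from vertex redundancy *)

(** Polynomial in each variable separately and not identically zero: the zero set is a curve that
    [avoid_plane] can miss. *)
Definition avoidable (Z : R -> R -> R) :=
  [/\ forall y, upoly (fun x => Z x y), forall x, upoly (Z x) & exists x y, Z x y != 0].

Lemma avoidable1 : avoidable (fun _ _ => 1).
Proof. by split=> [y|x|]; [exact: upolyC..|exists 0, 0; exact: oner_neq0]. Qed.

Lemma collinear_relation (a b c : R * R) : cross a b c = 0 -> exists l1 l2 : R,
  [/\ (l1 != 0) || (l2 != 0), l1 * (b.1 - a.1) + l2 * (c.1 - a.1) = 0 &
      l1 * (b.2 - a.2) + l2 * (c.2 - a.2) = 0].
Proof.
rewrite /cross => h.
have [/andP[/eqP b1 /eqP c1]|n1] := boolP ((b.1 - a.1 == 0) && (c.1 - a.1 == 0)); last first.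
  exists (c.1 - a.1), (- (b.1 - a.1)); split.
  - by move: n1; rewrite negb_and oppr_eq0 orbC.
  - by ring.
  - by rewrite -[RHS]oppr0 -[in RHS]h; ring.
have [/andP[/eqP b2 /eqP c2]|n2] := boolP ((b.2 - a.2 == 0) && (c.2 - a.2 == 0)).
  by exists 1, 0; rewrite oner_neq0 b1 c1 b2 c2 !mulr0 addr0.
exists (c.2 - a.2), (- (b.2 - a.2)); split.
- by move: n2; rewrite negb_and oppr_eq0 orbC.
- by rewrite b1 c1 !mulr0 addr0.
- by ring.
Qed.

(** The affine dependence of the [Q]s gives a relation between the squared distances in which the
    coordinates of [w] cancel. On the side of [z] the quadratic terms cancel too, and the remaining
    affine function is nonzero because the [P]s are not collinear. *)
Lemma collinear_avoidable (P0 P1 P2 Q0 Q1 Q2 : R * R) :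
  cross P0 P1 P2 != 0 -> cross Q0 Q1 Q2 = 0 -> exists Z, avoidable Z /\
  forall z w : R * R, dist2 w Q0 = dist2 z P0 -> dist2 w Q1 = dist2 z P1 ->
    dist2 w Q2 = dist2 z P2 -> Z z.1 z.2 = 0.
Proof.
move=> cP cQ; have [l1 [l2 [l0 e1 e2]]] := collinear_relation cQ.
pose nrm (u : R * R) := u.1 ^+ 2 + u.2 ^+ 2.
pose Z (x y : R) := l1 * (dist2 (x, y) P1 - nrm Q1) + l2 * (dist2 (x, y) P2 - nrm Q2)
  - (l1 + l2) * (dist2 (x, y) P0 - nrm Q0).
exists Z; split; last first.
  move=> [z1 z2] [w1 w2] h0 h1 h2; rewrite /Z /= -h0 -h1 -h2 /dist2 /nrm /=.
  transitivity (- 2 * w1 * (l1 * (Q1.1 - Q0.1) + l2 * (Q2.1 - Q0.1))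
    - 2 * w2 * (l1 * (Q1.2 - Q0.2) + l2 * (Q2.2 - Q0.2))); first by ring.
  by rewrite e1 e2; ring.
split=> [y|x|].
- by rewrite /Z /dist2 /=; upoly_tac.
- by rewrite /Z /dist2 /=; upoly_tac.
apply: contrapT => nz.
have Z0 x y : Z x y = 0 by apply/eqP; apply: contrapT => /negP h; apply: nz; exists x, y.
have d1 : l1 * (P1.1 - P0.1) + l2 * (P2.1 - P0.1) = 0.
  by have := Z0 0 0; have := Z0 1 0; rewrite /Z /dist2 /=; lra.
have d2 : l1 * (P1.2 - P0.2) + l2 * (P2.2 - P0.2) = 0.
  by have := Z0 0 0; have := Z0 0 1; rewrite /Z /dist2 /=; lra.
have [|||z1 z2] := @linear2_eq0 (P1.1 - P0.1) (P2.1 - P0.1) (P1.2 - P0.2) (P2.2 - P0.2) l1 l2.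
- by apply: contra_neq cP; rewrite /cross => h; rewrite -[RHS]h; ring.
- by rewrite mulrC (mulrC _ l2).
- by rewrite mulrC (mulrC _ l2).
by move: l0; rewrite z1 z2 eqxx.
Qed.

Section AffineImage.
Variables P0 P1 P2 Q0 Q1 Q2 : R * R.
Hypothesis cQ : cross Q0 Q1 Q2 != 0.
Let nrm (u : R * R) := u.1 ^+ 2 + u.2 ^+ 2.
Let r1 (z : R * R) := (nrm Q1 - nrm Q0 - dist2 z P1 + dist2 z P0) / 2.
Let r2 (z : R * R) := (nrm Q2 - nrm Q0 - dist2 z P2 + dist2 z P0) / 2.

(** Differences of the three distance equations form a linear system, solved here by Cramer's rule;
    its right-hand side, hence the solution, is affine in [z]. *)
Definition affine_image (z : R * R) : R * R :=
  ((r1 z * (Q2.2 - Q0.2) - r2 z * (Q1.2 - Q0.2)) / cross Q0 Q1 Q2,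
   ((Q1.1 - Q0.1) * r2 z - (Q2.1 - Q0.1) * r1 z) / cross Q0 Q1 Q2).

Lemma affine_imageE z w : dist2 w Q0 = dist2 z P0 -> dist2 w Q1 = dist2 z P1 ->
    dist2 w Q2 = dist2 z P2 -> w = affine_image z.
Proof.
move=> h0 h1 h2; rewrite [LHS]surjective_pairing /affine_image /r1 /r2 -h0 -h1 -h2 /dist2 /nrm.
by congr (_, _); move: cQ; rewrite /cross => c0; field.
Qed.

(** A fourth distance condition either holds identically in [z] or confines [z] to a curve. *)
Lemma affine_avoidable Pu Qu : exists Z, avoidable Z /\
  forall z : R * R, dist2 (affine_image z) Qu = dist2 z Pu -> Z z.1 z.2 != 0 ->
  forall z', dist2 (affine_image z') Qu = dist2 z' Pu.
Proof.
have [all|nall] := EM (forall z', dist2 (affine_image z') Qu = dist2 z' Pu).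
  by exists (fun _ _ => 1); split; [exact: avoidable1|].
exists (fun x y => dist2 (affine_image (x, y)) Qu - dist2 (x, y) Pu); split.
  split=> [y|x|].
  - by rewrite /affine_image /r1 /r2 /dist2 /=; upoly_tac.
  - by rewrite /affine_image /r1 /r2 /dist2 /=; upoly_tac.
  apply: contrapT => nz; apply: nall => -[x y]; apply/eqP; rewrite -subr_eq0.
  by apply: contrapT => /negP h; apply: nz; exists x, y.
by move=> [x y] /= ->; rewrite subrr eqxx.
Qed.
End AffineImage.

Section Tanigawa.
Variable T : finType.
Implicit Types (p q m : realisation T) (W : {set T}) (e : rel T).

Definition vertex_redundant W e :=
  forall v p, v \in W -> generic_real p -> infrigid p (W :\ v) e.

Definition relocate p v z : realisation T := fun x => if x == v then z else p x.

(** The three vertices form a triangle: two nonadjacent ones would have a nontrivial flex after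
    deletion of the third. *)
Lemma globrigid3 p W e : ssrbool.symmetric e -> vertex_redundant W e -> #|W| = 3%N ->
  generic_real p -> globrigid p W e.
Proof.
move=> se vr W3 gp q qe x y xW yW; have [->|xy] := eqVneq x y; first by rewrite !dist2xx.
apply: qe => //; apply: contrapT => /negP exy.
have [w] : exists w, w \in W :\ x :\ y.
  by apply/card_gt0P; move: W3; rewrite (cardsD1 x) xW (cardsD1 y) !inE eq_sym xy yW; lia.
rewrite !inE => /and3P[wy wx wW].
have cW : #|W :\ w :\ x :\ y| = 0%N.
  move: W3; rewrite (cardsD1 w) wW (cardsD1 x) !inE xW (eq_sym x) wx (cardsD1 y) !inE yW.
  by rewrite (eq_sym y w) wy (eq_sym y x) xy; lia.
pose m : realisation T := fun z => if z == x then ((p x).1 - (p y).1, (p x).2 - (p y).2) else (0, 0).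
have xyW z : z \in W :\ w -> z = x \/ z = y.
  move=> zW; have [->|zx] := eqVneq z x; first by left.
  have [->|zy] := eqVneq z y; first by right.
  by move/eqP: cW; rewrite cards_eq0 => /eqP/setP/(_ z); rewrite !inE zx zy /= -in_setD1 zW.
have mf : flex p m (W :\ w) e.
  move=> a b /xyW[->|->] /xyW[->|->] eab; rewrite ?strainxx //; first by rewrite eab in exy.
  by rewrite se eab in exy.
have /trivial_strain := vr w p wW gp m mf => /(_ x y).
rewrite !inE xW yW (eq_sym x) (eq_sym y) wx wy => /(_ isT isT).
rewrite /strain /m eqxx eq_sym (negPf xy) /= !subr0 -!expr2 -/(dist2 _ _) => /dist2_eq0 pxy.
by have := generic_neq1 gp xy; rewrite pxy eqxx.
Qed.

(* Tanigawa: given the finitely many placements of [W :\ v] equivalent to [p],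
   a point [z] for [v] outside countably many curves forces the distances
   between the neighbours of [v] to be preserved. *)
Theorem vertex_redundant_globrigid W e : ssrbool.symmetric e -> (2 < #|W|)%N ->
  vertex_redundant W e -> exists p, generic_real p /\ globrigid p W e.
Proof.
have [n] := ubnP #|W|; elim: n W e => // n IH W e Wn se W3 vr.
have [Wle3|W4] := leqP #|W| 3.
  have [p gp] := generic_exists T; exists p; split=> //.
  by apply: globrigid3 => //; apply/eqP; rewrite eqn_leq Wle3.
have [v vW] : exists v, v \in W by apply/card_gt0P; lia.
pose W' := W :\ v; pose e' := add_clique e v.
have cW' : #|W| = #|W'|.+1 by rewrite (cardsD1 v) vW.
have vr' : vertex_redundant W' e'.
  move=> u p; rewrite !inE => /andP[uv uW] gp.
  have -> : W' :\ u = W :\ u :\ v by apply/setP => x; rewrite !inE andbCA.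
  by apply: infrigid_add_clique => //; [rewrite !inE eq_sym uv vW | apply: vr].
have [||||p' [gp' gr']] := IH W' e'; try lia; try done.
  by move=> x y; rewrite /e' /add_clique se andbC.
have cD u : u \in W -> (2 < #|W :\ u|)%N by move=> uW; move: W4; rewrite (cardsD1 u) uW; lia.
have [w wW] : exists w, w \in W' by apply/card_gt0P; lia.
have /andP[wv wW0] : (w != v) && (w \in W) by move: wW; rewrite !inE.
(* After deletion of a vertex, [infrigid_nbr] avoids that vertex as well as [s]; this yields three
   distinct neighbours of [v]. *)
have [|||u0 [u0W u0v _ vu0]] := @infrigid_nbr T p' (W :\ w) e v w gp' se (vr w p' wW0 gp').
- exact: cD.
- by rewrite !inE eq_sym wv vW.
- by rewrite eq_sym.
have {}u0W : u0 \in W by move: u0W; rewrite !inE => /andP[].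
have [|||u1 [u1W u1v u10 vu1]] := @infrigid_nbr T p' (W :\ u0) e v u0 gp' se (vr u0 p' u0W gp').
- exact: cD.
- by rewrite !inE eq_sym u0v vW.
- by rewrite eq_sym.
have [|||u2 [u2W u2v u21 vu2]] := @infrigid_nbr T p' (W :\ u0) e v u1 gp' se (vr u0 p' u0W gp').
- exact: cD.
- by rewrite !inE eq_sym u0v vW.
- by rewrite eq_sym.
have {}u1W : u1 \in W by move: u1W; rewrite !inE => /andP[].
have /andP[u20 {}u2W] : (u2 != u0) && (u2 \in W) by move: u2W; rewrite !inE.
have u0W' : u0 \in W' by rewrite !inE u0v.
have u1W' : u1 \in W' by rewrite !inE u1v.
have u2W' : u2 \in W' by rewrite !inE u2v.
have irW' : infrigid p' W' e by apply: vr.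
(* [w2] is adjacent to [u0], so the distance between the two pinned vertices is an edge length. *)
have [|||w2 [w2W w2u _ uw2]] := @infrigid_nbr T p' W' e u0 u1 gp' se irW'.
- by move: W4; rewrite cW'.
- by [].
- by rewrite eq_sym.
have u0w2 : u0 != w2 by rewrite eq_sym.
have [s sP] := finite_equivalents gp' u0W' w2W (generic_neq2 gp' u0w2) irW'.
(* A map [Q : I] encodes a candidate placement of [W'] with coordinates in [s]. Which candidate
   occurs is unknown when [z] is chosen, so [z] has to suit all of them. *)
pose k := (size s).+1; pose I := {ffun T -> 'I_k * 'I_k}.
pose at_ (Q : I) x : R * R := (nth 0 s (Q x).1, nth 0 s (Q x).2).
have cP : cross (p' u0) (p' u1) (p' u2) != 0 by apply: generic_cross; rewrite // eq_sym.
have [ZB ZBP] : {ZB : I -> R -> R -> R & forall Q, avoidable (ZB Q) /\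
    (cross (at_ Q u0) (at_ Q u1) (at_ Q u2) = 0 ->
     forall z w : R * R, dist2 w (at_ Q u0) = dist2 z (p' u0) ->
     dist2 w (at_ Q u1) = dist2 z (p' u1) -> dist2 w (at_ Q u2) = dist2 z (p' u2) ->
     ZB Q z.1 z.2 = 0)}.
  apply: (@choice I (R -> R -> R) (fun Q Z => avoidable Z /\
    (cross (at_ Q u0) (at_ Q u1) (at_ Q u2) = 0 ->
     forall z w : R * R, dist2 w (at_ Q u0) = dist2 z (p' u0) ->
     dist2 w (at_ Q u1) = dist2 z (p' u1) -> dist2 w (at_ Q u2) = dist2 z (p' u2) ->
     Z z.1 z.2 = 0))) => Q.
  have [c0|c0] := eqVneq (cross (at_ Q u0) (at_ Q u1) (at_ Q u2)) 0.
    by have [Z [aZ ZP]] := collinear_avoidable cP c0; exists Z.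
  by exists (fun _ _ => 1); split; [exact: avoidable1 | move=> h; rewrite h eqxx in c0].
pose A (Q : I) := affine_image (p' u0) (p' u1) (p' u2) (at_ Q u0) (at_ Q u1) (at_ Q u2).
have [ZC ZCP] : {ZC : I * T -> R -> R -> R & forall c : I * T, avoidable (ZC c) /\
    forall z : R * R, dist2 (A c.1 z) (at_ c.1 c.2) = dist2 z (p' c.2) -> ZC c z.1 z.2 != 0 ->
    forall z', dist2 (A c.1 z') (at_ c.1 c.2) = dist2 z' (p' c.2)}.
  apply: (@choice (I * T)%type (R -> R -> R) (fun c Z => avoidable Z /\
    forall z : R * R, dist2 (A c.1 z) (at_ c.1 c.2) = dist2 z (p' c.2) -> Z z.1 z.2 != 0 ->
    forall z', dist2 (A c.1 z') (at_ c.1 c.2) = dist2 z' (p' c.2))) => c.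
  exact: affine_avoidable.
pose N := #|{: T * 'I_2}|.
(* These conditions keep the realisation generic after [v] is moved. *)
pose ZA (c : seq ('X_{1..N} * rat)) (x y : R) :=
  if mpoly_decode c == 0 then 1 else rev (mpoly_decode c) (vec (relocate p' v (x, y))).
have ZAP c : avoidable (ZA c).
  rewrite /ZA; have [_|c0] := eqVneq (mpoly_decode c) 0; first exact: avoidable1.
  split=> [y|x|].
  - have [g gP] := polyfun_line (relocate p' v (0, y)) (relocate (fun _ => (0, 0)) v (1, 0))
      (polyfun_rev (mpoly_decode c)).
    exists g => x; rewrite -gP; congr (rev _ (vec _)); apply/funext => u.
    by rewrite /moved /relocate; case: eqP => _ /=; rewrite ?mulr0 ?addr0 ?add0r ?mulr1 -?surjective_pairing.
  - have [g gP] := polyfun_line (relocate p' v (x, 0)) (relocate (fun _ => (0, 0)) v (0, 1))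
      (polyfun_rev (mpoly_decode c)).
    exists g => y; rewrite -gP; congr (rev _ (vec _)); apply/funext => u.
    by rewrite /moved /relocate; case: eqP => _ /=; rewrite ?mulr0 ?addr0 ?add0r ?mulr1 -?surjective_pairing.
  - exists (p' v).1, (p' v).2; have := (genericE p').1 gp' _ c0; congr (rev _ (vec _) != 0).
    by apply/funext => u; rewrite /relocate; case: eqP => // ->; rewrite -surjective_pairing.
pose Z (j : seq ('X_{1..N} * rat) + (I + I * T)) :=
  match j with inl c => ZA c | inr (inl Q) => ZB Q | inr (inr c) => ZC c end.
have aZ j : avoidable (Z j).
  by case: j => [c|[Q|c]]; [exact: ZAP | case: (ZBP Q) | case: (ZCP c)].
have [|||z1 [z2 zP]] := @avoid_plane _ Z.
- by move=> j; case: (aZ j).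
- by move=> j; case: (aZ j).
- by move=> j; case: (aZ j).
pose p := relocate p' v (z1, z2).
have pE x : x \in W' -> p x = p' x by rewrite !inE /p /relocate => /andP[/negPf -> _].
have pv : p v = (z1, z2) by rewrite /p /relocate eqxx.
exists p; split.
  apply/genericE => P P0; have := zP (inl (mpoly_code P)).
  by rewrite /= /ZA mpoly_codeK (negPf P0).
move=> q0 q0e.
(* An equivalent placement is first moved by an isometry to satisfy the pins at [u0] and [w2]. *)
have [||iso [isoP iso0 iso2]] := @exists_isometry (q0 u0) (q0 w2) (p' u0) (p' w2).
- rewrite q0e ?pE //; first by move: w2W; rewrite !inE => /andP[].
- apply/eqP => h; have := q0e u0 w2 u0W; rewrite h dist2xx !pE //.
  move: w2W; rewrite !inE => /andP[_ w2W] /(_ w2W uw2)/esym/dist2_eq0 h'.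
  by have := generic_neq1 gp' w2u; rewrite h' eqxx.
pose q x := iso (q0 x).
have qe x y : x \in W -> y \in W -> e x y -> dist2 (q x) (q y) = dist2 (p x) (p y).
  by move=> xW yW exy; rewrite isoP q0e.
suff qgoal : forall x y, x \in W -> y \in W -> dist2 (q x) (q y) = dist2 (p x) (p y).
  by move=> x y xW yW; rewrite -isoP; apply: qgoal.
have W'W x : x \in W' -> x \in W by rewrite !inE => /andP[].
have qs x : x \in W' -> (q x).1 \in s /\ (q x).2 \in s.
  apply: sP => [a b aW bW eab||].
  - by rewrite -!pE // qe ?W'W.
  - by rewrite /q iso0.
  - by rewrite /q iso2.
pose Q : I := [ffun x => (inord (index (q x).1 s), inord (index (q x).2 s))].
have QE x : x \in W' -> at_ Q x = q x.
  move=> xW; have [q1 q2] := qs x xW; rewrite [RHS]surjective_pairing /at_ ffunE /=.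
  by rewrite !inordK ?nth_index // ltnS index_size.
have vq u : u \in W' -> e v u -> dist2 (q v) (at_ Q u) = dist2 (z1, z2) (p' u).
  by move=> uW vu; rewrite QE // (qe v u vW (W'W u uW) vu) pv pE.
have cQ : cross (at_ Q u0) (at_ Q u1) (at_ Q u2) != 0.
  apply/eqP => c0; have [_ /(_ c0 (z1, z2) (q v))] := ZBP Q.
  rewrite !vq // => /(_ erefl erefl erefl) h.
  by have := zP (inr (inl Q)); rewrite /= h eqxx.
have qvA : q v = A Q (z1, z2) by apply: affine_imageE; rewrite ?vq.
(* Since [z] avoids [ZC], the identity at [z] holds at every point. At [p' u] it shows that [A Q]
   sends [p' u] to [q u], so the distances between neighbours of [v] are preserved. *)
have AP u : u \in W' -> e v u -> forall z', dist2 (A Q z') (q u) = dist2 z' (p' u).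
  move=> uW vu; have [_ /(_ (z1, z2))] := ZCP (Q, u); rewrite /= QE // -qvA.
  apply; last exact: (zP (inr (inr (Q, u)))).
  by rewrite -(QE u) // vq.
have Au u : u \in W' -> e v u -> A Q (p' u) = q u.
  by move=> uW vu; apply: dist2_eq0; rewrite AP // dist2xx.
have cong : forall x y, x \in W' -> y \in W' -> dist2 (q x) (q y) = dist2 (p' x) (p' y).
  apply: gr' => x y xW yW /orP[exy|/andP[vx vy]].
    by rewrite qe ?W'W // !pE.
  by rewrite -(Au x) // AP.
have congv y : y \in W' -> dist2 (q v) (q y) = dist2 (p v) (p y).
  move=> yW; apply/esym; rewrite (pE y) //.
  have vq' u : u \in W' -> e v u -> dist2 (p v) (p' u) = dist2 (q v) (q u).
    by move=> uW vu; rewrite pv -vq // QE.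
  by apply: (three_points_determine (b0 := q u0) (b1 := q u1) (b2 := q u2) cP); rewrite ?vq' // cong.
move=> x y xW yW; have [->|xv] := eqVneq x v; have [->|yv] := eqVneq y v.
- by rewrite !dist2xx.
- by apply: congv; rewrite !inE yv.
- by rewrite dist2C [RHS]dist2C; apply: congv; rewrite !inE xv.
- by rewrite cong ?inE ?xv ?yv // !pE ?inE ?xv ?yv.
Qed.
End Tanigawa.

(** * Sparse edge sets and Laman's theorem *)

Section Sparse.
Local Open Scope nat_scope.
Variable T : finType.
Implicit Types (F : {set {set T}}) (X Y Z W : {set T}).

Definition inner F X := [set f in F | f \subset X].
Definition edge_family F := forall f, f \in F -> #|f| = 2.
(** Laman's count, at most [2 |X| - 3] edges inside [X], free of natural subtraction; [tight] is the
    reverse inequality. *)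
Definition sparse F := forall X, 1 < #|X| -> #|inner F X| + 3 <= 2 * #|X|.
Definition tight F X := 2 * #|X| <= #|inner F X| + 3.
Definition edge_rel F : rel T := fun x y => [set x; y] \in F.

Lemma innerS F F' X : F \subset F' -> #|inner F X| <= #|inner F' X|.
Proof. by move=> /subsetP FF; apply/subset_leq_card/subsetP => f; rewrite !inE => /andP[/FF -> ->]. Qed.

Lemma inner_supermodular F X Y :
  #|inner F X| + #|inner F Y| <= #|inner F (X :|: Y)| + #|inner F (X :&: Y)|.
Proof.
rewrite -cardsUI; apply: leq_add; apply/subset_leq_card/subsetP => f; rewrite !inE.
  by case/orP => /andP[-> fX]; rewrite (subset_trans fX) ?subsetUl ?subsetUr.
by case/andP => /andP[-> fX] /andP[_ fY]; rewrite subsetI fX fY.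
Qed.

(** Uncrossing: supermodularity adds the two equalities, and sparsity bounds the edges inside the
    intersection. *)
Lemma tightU F X Y : sparse F -> tight F X -> tight F Y -> 1 < #|X :&: Y| -> tight F (X :|: Y).
Proof.
move=> sF tX tY XY; have := inner_supermodular F X Y; have := sF _ XY.
have := cardsUI X Y; rewrite /tight in tX tY *.
move: tX tY; move: #|X| #|Y| #|X :|: Y| #|X :&: Y| #|inner F X| #|inner F Y|
  #|inner F (X :|: Y)| #|inner F (X :&: Y)|; clear; lia.
Qed.

Lemma sparseS F F' : F \subset F' -> sparse F' -> sparse F.
Proof. by move=> FF sF X X2; apply: leq_trans (sF X X2); rewrite leq_add2r innerS. Qed.

Lemma blocked_tight F (f : {set T}) : sparse F -> #|f| = 2 -> f \in F \/ ~ sparse (f |: F) ->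
  exists2 X : {set T}, f \subset X & tight F X.
Proof.
move=> sF f2 [fF|nsp].
  exists f => //; rewrite /tight f2.
  have : 0 < #|inner F f| by apply/card_gt0P; exists f; rewrite !inE fF subxx.
  by move: #|inner F f| => k; lia.
apply: contrapT => nX; apply: nsp => X X2.
have [fX|fX] := boolP (f \subset X).
  have nt : ~ tight F X by move=> tX; apply: nX; exists X.
  have : #|inner (f |: F) X| <= #|inner F X|.+1.
    apply: (@leq_trans #|f |: inner F X|); last by rewrite cardsU1; case: (_ \notin _).
    by apply/subset_leq_card/subsetP => g; rewrite !inE => /andP[/orP[->//|->] ->]; rewrite orbT.
  move/negP: nt; rewrite /tight; move: #|_| #|_| #|_| => a b c; lia.
apply: leq_trans (sF X X2); rewrite leq_add2r; apply/subset_leq_card/subsetP => g.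
rewrite !inE => /andP[/orP[/eqP ->|->] gX] //; by rewrite gX in fX.
Qed.

Lemma handshake F W : edge_family F -> (forall f, f \in F -> f \subset W) ->
  \sum_(v in W) #|[set f in F | v \in f]| = 2 * #|F|.
Proof.
move=> F2 FW; under eq_bigr => v _ do rewrite -sum1dep_card big_mkcondr /=.
rewrite exchange_big /= mulnC -sum_nat_const; apply: eq_bigr => f fF.
rewrite -big_mkcondr /= sum1dep_card -(F2 f fF); apply: eq_card => v; rewrite !inE.
by have [vf|] := boolP (v \in f); rewrite ?andbF // andbT; apply: (subsetP (FW f fF)).
Qed.

Definition nbrs F v := [set x | (x != v) && ([set v; x] \in F)].

Lemma card_nbrs F v : edge_family F -> #|nbrs F v| = #|[set f in F | v \in f]|.
Proof.
move=> F2; have inj : {in nbrs F v &, injective (fun x => [set v; x])}.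
  move=> x y; rewrite !inE => /andP[xv _] /andP[yv _] /setP/(_ x).
  by rewrite !inE eqxx orbT (negPf xv) /= => /esym/eqP.
rewrite -(card_in_imset inj); apply: eq_card => f; rewrite !inE; apply/imsetP/andP.
  by case=> x; rewrite inE => /andP[xv xF] ->; rewrite xF !inE eqxx.
case=> fF vf; have := F2 f fF; rewrite (cardsD1 v) vf => -[] /eqP/cards1P[x fx].
have fE : f = [set v; x] by rewrite -(setD1K vf) fx.
have xfv : x \in f :\ v by rewrite fx inE.
have xv : x != v by move: xfv; rewrite !inE => /andP[].
by exists x; rewrite ?inE ?xv -?fE.
Qed.

Section Degree3.
Variables (F : {set {set T}}) (v a b c : T).
Hypotheses (F2 : edge_family F) (sF : sparse F).
Hypotheses (ab : a != b) (ac : a != c) (bc : b != c).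
Hypotheses (va : a \in nbrs F v) (vb : b \in nbrs F v) (vc : c \in nbrs F v).
Let G := [set f in F | v \notin f].

(** Adding [v] to such a set would add one vertex but three edges and break sparsity. *)
Lemma inner_add_vertex X : v \notin X -> a \in X -> b \in X -> c \in X -> ~ tight G X.
Proof.
move=> vX aX bX cX tX.
have X2 : 1 < #|v |: X|.
  by rewrite cardsU1 vX (cardsD1 a) aX.
have : #|inner G X| + 3 <= #|inner F (v |: X)|.
  have c3 : #|[set [set v; x] | x in [set a; b; c]]| = 3.
    rewrite card_in_imset.
      by rewrite -setUA cardsU1 cards2 !inE negb_or ab ac bc.
    have nv x : x \in [set a; b; c] -> x != v.
      by rewrite !inE -orbA => /or3P[] /eqP ->; [move: va|move: vb|move: vc]; rewrite inE => /andP[].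
    move=> x y /nv xv /nv yv /setP/(_ x).
    by rewrite !inE eqxx orbT (negPf xv) /= => /esym/eqP.
  rewrite -c3 -cardsUI [X in _ + X](_ : _ = 0) ?addn0; last first.
    apply/eqP; rewrite cards_eq0; apply/eqP/setP => f; rewrite !inE.
    apply/negP => /andP[/andP[/andP[_ vf] _] /imsetP[x _ fE]].
    by move: vf; rewrite fE !inE eqxx.
  apply/subset_leq_card/subsetP => f; rewrite !inE => /orP[/andP[/andP[-> _] fX]|/imsetP[x xabc ->]].
    by rewrite (subset_trans fX) ?subsetUr.
  have [xF xX] : [set v; x] \in F /\ x \in X.
    move: xabc; rewrite !inE -orbA => /or3P[] /eqP ->; split=> //;
      by [move: va; rewrite inE => /andP[]|move: vb; rewrite inE => /andP[]|move: vc; rewrite inE => /andP[]].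
  by rewrite xF subUset !sub1set !inE eqxx xX orbT.
have := sF X2; rewrite cardsU1 vX; move: tX; rewrite /tight.
move: #|_| #|_| #|_| => x y z; lia.
Qed.

Lemma sG : sparse G.
Proof. by apply: sparseS sF; apply/subsetP => f; rewrite inE => /andP[]. Qed.

Lemma tight_off_vertex (f : {set T}) : #|f| = 2 -> v \notin f -> f \in G \/ ~ sparse (f |: G) ->
  exists X : {set T}, [/\ v \notin X, f \subset X & tight G X].
Proof.
move=> f2 vf /(blocked_tight sG f2)[X fX tX]; exists (X :\ v); split.
- by rewrite !inE eqxx.
- by rewrite subsetD1 fX vf.
- apply: leq_trans (leq_trans _ tX) _; first by rewrite leq_mul2l subset_leq_card ?subsetDl.
  rewrite leq_add2r; apply/subset_leq_card/subsetP => g; rewrite !inE => /andP[/andP[-> vg] gX].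
  by rewrite vg subsetD1 gX vg.
Qed.

Lemma inner_small X : #|X| <= 1 -> #|inner G X| = 0.
Proof.
move=> X1; apply/eqP; rewrite cards_eq0; apply/eqP/setP => f; rewrite !inE.
apply/negP => /andP[/andP[fF _] /subset_leq_card]; rewrite (F2 fF) => h.
by move: (leq_trans h X1).
Qed.

(** The inverse Henneberg move. If it failed, each pair of neighbours would lie in a tight set
    avoiding [v]. By uncrossing, these three sets meet pairwise only in the common neighbour, and
    then the count makes their union tight, although it contains all three neighbours. *)
Lemma henneberg_pair : exists x y, [/\ x \in [set a; b; c], y \in [set a; b; c], x != y,
  [set x; y] \notin G & sparse ([set x; y] |: G)].
Proof.
have nv x : x \in [set a; b; c] -> x != v.
  by rewrite !inE -orbA => /or3P[] /eqP ->; [move: va|move: vb|move: vc]; rewrite inE => /andP[].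
apply: contrapT => nxy.
have blk x y : x \in [set a; b; c] -> y \in [set a; b; c] -> x != y ->
   exists X, [/\ v \notin X, x \in X, y \in X & tight G X].
  move=> x3 y3 xy; have [|||X [vX xyX tX]] := @tight_off_vertex [set x; y].
  - by rewrite cards2 xy.
  - by rewrite !inE !(eq_sym v) !negb_or !nv.
  - have [xyG|xyG] := boolP ([set x; y] \in G); first by left.
    by right => sp; apply: nxy; exists x, y.
  by exists X; move: xyX; rewrite subUset !sub1set => /andP[].
have [|||X [vX aX bX tX]] := blk a b; rewrite ?inE ?eqxx ?orbT //.
have [|||Y [vY bY cY tY]] := blk b c; rewrite ?inE ?eqxx ?orbT //.
have [|||Z [vZ aZ cZ tZ]] := blk a c; rewrite ?inE ?eqxx ?orbT //.
have XY : #|X :&: Y| <= 1.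
  rewrite leqNgt; apply/negP => h; have := tightU sG tX tY h.
  by apply: inner_add_vertex; rewrite !inE ?negb_or ?vX ?vY ?aX ?bX ?cY ?orbT.
have XZ : #|X :&: Z| <= 1.
  rewrite leqNgt; apply/negP => h; have := tightU sG tX tZ h.
  by apply: inner_add_vertex; rewrite !inE ?negb_or ?vX ?vZ ?aX ?bX ?cZ ?orbT.
have YZ : #|Y :&: Z| <= 1.
  rewrite leqNgt; apply/negP => h; have := tightU sG tY tZ h.
  by apply: inner_add_vertex; rewrite !inE ?negb_or ?vY ?vZ ?aZ ?bY ?cY ?orbT.
apply: (@inner_add_vertex (X :|: Y :|: Z)); rewrite ?inE ?negb_or ?vX ?vY ?vZ ?aX ?bX ?cY ?orbT //.
have disj A B : #|A :&: B| <= 1 -> [disjoint inner G A & inner G B].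
  move=> AB; rewrite -setI_eq0 -cards_eq0 -leqn0 -(inner_small AB).
  apply/subset_leq_card/subsetP => f; rewrite !inE => /andP[/andP[-> fA] /andP[_ fB]].
  by rewrite subsetI fA fB.
have i3 : #|inner G X| + #|inner G Y| + #|inner G Z| <= #|inner G (X :|: Y :|: Z)|.
  have dXY := disj _ _ XY; have dXZ := disj _ _ XZ; have dYZ := disj _ _ YZ.
  have <- : #|inner G X :|: inner G Y| = #|inner G X| + #|inner G Y|.
    by apply/eqP; rewrite leq_card_setU.
  have <- : #|inner G X :|: inner G Y :|: inner G Z| = #|inner G X :|: inner G Y| + #|inner G Z|.
    by apply/eqP; rewrite leq_card_setU -setI_eq0 setIUl setU_eq0 !setI_eq0 dXZ dYZ.
  apply/subset_leq_card/subsetP => f; rewrite !inE.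
  by case/orP => [/orP[]|] /andP[-> fX] /=; rewrite (subset_trans fX) //
     ?subsetUr // -?setUA ?subsetUl // setUCA subsetUl.
have u2 : #|X :|: Y| + 1 <= #|X| + #|Y|.
  by rewrite -cardsUI leq_add2l; apply/card_gt0P; exists b; rewrite !inE bX.
have u3 : #|X :|: Y :|: Z| + 2 <= #|X :|: Y| + #|Z|.
  rewrite -cardsUI leq_add2l; have <- : #|[set a; c]| = 2 by rewrite cards2 ac.
  by apply/subset_leq_card/subsetP => x; rewrite !inE => /orP[] /eqP ->; rewrite ?aX ?aZ ?cY ?cZ ?orbT.
move: i3 u2 u3 tX tY tZ; rewrite /tight.
move: #|inner G X| #|inner G Y| #|inner G Z| #|inner G (X :|: Y :|: Z)|.
move: #|X :|: Y :|: Z| #|X :|: Y| #|X| #|Y| #|Z|; clear; lia.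
Qed.
End Degree3.
End Sparse.

Section Laman.
Variable T : finType.
Implicit Types (p q m : realisation T) (F : {set {set T}}) (W X Y : {set T}).

(** Two bars in independent directions leave [v] no velocity of its own. *)
Lemma extend_trivial p m W v x y : trivial_flex p m (W :\ v) -> x \in W :\ v -> y \in W :\ v ->
  strain p m v x = 0 -> strain p m v y = 0 -> cross (p v) (p x) (p y) != 0 -> trivial_flex p m W.
Proof.
move=> [a [b [c abc]]] xW yW sx sy cr; exists a, b, c => z zW.
have [->|zv] := eqVneq z v; last by apply: abc; rewrite !inE zv.
have [x1 x2] := abc _ xW; have [y1 y2] := abc _ yW.
pose u := (m v).1 - (a - c * (p v).2); pose w := (m v).2 - (b + c * (p v).1).
have [||| u0 w0] := @linear2_eq0 ((p v).1 - (p x).1) ((p v).2 - (p x).2)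
  ((p v).1 - (p y).1) ((p v).2 - (p y).2) u w.
- by apply: contra_neq cr => h; rewrite -[RHS]h /cross; ring.
- by rewrite -[RHS]sx /strain x1 x2 /u /w; ring.
- by rewrite -[RHS]sy /strain y1 y2 /u /w; ring.
by move: u0 w0; rewrite /u /w => u0 w0; split; lra.
Qed.

Lemma infrigidS p W (e e' : rel T) : (forall x y, e x y -> e' x y) -> infrigid p W e -> infrigid p W e'.
Proof. by move=> ee ir m mf; apply: ir => x y xW yW exy; apply: mf => //; apply: ee. Qed.

(* The new vertex is placed on the line through [a] and [b], where its two
   bars to [a] and [b] act as the bar [ab]. *)
Lemma henneberg1 p W (G : {set {set T}}) v a b c : generic_real p ->
  a \in W :\ v -> b \in W :\ v -> c \in W :\ v -> a != b -> a != c -> b != c -> v \in W ->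
  infrigid p (W :\ v) (edge_rel ([set a; b] |: G)) ->
  infrigid p W (edge_rel ([set v; a] |: ([set v; b] |: ([set v; c] |: G)))).
Proof.
move=> gp aW bW cW ab ac bc vW ir.
pose p0 := relocate p v (((p a).1 + (p b).1) / 2, ((p a).2 + (p b).2) / 2).
have pE x : x \in W :\ v -> p0 x = p x by rewrite !inE /p0 /relocate => /andP[/negPf -> _].
have pv : p0 v = (((p a).1 + (p b).1) / 2, ((p a).2 + (p b).2) / 2) by rewrite /p0 /relocate eqxx.
have W'W x : x \in W :\ v -> x \in W by rewrite !inE => /andP[].
apply: (@infrigid_transfer _ p p0 W _ a b gp (W'W _ aW) (W'W _ bW)).
  by rewrite !pE // generic_neq2.
move=> m mf.
have se u : u \in W :\ v -> [set v; u] \in [set v; a] |: ([set v; b] |: ([set v; c] |: G)) ->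
   strain p0 m v u = 0 by move=> uW uF; apply: mf => //; apply: W'W.
have sa : strain p0 m v a = 0 by apply: se; rewrite // !inE eqxx.
have sb : strain p0 m v b = 0 by apply: se; rewrite // !inE eqxx !orbT.
have sc : strain p0 m v c = 0 by apply: se; rewrite // !inE eqxx !orbT.
have sab : strain p m a b = 0.
  by move: sa sb; rewrite /strain pv !pE // /= => sa sb; lra.
have tr : trivial_flex p m (W :\ v).
  apply: ir => x y xW yW; rewrite /edge_rel !inE => /orP[/eqP/setP xyab|xyG].
    have := xyab y; have := xyab x; rewrite !inE !eqxx orbT /= => /esym hx /esym hy.
    case/orP: hx => /eqP ->; case/orP: hy => /eqP ->; rewrite ?strainxx //.
    by rewrite strainC.
  have -> : strain p m x y = strain p0 m x y by rewrite /strain !pE.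
  by apply: mf; rewrite ?W'W // /edge_rel !inE xyG !orbT.
have tr0 : trivial_flex p0 m (W :\ v).
  by case: tr => a' [b' [c' abc]]; exists a', b', c' => x xW; rewrite pE //; apply: abc.
apply: (extend_trivial tr0 aW cW sa sc).
rewrite pv !pE //; have := @generic_cross _ p a b c gp ab ac bc.
by apply: contra_neq; rewrite /cross /= => h; lra.
Qed.

(** The average degree is below four, and sparsity away from [v] gives degree at least two. A vertex
    of degree two is held by its two bars; one of degree three is removed by [henneberg_pair] and
    put back by [henneberg1]. *)
Theorem laman W F : (1 < #|W|)%N -> edge_family F -> (forall f, f \in F -> f \subset W) ->
  sparse F -> (#|F| + 3 = 2 * #|W|)%N -> forall p, generic_real p -> infrigid p W (edge_rel F).
Proof.
have [n] := ubnP #|W|; elim: n W F => // n IH W F Wn W2 F2 FW sF cF p gp.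
have [Wle2|W3] := leqP #|W| 2.
  have cW : #|W| = 2%N by apply/eqP; rewrite eqn_leq Wle2.
  have /eqP/cards1P[f Ff] : #|F| = 1%N by move: cF; rewrite cW; lia.
  have fE : f = W.
    have fF : f \in F by rewrite Ff inE.
    by apply/eqP; rewrite eqEcard FW // cW F2.
  move=> m mf; apply: (@complete_infrigid _ p W gp) => x y xW yW _.
  have [->|xy] := eqVneq x y; first exact: strainxx.
  apply: mf => //; rewrite /edge_rel Ff inE fE eqEcard cW cards2 xy andbT.
  by rewrite subUset !sub1set xW yW.
have [v vW dv3] : exists2 v, v \in W & (#|nbrs F v| <= 3)%N.
  apply: contrapT => nv.
  have : (\sum_(v in W) 4 <= \sum_(v in W) #|[set f in F | v \in f]|)%N.
    apply: leq_sum => v vW; rewrite -card_nbrs // ltnNge; apply/negP => h.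
    by apply: nv; exists v.
  by rewrite sum_nat_const handshake //; move: cF; move: #|F| #|W| => a b; clear; lia.
pose G := [set f in F | v \notin f].
have cW : #|W| = #|W :\ v|.+1 by rewrite (cardsD1 v) vW.
have cG : (#|F| = #|G| + #|nbrs F v|)%N.
  rewrite card_nbrs // addnC -(cardsID [set f : {set T} | v \in f] F); congr (_ + _)%N.
    by apply: eq_card => f; rewrite !inE andbC.
  by apply: eq_card => f; rewrite !inE andbC.
have GW : forall f, f \in G -> f \subset W :\ v.
  by move=> f; rewrite inE => /andP[/FW fW vf]; rewrite subsetD1 fW.
have G2 : edge_family G by move=> f; rewrite inE => /andP[/F2].
have sG : sparse G by apply: sparseS sF; apply/subsetP => f; rewrite inE => /andP[].
have dv2 : (2 <= #|nbrs F v|)%N.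
  have W'2 : (1 < #|W :\ v|)%N by move: W3; rewrite cW.
  have := sG _ W'2; have -> : inner G (W :\ v) = G.
    by apply/setP => f; rewrite !inE; case: (boolP (f \in F)) => //= fF; case: (boolP (v \in f)) => //= vf;
      apply: GW; rewrite inE fF vf.
  by move: cF cG cW; move: #|F| #|G| #|W| #|W :\ v| #|nbrs F v|; clear; lia.
have nbrP x : x \in nbrs F v -> x \in W :\ v /\ [set v; x] \in F.
  rewrite inE => /andP[xv vxF]; split=> //; rewrite !inE xv.
  by apply: (subsetP (FW _ vxF)); rewrite !inE eqxx orbT.
have [d3|d2] := boolP (2 < #|nbrs F v|)%N; last first.
  have /eqP/cards2P[a [b [ab nE]]] : #|nbrs F v| = 2%N by apply/eqP; rewrite eqn_leq dv2 leqNgt d2.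
  have [|aW vaF] := nbrP a; first by rewrite nE !inE eqxx.
  have [|bW vbF] := nbrP b; first by rewrite nE !inE eqxx orbT.
  have irG : infrigid p (W :\ v) (edge_rel G).
    by apply: IH => //; move: Wn W3 cF cG cW dv2 d2;
      move: #|F| #|G| #|W| #|W :\ v| #|nbrs F v|; clear; lia.
  move=> m mf; have tr : trivial_flex p m (W :\ v).
    apply: irG => x y; rewrite !inE => /andP[_ xW] /andP[_ yW]; rewrite /edge_rel inE => /andP[xyF _].
    exact: mf.
  have [av aW0] : a != v /\ a \in W by move: aW; rewrite !inE => /andP[].
  have [bv bW0] : b != v /\ b \in W by move: bW; rewrite !inE => /andP[].
  apply: (extend_trivial tr aW bW); [exact: mf|exact: mf|].
  by apply: generic_cross; rewrite // eq_sym.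
have cn3 : #|nbrs F v| = 3%N by apply/eqP; rewrite eqn_leq dv3.
have [a an] : exists a, a \in nbrs F v by apply/card_gt0P; rewrite cn3.
have /eqP/cards2P[b [c [bc nE]]] : #|nbrs F v :\ a| = 2%N.
  by move: cn3; rewrite (cardsD1 a) an => -[].
have /andP[ba bn] : (b != a) && (b \in nbrs F v) by rewrite -in_setD1 nE !inE eqxx.
have /andP[ca cn] : (c != a) && (c \in nbrs F v) by rewrite -in_setD1 nE !inE eqxx orbT.
have ab : a != b by rewrite eq_sym.
have ac : a != c by rewrite eq_sym.
have [x [y [x3 y3 xy xyG sxy]]] := henneberg_pair F2 sF ab ac bc an bn cn.
have abcn z : z \in [set a; b; c] -> z \in nbrs F v.
  by rewrite !inE -orbA => /or3P[] /eqP ->; [move: an|move: bn|move: cn]; rewrite inE.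
have [w [w3 wx wy]] : exists w, [/\ w \in [set a; b; c], w != x & w != y].
  have : (0 < #|[set a; b; c] :\ x :\ y|)%N.
    have : #|[set a; b; c]| = 3%N by rewrite -setUA cardsU1 cards2 !inE negb_or ab ac bc.
    move=> c3; have e1 := cardsD1 x [set a; b; c]; have e2 := cardsD1 y ([set a; b; c] :\ x).
    rewrite x3 c3 in e1; rewrite in_setD1 y3 [y == x]eq_sym xy in e2.
    by move: e1; rewrite e2 add1n add1n => -[] <-.
  by case/card_gt0P => w; rewrite in_setD1 => /andP[wy]; rewrite in_setD1 => /andP[wx w3]; exists w.
have [xW vxF] := nbrP x (abcn x x3); have [yW vyF] := nbrP y (abcn y y3).
have [wW vwF] := nbrP w (abcn w w3).
have irG : infrigid p (W :\ v) (edge_rel ([set x; y] |: G)).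
  apply: IH => //.
  - by move: Wn; rewrite cW.
  - by move: W3; rewrite cW.
  - by move=> f; rewrite !inE => /orP[/eqP ->|fG]; [rewrite cards2 xy | apply: G2; rewrite inE].
  - move=> f; rewrite in_setU1 => /orP[/eqP ->|/GW //]; by rewrite subUset !sub1set xW yW.
  - rewrite cardsU1 xyG; move: cF cG cW cn3.
    by move: #|F| #|G| #|W| #|W :\ v| #|nbrs F v|; clear; lia.
have xw : x != w by rewrite eq_sym.
have yw : y != w by rewrite eq_sym.
have := henneberg1 gp xW yW wW xy xw yw vW irG.
apply: infrigidS => s t; rewrite /edge_rel !inE.
by case/or4P => [/eqP ->|/eqP ->|/eqP ->|/andP[]].
Qed.

(* A maximal sparse set of edges is covered by its maximal tight sets, which
   pairwise share at most one vertex. *)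
Lemma maximal_sparse_rigid W (E : {set {set T}}) : (1 < #|W|)%N -> edge_family E ->
  (forall f, f \in E -> f \subset W) ->
  (forall s : seq {set T}, (forall X, X \in s -> (1 < #|X|)%N /\ X \subset W) ->
    (2 * #|W| <= \sum_(X <- s) (2 * #|X| - 3) +
      #|[set f in E | all (fun X : {set T} => ~~ (f \subset X)) s]| + 3)%N) ->
  forall p, generic_real p -> infrigid p W (edge_rel E).
Proof.
move=> W2 E2 EW cover p gp.
have ex0 : exists F : {set {set T}}, (F \subset E) && `[< sparse F >].
  exists set0; rewrite sub0set; apply/asboolP => X X2.
  have -> : inner set0 X = set0 by apply/setP => f; rewrite !inE.
  by rewrite cards0; lia.
have [F /andP[FE /asboolP sF] Fmax] := @arg_maxnP _ _ (fun F => (F \subset E) && `[< sparse F >])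
  (fun F : {set {set T}} => #|F|) (xchooseP ex0).
have F2 : edge_family F by move=> f /(subsetP FE)/E2.
have FW f : f \in F -> f \subset W by move=> /(subsetP FE)/EW.
pose TW X := [&& (1 < #|X|)%N, X \subset W & (2 * #|X| <= #|inner F X| + 3)%N].
pose s := enum [set X : {set T} | TW X && [forall Y : {set T}, TW Y ==> (X \subset Y) ==> (Y == X)]].
have maxT X : TW X -> exists2 Y, Y \in s & X \subset Y.
  move=> tX; have [Y /andP[tY XY] Ymax] := @arg_maxnP _ X (fun Y => TW Y && (X \subset Y))
    (fun Y : {set T} => #|Y|) (introT andP (conj tX (subxx X))).
  exists Y => //; rewrite mem_enum inE tY; apply/forallP => Z; apply/implyP => tZ; apply/implyP => YZ.
  rewrite eq_sym eqEcard YZ; apply: Ymax; rewrite tZ.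
  exact: subset_trans XY YZ.
have sP X : X \in s -> TW X /\ forall Y, TW Y -> X \subset Y -> Y = X.
  rewrite mem_enum inE => /andP[tX /forallP h]; split=> // Y tY XY.
  by have := h Y; rewrite tY XY /= => /eqP.
have coverE f : f \in E -> exists2 X, X \in s & f \subset X.
  move=> fE; have [X fX tX] : exists2 X : {set T}, f \subset X & tight F X.
    apply: blocked_tight => //; first exact: E2.
    have [fF|fF] := boolP (f \in F); [by left|right=> sfF].
    have := Fmax (f |: F); rewrite cardsU1 fF subUset sub1set fE FE /= => h.
    by have := h (asboolT sfF); rewrite add1n ltnn.
  have tXW : TW (X :&: W).
    have fXW : f \subset X :&: W by rewrite subsetI fX EW.
    apply/and3P; split; [|exact: subsetIr|].
      by apply: leq_trans (subset_leq_card fXW); rewrite E2.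
    apply: leq_trans (leq_trans _ tX) _; first by rewrite leq_mul2l subset_leq_card ?subsetIl.
    rewrite leq_add2r; apply/subset_leq_card/subsetP => g; rewrite !inE => /andP[gF gX].
    by rewrite gF subsetI gX FW.
  by have [Y Ys XY] := maxT _ tXW; exists Y; rewrite // (subset_trans _ XY) // subsetI fX EW.
have sumF : (\sum_(X <- s) (2 * #|X| - 3) <= #|F|)%N.
  have -> : (\sum_(X <- s) (2 * #|X| - 3) = \sum_(X <- s) #|inner F X|)%N.
    rewrite !big_seq; apply: eq_bigr => X /sP[/and3P[X2 _ tX] _].
    by have := sF X X2; move: tX; move: #|X| #|inner F X| => a b; clear; lia.
  have -> : (\sum_(X <- s) #|inner F X| = \sum_(f in F) count (fun X : {set T} => f \subset X) s)%N.
    under eq_bigr => X _ do rewrite -sum1dep_card big_mkcondr /=.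
    rewrite exchange_big /=; apply: eq_bigr => f fF; rewrite -sum1_count.
    by rewrite -big_mkcond.
  rewrite -sum1_card; apply: leq_sum => f fF.
  rewrite -size_filter; case E1: (filter _ s) => [|X [|Y r]] //.
  have us : uniq [seq X : {set T} <- s | f \subset X] by rewrite filter_uniq // enum_uniq.
  have : X \in [seq X : {set T} <- s | f \subset X] by rewrite E1 inE eqxx.
  have : Y \in [seq X : {set T} <- s | f \subset X] by rewrite E1 !inE eqxx orbT.
  rewrite mem_filter => /andP[fY Ys]; rewrite mem_filter => /andP[fX Xs].
  have [tY mY] := sP Y Ys; have [tX mX] := sP X Xs.
  have tXY : TW (X :|: Y).
    case/and3P: tX => X2 XW tX; case/and3P: tY => Y2 YW tY.
    apply/and3P; split; first by apply: leq_trans X2 (subset_leq_card (subsetUl _ _)).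
      by rewrite subUset XW.
    apply: tightU => //; apply: (@leq_trans #|f|); first by rewrite F2.
    by apply: subset_leq_card; rewrite subsetI fX.
  have XY : X = Y by rewrite -(mX _ tXY) ?subsetUl // (mY _ tXY) ?subsetUr.
  by move: us; rewrite E1 XY /= inE eqxx.
have unc0 : [set f in E | all (fun X : {set T} => ~~ (f \subset X)) s] = set0.
  apply/setP => f; rewrite !inE; apply/negP => /andP[/coverE[X Xs fX] /allP/(_ X Xs)].
  by rewrite fX.
have cF : (#|F| + 3 = 2 * #|W|)%N.
  have hs X : X \in s -> (1 < #|X|)%N /\ X \subset W by move=> /sP[/and3P[]].
  have := cover s hs; rewrite unc0 cards0 addn0 => h.
  have := sF W W2; have -> : inner F W = F.
    by apply/setP => f; rewrite !inE; case: (boolP (f \in F)) => //= /FW.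
  by move: h sumF; move: (\sum_(X <- s) _)%N #|F| #|W|; clear; lia.
apply: (infrigidS (e := edge_rel F)); last exact: laman.
by move=> x y; apply: (subsetP FE).
Qed.
End Laman.

(** * Edge cuts of distance-regular graphs *)

Section Distance.
Local Open Scope nat_scope.
Variables (T : finType) (e : rel T).
Hypotheses (se : ssrbool.symmetric e) (ie : ssrbool.irreflexive e) (ce : connected_graph e).
Local Notation d := (gdist e).

Lemma gballS x n y z : y \in gball e x n -> e y z -> z \in gball e x n.+1.
Proof. by move=> yB yz; rewrite /= !inE; apply/orP; right; apply/existsP; exists y; rewrite yB. Qed.

Lemma gball_mono x n m y : n <= m -> y \in gball e x n -> y \in gball e x m.
Proof.
move=> /subnK <-; elim: (m - n) => // i IH /IH yB.
by rewrite addSn /= inE yB.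
Qed.

Lemma gball_path x q : path e x q -> last x q \in gball e x (size q).
Proof.
elim/last_ind: q => [|q y IH]; first by rewrite inE.
by rewrite rcons_path last_rcons size_rcons => /andP[/IH h] /(gballS h).
Qed.

Lemma gball_find x y : has (fun n => y \in gball e x n) (iota 0 #|T|).
Proof.
have /connectP[q eq ->] := ce x y; have [q' eq' uq' _] := shortenP eq.
apply/hasP; exists (size q'); last exact: gball_path.
by rewrite mem_iota /= add0n -[_.+1]/(size (x :: q')) -(card_uniqP uq') max_card.
Qed.

Lemma gdist_leP x y n : reflect (d x y <= n) (y \in gball e x n).
Proof.
have hf := gball_find x y.
have dT : d x y < #|T| by rewrite /gdist -[X in _ < X](size_iota 0) -has_find.
have yd : y \in gball e x (d x y).
  by have := nth_find 0 hf; rewrite nth_iota.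
apply: (iffP idP) => [yn|dn]; last exact: gball_mono yd.
rewrite leqNgt; apply/negP => nd.
have := before_find 0 (a := fun n => y \in gball e x n) (s := iota 0 #|T|) nd.
by rewrite nth_iota ?yn // (ltn_trans nd).
Qed.

Lemma gdist_eq0 x y : (d x y == 0) = (x == y).
Proof.
rewrite -leqn0; apply/idP/eqP => [/gdist_leP|->]; first by rewrite /= inE => /eqP.
by apply/gdist_leP; rewrite /= inE.
Qed.

Lemma gdistxx x : d x x = 0.
Proof. by apply/eqP; rewrite gdist_eq0. Qed.

Lemma gdist_step x y z : e y z -> d x z <= (d x y).+1.
Proof. by move=> yz; apply/gdist_leP/(gballS _ yz)/gdist_leP. Qed.

Lemma gdist_pred x y n : d x y = n.+1 -> exists2 z, e z y & d x z = n.
Proof.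
move=> dxy; have /gdist_leP : d x y <= n.+1 by rewrite dxy.
rewrite /= !inE => /orP[/gdist_leP|]; first by rewrite dxy ltnn.
case/existsP => z /andP[/gdist_leP dz zy]; exists z => //; apply/eqP; rewrite eqn_leq dz.
by have := gdist_step x zy; rewrite dxy.
Qed.

Lemma gdist_triangle x y z : d x z <= d x y + d y z.
Proof.
move E: (d y z) => n; elim: n z E => [|n IH] z E.
  by move/eqP: E; rewrite gdist_eq0 => /eqP ->; rewrite addn0.
have [w wz dw] := gdist_pred E.
by rewrite addnS; apply: leq_trans (gdist_step x wz) _; rewrite ltnS IH.
Qed.

Lemma gdist_eq1 x y : (d x y == 1) = e x y.
Proof.
apply/eqP/idP => [/gdist_pred[z zy /eqP]|xy]; first by rewrite gdist_eq0 => /eqP ->.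
apply/eqP; rewrite eqn_leq lt0n gdist_eq0; apply/andP; split.
  by have := gdist_step x xy; rewrite gdistxx.
by apply: contraTneq xy => ->; rewrite ie.
Qed.

Lemma gdistC x y : d x y = d y x.
Proof.
suff le a b : d b a <= d a b by apply/eqP; rewrite eqn_leq !le.
move E: (d a b) => n; elim: n b E => [|n IH] b E.
  by move/eqP: E; rewrite gdist_eq0 => /eqP ->; rewrite gdistxx.
have [z zb dz] := gdist_pred E.
apply: leq_trans (gdist_triangle b z a) _.
by have /eqP -> : d b z == 1; [rewrite gdist_eq1 se | rewrite add1n ltnS IH].
Qed.

Lemma gdist_succ x y n : d x y = n.+1 -> exists2 z, e x z & d z y = n.
Proof.
by rewrite gdistC => /gdist_pred[z zx dz]; exists z; rewrite 1?se // gdistC.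
Qed.

Lemma gdist_ge1 x y : e x y -> d x y = 1. Proof. by move=> xy; apply/eqP; rewrite gdist_eq1. Qed.
End Distance.

(** * Degrees and edge cuts *)

Section DegreeCounts.
Local Open Scope nat_scope.
Variables (T : finType) (e : rel T).
Hypotheses (se : ssrbool.symmetric e) (ie : ssrbool.irreflexive e).
Implicit Types (X Y : {set T}).

Definition degin X x := #|[set y in X | e x y]|.
Definition boundary X := \sum_(x in X) degin (~: X) x.

Lemma sum_degin X Y : \sum_(x in X) degin Y x = \sum_(y in Y) degin X y.
Proof.
have aux A B : \sum_(x in A) degin B x = \sum_(x in A) \sum_(y in B) (e x y : nat).
  apply: eq_bigr => x _; rewrite /degin -sum1dep_card big_mkcondr /=.
  by apply: eq_bigr => y _; case: (e x y).
rewrite !aux exchange_big /=; apply: eq_bigr => y _; apply: eq_bigr => x _.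
by rewrite se.
Qed.

Lemma boundaryC X : boundary (~: X) = boundary X.
Proof. by rewrite /boundary setCK sum_degin. Qed.

Lemma degin_le_boundary X x : x \in X -> degin (~: X) x <= boundary X.
Proof. by move=> xX; rewrite /boundary (bigD1 x) //= leq_addr. Qed.

(** Each edge inside [X] is counted from both ends; the enumeration order separates the two. *)
Lemma sum_degin_even X : ~~ odd (\sum_(x in X) degin X x).
Proof.
pose S (c : rel T) := \sum_(x in X) \sum_(y in X) (e x y && c x y : nat).
have -> : \sum_(x in X) degin X x =
  S (fun x y => enum_rank x < enum_rank y) + S (fun x y => enum_rank y < enum_rank x).
  rewrite -big_split /=; apply: eq_bigr => x _; rewrite -big_split /= /degin.
  rewrite -sum1dep_card big_mkcondr /=; apply: eq_bigr => y _.
  case exy: (e x y) => //=; case: (ltngtP (enum_rank x) (enum_rank y)) => // h.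
  by move: exy; rewrite (enum_rank_inj (val_inj h)) ie.
have -> : S (fun x y => enum_rank y < enum_rank x) = S (fun x y => enum_rank x < enum_rank y).
  by rewrite /S exchange_big /=; apply: eq_bigr => x _; apply: eq_bigr => y _; rewrite se.
by rewrite addnn odd_double.
Qed.

Lemma degin_split X x : degin setT x = degin X x + degin (~: X) x.
Proof.
rewrite /degin -(cardsID X [set y in setT | e x y]); congr (_ + _); apply: eq_card => y;
  by rewrite !inE andbC.
Qed.

Variable k : nat.
Hypothesis reg : forall x, #|[set y | e x y]| = k.

Lemma degin_total x : degin setT x = k.
Proof. by rewrite -(reg x); apply: eq_card => y; rewrite !inE. Qed.

Lemma deginC X x : degin X x + degin (~: X) x = k.
Proof. by rewrite -degin_split degin_total. Qed.

Lemma boundary_parity X : odd (boundary X) = odd (k * #|X|).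
Proof.
have : \sum_(x in X) degin X x + boundary X = k * #|X|.
  rewrite -big_split /= (eq_bigr (fun _ => k)) => [|x _]; last exact: deginC.
  by rewrite sum_nat_const mulnC.
by move=> <-; rewrite oddD (negPf (sum_degin_even X)).
Qed.

Lemma degin_lt X x : x \in X -> degin X x < #|X|.
Proof.
move=> xX; rewrite (cardsD1 x X) xX add1n ltnS; apply/subset_leq_card/subsetP => y.
by rewrite !inE => /andP[-> xy]; rewrite andbT; apply: contraTneq xy => ->; rewrite ie.
Qed.

(** Each vertex has at least [k + 1 - |X|] neighbours outside [X]; the concave product
    [s (k + 1 - s)] is smallest at [s = 2] and [s = k - 1]. *)
Lemma boundary_small X : 2 <= #|X| -> #|X| < k -> 2 * (k - 1) <= boundary X.
Proof.
move=> X2 Xk; apply: (@leq_trans (#|X| * (k.+1 - #|X|))).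
  move: X2 Xk; move: #|X| => s s2 sk.
  have -> : k.+1 - s = (k - 1 - s) + 2 by lia.
  have : k - 1 = (k - 1 - s) + s by lia.
  by move: (k - 1 - s) => a ->; nia.
rewrite -sum_nat_const; apply: leq_sum => x xX.
by have := deginC X x; have := degin_lt xX; move: #|X| (degin X x) (degin (~: X) x) => *; lia.
Qed.

(** The hypotheses force [|X| = k] and exactly one outgoing edge per vertex, leaving [k - 1]
    neighbours among the [k - 1] other vertices of [X]. *)
Lemma boundary_clique X : k <= #|X| -> boundary X <= k ->
  (forall x, x \in X -> 0 < degin (~: X) x) -> forall x y, x \in X -> y \in X -> x != y -> e x y.
Proof.
move=> kX bk h.
have s1 : \sum_(x in X) 1 <= boundary X by apply: leq_sum => x /h.
have cX : #|X| = k.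
  by apply/eqP; rewrite eqn_leq kX andbT; apply: leq_trans bk; rewrite -sum1_card.
have d1 x : x \in X -> degin (~: X) x = 1.
  move=> xX; apply/eqP; rewrite eqn_leq h // andbT; move: bk; rewrite /boundary (bigD1 x) //=.
  have : \sum_(y in X | y != x) 1 <= \sum_(y in X | y != x) degin (~: X) y.
    by apply: leq_sum => y /andP[/h].
  have := cX; rewrite -sum1_card (bigD1 x) //=.
  by move: (\sum_(y in X | y != x) 1) (\sum_(y in X | y != x) _) (degin _ x) => *; lia.
move=> x y xX yX xy; apply: contraTT (leqnn (degin X x)) => nxy; rewrite -ltnNge.
have : degin X x <= #|X :\ x :\ y|.
  apply/subset_leq_card/subsetP => z; rewrite !inE => /andP[-> xz]; rewrite andbT.
  by apply/andP; split; apply: contraTneq xz => ->; rewrite ?ie.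
have := cX; rewrite (cardsD1 x X) xX (cardsD1 y (X :\ x)) !inE eq_sym xy yX /=.
by have := deginC X x; rewrite d1 //; move: (degin X x) #|_| => *; lia.
Qed.
End DegreeCounts.

(** * Intersection numbers and the geodesic flow *)

Section Drg.
Local Open Scope nat_scope.
Variables (T : finType) (e : rel T) (k : nat).
Hypotheses (se : ssrbool.symmetric e) (ie : ssrbool.irreflexive e) (ce : connected_graph e).
Hypotheses (dr : distance_regular e) (reg : forall x, #|[set y | e x y]| = k).
Local Notation d := (gdist e).
Local Notation degin := (degin e).
Local Notation boundary := (boundary e).

Lemma nbr_count i j : exists a, forall x y, d x y = j -> #|[set z | e y z & d x z == i]| = a.
Proof.
have [a aP] := dr i 1 j; exists a => x y /aP <-; apply: eq_card => z.
by rewrite !inE gdist_eq1 // andbC.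
Qed.

(** The intersection numbers [b_j] and [c_j] of the graph; for distances that do not occur the
    values are arbitrary. *)
Lemma intersection_numbers : exists b c : nat -> nat,
  (forall j x y, d x y = j -> #|[set z | e y z & d x z == j.+1]| = b j) /\
  (forall j x y, d x y = j.+1 -> #|[set z | e y z & d x z == j]| = c j.+1).
Proof.
have [b bP] := choice (fun j => nbr_count j.+1 j).
have [c cP] := choice (fun j => nbr_count j j.+1).
by exists b, (fun j => c j.-1); split=> j x y; [apply: bP | apply: cP].
Qed.

Variables b c : nat -> nat.
Hypothesis bP : forall j x y, d x y = j -> #|[set z | e y z & d x z == j.+1]| = b j.
Hypothesis cP : forall j x y, d x y = j.+1 -> #|[set z | e y z & d x z == j]| = c j.+1.

Lemma c_gt0 j x y : d x y = j.+1 -> 0 < c j.+1.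
Proof.
move=> dxy; rewrite -(cP dxy); apply/card_gt0P; have [z zy dz] := gdist_pred ce dxy.
by exists z; rewrite inE se zy dz eqxx.
Qed.

(** Move [x] one step towards [y]: the neighbours of [y] on geodesics from the new point lie on
    geodesics from [x] as well. *)
Lemma c_mono j x y : d x y = j.+2 -> c j.+1 <= c j.+2.
Proof.
move=> dxy; have [x' xx' dx'] := gdist_succ se ie ce dxy.
rewrite -(cP dxy) -(cP dx'); apply/subset_leq_card/subsetP => z; rewrite !inE.
move=> /andP[yz /eqP dz]; rewrite yz /= eqn_leq; apply/andP; split.
  by have := gdist_triangle ce x x' z; rewrite (gdist_ge1 ie ce xx') dz.
have zy : e z y by rewrite se.
by have := gdist_triangle ce x z y; rewrite dxy (gdist_ge1 ie ce zy) addn1.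
Qed.

Lemma b_mono j x y : d x y = j.+1 -> b j.+1 <= b j.
Proof.
move=> dxy; have [x' xx' dx'] := gdist_succ se ie ce dxy.
rewrite -(bP dxy) -(bP dx'); apply/subset_leq_card/subsetP => z; rewrite !inE.
move=> /andP[yz /eqP dz]; rewrite yz /= eqn_leq; apply/andP; split.
  by have := gdist_step ce x' yz; rewrite dx'.
by have := gdist_triangle ce x x' z; rewrite dz (gdist_ge1 ie ce xx') add1n ltnS.
Qed.

Lemma c1 x y : e x y -> c 1 = 1.
Proof.
move=> xy; rewrite -(cP (gdist_ge1 ie ce xy)) -(cards1 x); apply: eq_card => z.
by rewrite !inE gdist_eq0 // eq_sym andbC; case: eqP => [->|]//; rewrite se.
Qed.

Definition diam := \max_(u : T * T) d u.1 u.2.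

Lemma diam_ge x y : d x y <= diam.
Proof. exact: (leq_bigmax (x, y)). Qed.

Lemma dist_attained j : 0 < #|T| -> j <= diam -> exists x y, d x y = j.
Proof.
move=> /card_gt0P[t _] jD.
have [u uD] : exists u : T * T, diam = d u.1 u.2.
  by have [|u uE] := @bigop.eq_bigmax _ (fun u : T * T => d u.1 u.2); last (by exists u); apply/card_gt0P; exists (t, t).
move: jD; rewrite uD; case: u {uD} => x y /=.
move E: (d x y) => m; elim: m y E => [|m IH] y E.
  by rewrite leqn0 => /eqP ->; exists x, y.
rewrite leq_eqVlt => /orP[/eqP ->|jm]; first by exists x, y.
by have [z _ dz] := gdist_pred ce E; apply: (IH z).
Qed.

Local Open Scope ring_scope.

(** The balance equation [c_{j+1} l_j = 1 + b_{j+1} l_{j+1}] solved backwards from the diameter; [t]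
    is the distance left to the diameter. *)
Fixpoint load_rev (t : nat) : rat :=
  if t is t'.+1 then (1 + (b (diam - t'))%:R * load_rev t') / (c (diam - t'))%:R else 0.

(* The flow along an edge from distance [j] to distance [j.+1] when the source
   sends one unit to every other vertex, spread evenly. *)
Definition load j := load_rev (diam - j).

Lemma load_balance j : (0 < #|T|)%N -> (j < diam)%N ->
  (c j.+1)%:R * load j = 1 + (b j.+1)%:R * load j.+1.
Proof.
move=> T0 jD; have [x [y dxy]] := dist_attained T0 jD.
have c0 : (c j.+1)%:R != 0 :> rat by rewrite pnatr_eq0 -lt0n (c_gt0 dxy).
rewrite /load -(subnSK jD) /= subKn //.
by rewrite mulrC divfK.
Qed.

Lemma load_ge0 j : 0 <= load j.
Proof.
rewrite /load; elim: (diam - j)%N => //= t IH.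
by rewrite divr_ge0 ?ler0n // addr_ge0 // mulr_ge0 ?ler0n.
Qed.

(** Backward induction through the balance equation, since [b] decreases and [c] increases with the
    distance. *)
Lemma load_step j : (0 < #|T|)%N -> load j.+1 <= load j.
Proof.
move=> T0; have [Dj|jD] := leqP diam j.
  by rewrite /load (eqP Dj) (eqP (leqW Dj)).
move E: (diam - j.+1)%N => t; elim: t j jD E => [|t IH] j jD E.
  by rewrite {1}/load E load_ge0.
have j1D : (j.+1 < diam)%N by rewrite -subn_gt0 E.
have [x [y dxy]] := dist_attained T0 j1D.
have {}IH := IH j.+1 j1D _; have {}IH : load j.+2 <= load j.+1 by apply: IH; rewrite subnS E.
have [z zy dz] := gdist_pred ce dxy.
have c0 : (0 < c j.+1)%N := c_gt0 dz.
have c0' : (0 < c j.+2)%N := c_gt0 dxy.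
have e1 := load_balance T0 jD; have e2 := load_balance T0 j1D.
have bb : (b j.+2)%:R <= (b j.+1)%:R :> rat by rewrite ler_nat (b_mono dxy).
have cc : (c j.+1)%:R <= (c j.+2)%:R :> rat by rewrite ler_nat (c_mono dxy).
rewrite -(ler_pM2l (x := (c j.+1)%:R)) ?ltr0n //.
apply: le_trans (_ : (c j.+2)%:R * load j.+1 <= _).
  by apply: ler_wpM2r => //; apply: load_ge0.
by rewrite e1 e2 lerD2l; apply: ler_pM; rewrite ?ler0n ?load_ge0.
Qed.

Lemma load_mono i j : (0 < #|T|)%N -> (i <= j)%N -> load j <= load i.
Proof.
move=> T0 /subnK <-; elim: (j - i)%N => // m IH; rewrite addSn.
exact: le_trans (load_step _ T0) IH.
Qed.

Definition flow x z y : rat :=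
  if d x y == (d x z).+1 then load (d x z) else
  if d x z == (d x y).+1 then - load (d x y) else 0.

Lemma flowC x z y : flow x z y = - flow x y z.
Proof.
rewrite /flow; have [->|_] := eqVneq (d x y) (d x z).+1.
  by rewrite (_ : (_ == _.+2) = false) ?eqxx ?opprK //; apply/negP => /eqP; lia.
by case: eqP => // _; rewrite oppr0.
Qed.

Lemma flow_balance x y : x != y -> \sum_(z | e y z) flow x z y = 1.
Proof.
move=> xy; have T0 : (0 < #|T|)%N by apply/card_gt0P; exists x.
case E: (d x y) => [|j].
  by move/eqP: E; rewrite gdist_eq0 // (negPf xy).
have jD : (j < diam)%N by rewrite -E diam_ge.
have := load_balance T0 jD; move/eqP; rewrite -subr_eq => /eqP <-.
rewrite -(cP E) -(bP E) -!sum1dep_card !natr_sum !mulr_suml -sumrN.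
rewrite !big_mkcondr.
rewrite -big_split /=; apply: eq_bigr => z yz; rewrite /flow E eqSS.
have [->|] := eqVneq (d x z) j.
  by rewrite mul1r (_ : (_ == _.+2) = false) ?addr0 //; apply/negP => /eqP; lia.
by move=> _; rewrite add0r mul1r.
Qed.

(** Every vertex outside [X] absorbs one unit; in the sum, the flow between two such vertices
    cancels by antisymmetry. *)
Lemma flow_cut x (X : {set T}) : x \in X ->
  #|~: X|%:R = \sum_(y in ~: X) \sum_(z in X | e y z) flow x z y.
Proof.
move=> xX.
have -> : #|~: X|%:R = \sum_(y in ~: X) \sum_(z | e y z) flow x z y.
  rewrite -sum1_card natr_sum; apply: eq_bigr => y; rewrite inE => yX.
  by rewrite flow_balance //; apply: contraNneq yX => <-.
have split y : \sum_(z | e y z) flow x z y =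
   \sum_(z in X | e y z) flow x z y + \sum_(z in ~: X | e y z) flow x z y.
  rewrite (bigID (fun z => z \in X)) /=; congr (_ + _); apply: eq_bigl => z.
    by rewrite andbC.
  by rewrite !inE andbC.
under eq_bigr => y _ do rewrite split.
rewrite big_split /=; set S := (X in _ + X).
suff SN : S = - S.
  by have -> : S = 0; [lra | rewrite addr0].
rewrite /S -sumrN; under [RHS]eq_bigr => y _ do rewrite -sumrN.
have mk F : \sum_(y in ~: X) \sum_(z in ~: X | e y z) F y z =
    \sum_(y in ~: X) \sum_(z in ~: X) (if e y z then F y z else 0 : rat).
  by apply: eq_bigr => y _; rewrite big_mkcondr.
rewrite !mk [RHS]exchange_big /=; apply: eq_bigr => y _; apply: eq_bigr => z _.
by rewrite se -flowC.
Qed.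

Lemma load0 : (0 < #|T|)%N -> k%:R * load 0 = #|T|%:R - 1.
Proof.
case/card_gt0P => x _; have := @flow_cut x [set x] (set11 x).
have -> : #|~: [set x]|%:R = #|T|%:R - 1 :> rat.
  by rewrite -(cardsC [set x]) cards1 natrD addrAC subrr add0r.
move=> ->; rewrite -(reg x) -sum1dep_card natr_sum mulr_suml big_mkcond /=.
rewrite [RHS]big_mkcond; apply: eq_bigr => y _; rewrite !inE.
have [->|yx] := eqVneq y x; first by rewrite ie.
case xy: (e x y); last first.
  by rewrite big_pred0 // => z; rewrite inE; case: eqP => //= ->; rewrite se xy.
rewrite (big_pred1 x) => [|z]; last by rewrite inE /=; case: eqP => //= ->; rewrite se xy.
by rewrite /flow (gdistxx ce) (gdist_ge1 ie ce xy) eqxx mul1r.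
Qed.

Lemma load1 : (0 < #|T|)%N -> (0 < diam)%N -> k%:R * (b 1)%:R * load 1 = #|T|%:R - 1 - k%:R.
Proof.
move=> T0 D0; have := load_balance T0 D0.
have [x [y dxy]] := dist_attained T0 D0.
have exy : e x y by rewrite -(gdist_eq1 ie ce) dxy.
rewrite (c1 exy) mul1r => l0; have := load0 T0; rewrite l0 mulrDr mulr1 mulrA.
by lra.
Qed.

(** With source [x], the cut edges at [x] carry [load 0] and all others at most [load 1]. The factor
    [k * b 1] turns both loads into integers. *)
Lemma cut_bound (x : T) (X : {set T}) : x \in X -> (0 < b 1)%N ->
  (k * b 1 * #|~: X| <= degin (~: X) x * (b 1 * (#|T| - 1)) +
     (boundary X - degin (~: X) x) * (#|T| - 1 - k))%N.
Proof.
move=> xX b1; have T0 : (0 < #|T|)%N by apply/card_gt0P; exists x.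
have [X1|X1] := eqVneq (~: X) set0; first by rewrite X1 cards0 muln0.
have [y yX] := set0Pn _ X1.
have xy : x != y by apply: contraTneq yX => <-; rewrite inE xX.
have D0 : (0 < diam)%N by apply: leq_trans (diam_ge x y); rewrite lt0n gdist_eq0.
have kT : (k < #|T|)%N.
  rewrite -(reg x) -cardsT; apply: proper_card; apply/properP; split; first exact: subsetT.
  by exists x; rewrite !inE ?ie.
have key : (#|~: X|%:R <= (degin (~: X) x)%:R * load 0 +
     (boundary X - degin (~: X) x)%:R * load 1 :> rat).
  have bX : boundary X = (degin (~: X) x + \sum_(z in X | z != x) degin (~: X) z)%N.
    by rewrite /boundary (bigD1 x).
  rewrite bX addKn (flow_cut xX).
  have -> : \sum_(y in ~: X) \sum_(z in X | e y z) flow x z y =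
      \sum_(z in X) \sum_(y in ~: X | e z y) flow x z y.
    have mk (A B : {set T}) (F : T -> T -> rat) : \sum_(y in A) \sum_(z in B | e y z) F y z =
      \sum_(y in A) \sum_(z in B) (if e y z then F y z else 0).
      by apply: eq_bigr => u _; rewrite big_mkcondr.
    by rewrite !mk exchange_big /=; apply: eq_bigr => u _; apply: eq_bigr => v _; rewrite se.
  rewrite (bigD1 x) //= natr_sum mulr_suml.
  have cst (z : T) (l : rat) : (degin (~: X) z)%:R * l = \sum_(y in ~: X | e z y) l.
    by rewrite /degin -sum1dep_card natr_sum mulr_suml; apply: eq_bigr => ? _; rewrite mul1r.
  apply: lerD.
    rewrite cst; apply: ler_sum => z /andP[_ xz].
    by rewrite /flow (gdistxx ce) (gdist_ge1 ie ce xz) eqxx.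
  apply: ler_sum => z /andP[zX zx]; rewrite cst; apply: ler_sum => w _.
  have z0 : (0 < d x z)%N by rewrite lt0n gdist_eq0 // eq_sym.
  rewrite /flow; case: ifP => _; first exact: load_mono.
  have l0 := load_ge0; case: ifP => _; last exact: l0.
  by apply: le_trans (l0 1); rewrite oppr_le0.
have := @ler_wpM2l rat (k%:R * (b 1)%:R) _ _ _ key; rewrite mulr_ge0 ?ler0n // => /(_ isT).
rewrite mulrDr !mulrA ![k%:R * (b 1)%:R * _]mulrAC.
have -> : k%:R * (degin (~: X) x)%:R * (b 1)%:R * load 0 =
  (degin (~: X) x)%:R * ((b 1)%:R * (k%:R * load 0)) by ring.
have -> : k%:R * (boundary X - degin (~: X) x)%:R * (b 1)%:R * load 1 =
  (boundary X - degin (~: X) x)%:R * (k%:R * (b 1)%:R * load 1) by ring.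
rewrite load0 // load1 //.
have -> : #|T|%:R - 1 - k%:R = (#|T| - 1 - k)%:R :> rat.
  by rewrite !natrB //; lia.
have -> : #|T|%:R - 1 = (#|T| - 1)%:R :> rat by rewrite natrB.
by rewrite mulrAC -!natrM -natrD ler_nat.
Qed.
End Drg.

(** * Lower bounds for edge cuts *)

Section Isoperimetry.
Local Open Scope nat_scope.
Variables (T : finType) (e : rel T) (k : nat).
Hypotheses (se : ssrbool.symmetric e) (ie : ssrbool.irreflexive e) (ce : connected_graph e).
Hypotheses (dr : distance_regular e) (reg : forall x, #|[set y | e x y]| = k).
Hypothesis k4 : 4 <= k.
Local Notation d := (gdist e).
Local Notation degin := (degin e).
Local Notation boundary := (boundary e).
Variables b c : nat -> nat.
Hypothesis bP : forall j x y, d x y = j -> #|[set z | e y z & d x z == j.+1]| = b j.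
Hypothesis cP : forall j x y, d x y = j.+1 -> #|[set z | e y z & d x z == j]| = c j.+1.

Lemma nbr_exists x : exists y, e x y.
Proof.
have /card_gt0P[y] : 0 < #|[set y | e x y]| by rewrite reg; lia.
by rewrite inE; exists y.
Qed.

Lemma common_nbrs x y : e x y -> #|[set z | e x z & e y z]| + b 1 + 1 = k.
Proof.
move=> xy; rewrite -(bP (gdist_ge1 ie ce xy)) -(reg y).
rewrite -[RHS](cardsID [set z | e x z]) -addnA; congr (_ + _).
  by apply: eq_card => z; rewrite !inE andbC.
rewrite [RHS](cardsD1 x) !inE ie se xy /= addnC; congr (_ + _); apply: eq_card => z.
rewrite !inE; have [->|zx] := eqVneq z x; first by rewrite (gdistxx ce) andbF.
rewrite /= andbC; case yz: (e y z); rewrite ?andbF //= andbT.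
have := gdist_step ce x yz; rewrite (gdist_ge1 ie ce xy) => d2.
have d0 : 0 < d x z by rewrite lt0n gdist_eq0 // eq_sym.
by rewrite -(gdist_eq1 ie ce); move: d2 d0; case: (d x z) => [|[|[|]]].
Qed.

(** The neighbourhood of [x] induces a regular graph on [k] vertices, whose degree sum is even. *)
Lemma common_nbrs_even x y : e x y -> ~~ odd (k * #|[set z | e x z & e y z]|).
Proof.
move=> xy; set a := #|_|.
have := @sum_degin_even T e se ie [set z | e x z].
rewrite (eq_bigr (fun _ => a)); first by rewrite sum_nat_const reg.
move=> z; rewrite inE => xz; have := common_nbrs xy; rewrite -/a => h1.
have := common_nbrs xz; have -> : degin [set z | e x z] z = #|[set w | e x w & e z w]|.
  by apply: eq_card => w; rewrite !inE.
by lia.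
Qed.

(** For a common neighbour [w], the two sets of [k - 1 - b 1] vertices adjacent to [w] and to [x],
    or to [w] and to [y], lie among [k - 2] neighbours of [w]. Their overlap together with [w]
    consists of common neighbours of [x] and [y]. *)
Lemma dist2_c2 x y : d x y = 2 -> k + 1 <= c 2 + 2 * b 1.
Proof.
move=> dxy; have [w wy dw] := gdist_pred ce dxy.
have xw : e x w by rewrite -(gdist_eq1 ie ce) dw.
have nxy : ~~ e x y by rewrite -(gdist_eq1 ie ce) dxy.
have nE : x != y by rewrite -(gdist_eq0 ce) dxy.
rewrite -(cP dxy).
pose A := [set z | e w z & e x z]; pose B := [set z | e w z & e y z].
have cA : #|A| + b 1 + 1 = k by apply: common_nbrs; rewrite se.
have cB : #|B| + b 1 + 1 = k by apply: common_nbrs.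
have ABn : #|A :|: B| + 2 <= k.
  rewrite -(reg w); have <- : #|[set x; y]| = 2 by rewrite cards2 nE.
  have AB0 : (A :|: B) :&: [set x; y] = set0.
    apply/setP => z; rewrite !inE; apply/negP => /andP[h /orP[] /eqP zE]; move: h.
      by rewrite zE ie (se y) (negPf nxy) !andbF.
    by rewrite zE ie (negPf nxy) !andbF.
  rewrite -cardsUI AB0 cards0 addn0; apply/subset_leq_card/subsetP => z; rewrite !inE.
  by case/or3P => [/orP[]|/eqP ->|/eqP ->]; rewrite ?[e w x]se // => /andP[].
have ABc : #|A :&: B| + 1 <= #|[set z | e y z & d x z == 1]|.
  have <- : #|w |: (A :&: B)| = #|A :&: B| + 1 by rewrite cardsU1 !inE ie addnC.
  apply/subset_leq_card/subsetP => z; rewrite !inE (gdist_eq1 ie ce).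
  by case/orP => [/eqP ->|/andP[/andP[_ ->] /andP[_ ->]]] //; rewrite se wy.
have := cardsUI A B; move: cA cB ABn ABc.
by move: #|A| #|B| #|A :|: B| #|A :&: B| #|_| (b 1) => *; lia.
Qed.

Lemma sphere2_count x : #|[set z | d x z == 2]| * c 2 = k * b 1.
Proof.
transitivity (\sum_(z in [set z | d x z == 2]) #|[set y in [set y | e x y] | e z y]|).
  rewrite -sum_nat_const; apply: eq_bigr => z; rewrite inE => /eqP dz.
  by rewrite -(cP dz); apply: eq_card => y; rewrite !inE (gdist_eq1 ie ce) andbC.
rewrite -/(degin _ _) (sum_degin se) -(reg x) -sum_nat_const; apply: eq_bigr => y.
rewrite inE => xy; rewrite -(bP (gdist_ge1 ie ce xy)).
by apply: eq_card => z; rewrite !inE andbC.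
Qed.

(** Let [w] follow [x] on a geodesic to [y]: the neighbours of [w] next to [y] are at distance two
    from [x]. *)
Lemma dist3_c2 x y : d x y = 3 -> c 2 <= b 1.
Proof.
move=> dxy; have [w xw dw] := gdist_succ se ie ce dxy.
have dyw : d y w = 2 by rewrite gdistC.
rewrite -(bP (gdist_ge1 ie ce xw)); have <- : #|[set z | e w z & d y z == 1]| = c 2 by exact: cP.
apply/subset_leq_card/subsetP => z; rewrite !inE => /andP[wz /eqP yz]; rewrite wz /=.
have := gdist_step ce x wz; rewrite (gdist_ge1 ie ce xw) => d2.
have := gdist_triangle ce x z y; rewrite dxy (gdistC se ie ce z) yz.
by move: d2; case: (d x z) => [|[|[|]]].
Qed.

Lemma diam2_card x : (forall y, d x y <= 2) -> #|T| = 1 + k + #|[set z | d x z == 2]|.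
Proof.
move=> dx; rewrite -(reg x) -cardsT -(cardsID [set x] setT) setTI cards1 -addnA; congr (_ + _).
rewrite -(cardsID [set y | e x y]); congr (_ + _); apply: eq_card => y; rewrite !inE -(gdist_eq0 ce) (gdistC se ie ce y x).
  by rewrite -(gdist_eq1 ie ce); case: (d x y) => [|[|]].
by rewrite -(gdist_eq1 ie ce); have := dx y; case: (d x y) => [|[|[|]]].
Qed.

Lemma all_dist_le m : ~ (exists x y, d x y = m.+1) -> forall x y, d x y <= m.
Proof.
move=> n x y; rewrite leqNgt; apply/negP; move E: (d x y) => j.
elim: j y E => // j IH y E; rewrite ltnS leq_eqVlt => /orP[/eqP mj|mj].
  by apply: n; exists x, y; rewrite E mj.
by have [z _ dz] := gdist_pred ce E; apply: IH dz mj.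
Qed.

(** Here [c 2 >= k - 1] exceeds [b 1], so the diameter is at most two, and double counting leaves at
    most one vertex at distance two. *)
Lemma card_small_b1 : 0 < #|T| -> b 1 <= 1 -> #|T| <= k + 2.
Proof.
case/card_gt0P => x _ b1.
have [[u [w duw]]|n2] := EM (exists x y, d x y = 2); last first.
  rewrite (@diam2_card x) => [|y]; last by apply: leqW; apply: all_dist_le.
  rewrite (_ : [set z | _] = set0) ?cards0; first by lia.
  apply/setP => z; rewrite !inE; apply/negP => /eqP dz; apply: n2; by exists x, z.
have c2 := dist2_c2 duw.
have d2 : forall y, d x y <= 2.
  move=> y; apply: all_dist_le => -[s [t /dist3_c2]]; lia.
rewrite (diam2_card d2); have := sphere2_count x; move: #|_| => s h.
have s1 : s <= 1 by nia.
by lia.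
Qed.

(** As before with [c 2 >= k - 3]; for [k >= 6] the quotient [2 k / (k - 3)] is at most 4. *)
Lemma card_b1_2 : 0 < #|T| -> 6 <= k -> b 1 = 2 -> #|T| <= k + 5.
Proof.
case/card_gt0P => x _ k6 b1.
have [[u [w duw]]|n2] := EM (exists x y, d x y = 2); last first.
  rewrite (@diam2_card x) => [|y]; last by apply: leqW; apply: all_dist_le.
  rewrite (_ : [set z | _] = set0) ?cards0; first by lia.
  apply/setP => z; rewrite !inE; apply/negP => /eqP dz; apply: n2; by exists x, z.
have c2 := dist2_c2 duw.
have d2 : forall y, d x y <= 2.
  move=> y; apply: all_dist_le => -[s [t /dist3_c2]]; lia.
rewrite (diam2_card d2); have := sphere2_count x; move: #|_| => s h.
have s1 : s <= 4 by nia.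
by lia.
Qed.

(** In so small a graph, [X] or its complement has fewer than [k] vertices. *)
Lemma boundary_small_order (X : {set T}) : #|T| <= 2 * (k - 1) + 1 -> 2 <= #|X| -> 2 <= #|~: X| ->
  2 * (k - 1) <= boundary X.
Proof.
move=> n X2 X2'; have := cardsC X => nX.
have [Xk|kX] := ltnP #|X| k; first exact: (boundary_small ie reg).
rewrite -(boundaryC se); apply: (boundary_small ie reg) => //; lia.
Qed.

Lemma clique_b1 (X : {set T}) : k <= #|X| -> (forall x y, x \in X -> y \in X -> x != y -> e x y) -> b 1 <= 1.
Proof.
move=> kX cX; have [x xX] : exists x, x \in X by apply/card_gt0P; lia.
have [y] : exists y, y \in X :\ x by apply/card_gt0P; move: kX; rewrite (cardsD1 x) xX; lia.
rewrite !inE => /andP[yx yX]; have xy : e x y by apply: cX; rewrite // eq_sym.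
have : #|X :\ x :\ y| <= #|[set z | e x z & e y z]|.
  apply/subset_leq_card/subsetP => z; rewrite !inE => /and3P[zy zx zX].
  by rewrite !cX // eq_sym.
have := common_nbrs xy; move: kX; rewrite (cardsD1 x) xX (cardsD1 y (X :\ x)) !inE yx yX /=.
by move: #|_| #|_| => *; lia.
Qed.

Lemma two_sides (X : {set T}) x y : 0 < b 1 -> x \in X -> y \notin X ->
  k * b 1 * #|T| <= (degin (~: X) x + degin X y) * (b 1 * (#|T| - 1)) +
    (2 * boundary X - (degin (~: X) x + degin X y)) * (#|T| - 1 - k).
Proof.
move=> b1 xX yX.
have c1 := cut_bound se ie ce reg bP cP xX b1.
have yX' : y \in ~: X by rewrite inE.
have c2 := cut_bound se ie ce reg bP cP yX' b1.
rewrite setCK (boundaryC se) in c2.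
have i1 : degin (~: X) x <= boundary X by apply: degin_le_boundary.
have i2 : degin X y <= boundary X.
  by rewrite -(boundaryC se) -{1}[X]setCK degin_le_boundary.
have -> : 2 * boundary X - (degin (~: X) x + degin X y) =
  (boundary X - degin (~: X) x) + (boundary X - degin X y) by lia.
rewrite -(cardsC X) mulnDr in c1 c2 *.
move: c1 c2; move: (boundary X - _) (boundary X - _) (k * b 1 * #|_|) (k * b 1 * #|_|) (#|_| + #|_|).
move=> u v s t n c1 c2; rewrite !mulnDl; lia.
Qed.

(** If the cut had at most [k] edges, each side would contain a vertex without neighbours across,
    since otherwise it would be a clique on [k] vertices and [b 1 <= 1]. With these two sources the
    flow uses only light edges, which cannot carry [k * b 1 * n >= 2 k n]. *)
Lemma boundary_gt_degree (X : {set T}) : 2 <= b 1 -> 2 <= #|X| -> 2 <= #|~: X| -> k < boundary X.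
Proof.
move=> b2 X2 X2'; rewrite ltnNge; apply/negP => bk.
have bk' : boundary (~: X) <= k by rewrite (boundaryC se).
have side (Y : {set T}) : 2 <= #|Y| -> boundary Y <= k -> exists2 x, x \in Y & degin (~: Y) x = 0.
  move=> Y2 Yk; have kY : k <= #|Y|.
    rewrite leqNgt; apply/negP => h; have := boundary_small ie reg Y2 h; lia.
  apply: contrapT => nx; have := @clique_b1 Y kY; suff h : forall x y, x \in Y -> y \in Y -> x != y -> e x y.
    by move=> /(_ h); lia.
  apply: (boundary_clique ie reg kY Yk) => x xY; rewrite lt0n; apply/negP => /eqP h.
  by apply: nx; exists x.
have [x xX dx] := side X X2 bk; have [y yX dy] := side (~: X) X2' bk'.
rewrite setCK inE in dy yX; have := two_sides (ltnW b2) xX yX; rewrite dx dy subn0 mul0n add0n.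
have : 0 < #|T| by apply/card_gt0P; exists x.
move: (boundary X) bk #|T| => s sk n n0 h.
have h1 : 2 * s * (n - 1 - k) <= 2 * k * (n - 1) by apply: leq_mul; lia.
have h2 : 2 * k * n <= k * b 1 * n by rewrite leq_mul2r mulnC leq_mul2l b2 !orbT.
have h3 : 2 * k * n = 2 * k * (n - 1) + 2 * k by rewrite -[in LHS](subnK n0) mulnDr muln1.
by move: h h1 h2 h3; move: (2 * k * n) (2 * k * (n - 1)) (k * b 1 * n) (2 * s * _) => *; lia.
Qed.

Lemma b1_3_even : b 1 = 3 -> 0 < #|T| -> ~~ odd k.
Proof.
move=> b3 /card_gt0P[x _]; have [y xy] := nbr_exists x.
have := common_nbrs_even xy; have := common_nbrs xy; move: #|_| => a; rewrite b3 oddM => <-.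
by rewrite !oddD /=; case: (odd a).
Qed.

Lemma boundary_large (X : {set T}) : 6 <= k -> 2 <= #|X| -> 2 <= #|~: X| -> 3 * k <= 2 * boundary X.
Proof.
move=> k6 X2 X2'.
have T0 : 0 < #|T| by apply: leq_trans (max_card (mem X)); apply: ltnW.
(* Either bound suffices, as [4 (k - 1) >= 3 k]. *)
suff : 2 * (k - 1) <= boundary X \/ 3 * k <= 2 * boundary X by lia.
have [b3|b2] := leqP 3 (b 1); last first.
  left; apply: boundary_small_order => //.
  have [b1|b1] := leqP (b 1) 1; first by have := card_small_b1 T0 b1; lia.
  have /(card_b1_2 T0 k6) : b 1 = 2 by lia.
  by lia.
have [Xk|kX] := ltnP #|X| k; first by left; exact: (boundary_small ie reg).
have [Xk'|kX'] := ltnP #|~: X| k.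
  by left; rewrite -(boundaryC se); exact: (boundary_small ie reg).
right; rewrite leqNgt; apply/negP => bk.
(* If all vertices had two neighbours across, the cut would have at least [2 k] edges. *)
have side (Y : {set T}) : k <= #|Y| -> 2 * boundary Y < 3 * k -> exists2 x, x \in Y & degin (~: Y) x = 0 \/
    (degin (~: Y) x = 1 /\ #|Y| <= boundary Y).
  move=> kY Yk; have [[x xY dx]|n0] := EM (exists2 x, x \in Y & degin (~: Y) x = 0).
    by exists x => //; left.
  have h x : x \in Y -> 0 < degin (~: Y) x.
    by move=> xY; rewrite lt0n; apply/negP => /eqP dx; apply: n0; exists x.
  have sY : #|Y| <= boundary Y by rewrite -sum1_card; apply: leq_sum => x /h.
  apply: contrapT => n1.
  have : \sum_(x in Y) 2 <= boundary Y.
    apply: leq_sum => x xY; have := h x xY; rewrite leq_eqVlt => /orP[/eqP d1|//].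
    by case: n1; exists x => //; right.
  by rewrite sum_nat_const; lia.
have [x xX dx] := side X kX bk.
have [|y yX dy] := side (~: X) kX'; first by rewrite (boundaryC se).
rewrite setCK (boundaryC se) inE in dy yX; have := two_sides (leq_trans (isT : 0 < 3) b3) xX yX.
have nX := cardsC X; have ev := b1_3_even.
move: T0 ev bk dx dy kX kX' nX b3; move: (boundary X) (degin (~: X) x) (degin X y) #|X| #|~: X| #|T| (b 1).
move=> s u v n1 n2 n beta T0 ev bk dx dy kX kX' nX b3.
(* [m] is the number of vertices at distance at least two from a given one. *)
have [m nE] : exists m, n = m + k + 1 by exists (n - k - 1); lia.
have e1 : n - 1 - k = m by lia.
have e2 : n - 1 = m + k by lia.
rewrite e1 e2 nE; move: T0 nE e1 e2 => _ nE _ _.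
have mixed : k * beta * (m + k + 1) <= 1 * (beta * (m + k)) + (2 * s - 1) * m -> False.
  have [k' kE] : exists k', k = k' + 1 by exists (k - 1); lia.
  have -> : k * beta * (m + k + 1) = beta * (m + k) + beta * (k' * (m + k) + k) by rewrite kE; ring.
  rewrite mul1n leq_add2l => h; have [b4|b4] := leqP 4 beta.
    have h1 : 4 * (k' * (m + k) + k) <= beta * (k' * (m + k) + k) by rewrite leq_mul2r b4 orbT.
    have h2 : (2 * s - 1) * m <= (3 * k' + 1) * m by rewrite leq_mul2r; lia.
    have h3 : 1 * m <= k' * m by rewrite leq_mul2r; lia.
    by move: (leq_trans h1 (leq_trans h h2)); clear -h3 k6 kE; rewrite !mulnDr !mulnDl; lia.
  (* The estimate is tight here and parity decides: for even [k], [2 s < 3 k] gives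
     [2 s - 1 <= 3 (k - 1)]. *)
  have bE : beta = 3 by lia.
  have ek : ~~ odd k by apply: ev => //; lia.
  have h2 : (2 * s - 1) * m <= 3 * k' * m by rewrite leq_mul2r; lia.
  by move: (leq_trans h h2); rewrite bE; clear -k6 kE; rewrite !mulnDr; lia.
case: dx => [->|[-> s1]]; case: dy => [->|[-> s2]]; rewrite ?addn0 ?add0n ?subn0 //.
- move=> h.
  have h1 : 3 * (k * (m + k + 1)) <= beta * (k * (m + k + 1)) by rewrite leq_mul2r b3 orbT.
  have h2 : 2 * s * m <= 3 * k * m by rewrite leq_mul2r (ltnW bk) orbT.
  move: (leq_trans h h2); rewrite (mulnC k) -mulnA => /(leq_trans h1).
  by clear -k6; rewrite !mulnDr; lia.
(* Both sides have at most [s] vertices in this case, which bounds [m] by [2 k]. *)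
- have [k' kE] : exists k', k = k' + 2 by exists (k - 2); lia.
  have -> : k * beta * (m + k + 1) = (1 + 1) * (beta * (m + k)) + beta * (k' * (m + k) + k) by rewrite kE; ring.
  rewrite leq_add2l => h.
  have h1 : 3 * (k' * (m + k) + k) <= beta * (k' * (m + k) + k) by rewrite leq_mul2r b3 orbT.
  have h2 : (2 * s - (1 + 1)) * m <= (3 * k' + 3) * m by rewrite leq_mul2r; lia.
  have h3 : 4 * k <= k' * k by rewrite leq_mul2r; lia.
  have h4 : m <= 2 * k by lia.
  by move: (leq_trans h1 (leq_trans h h2)); clear -h3 h4 k6 kE; rewrite !mulnDr !mulnDl; lia.
Qed.
End Isoperimetry.

(** * Distance-regular graphs of degree at least four *)

Section Sufficiency.
Local Open Scope nat_scope.
Variables (T : finType) (e : rel T) (k : nat).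
Hypotheses (se : ssrbool.symmetric e) (ie : ssrbool.irreflexive e) (ce : connected_graph e).
Hypotheses (dr : distance_regular e) (reg : forall x, #|[set y | e x y]| = k).
Hypothesis k4 : 4 <= k.
Local Notation degin := (degin e).
Local Notation boundary := (boundary e).

(** More than [k] edges in all cases; for [k = 4] the cut is even, so five becomes six. *)
Lemma boundary_bound (X : {set T}) : 2 <= #|X| -> 2 <= #|~: X| ->
  (k != 5 -> 3 * k <= 2 * boundary X) /\ (k = 5 -> 6 <= boundary X).
Proof.
move=> X2 X2'; have [b [c [bP cP]]] := intersection_numbers ie ce dr.
have T0 : 0 < #|T| by apply: leq_trans (max_card (mem X)); apply: ltnW.
have gt : k < boundary X.
  have [b1|b1] := leqP (b 1) 1; last exact: (boundary_gt_degree se ie ce reg k4 bP cP).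
  have := card_small_b1 se ie ce reg k4 bP cP T0 b1 => n.
  apply: (@leq_trans (2 * (k - 1))); first by clear -k4; lia.
  by apply: (boundary_small_order se ie reg k4) => //; clear -n k4; lia.
split=> [k5|k5]; last by move: gt; rewrite k5.
have [k6|k6] := leqP 6 k; first exact: (boundary_large se ie ce reg k4 bP cP).
have kE : k = 4 by move/eqP: k5 => k5; clear -k4 k5 k6; lia.
have := boundary_parity se ie reg X; move: gt; rewrite kE oddM /=; move: (boundary X); clear; lia.
Qed.

(** * Edge covers of a vertex-deleted graph *)

Section DeletedVertex.
Variable v : T.
Local Notation W := [set~ v].

Definition deleted_edges : {set {set T}} :=
  [set [set u.1; u.2] | u in [set u : T * T | [&& e u.1 u.2, u.1 != v & u.2 != v]]].
Local Notation E := deleted_edges.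

Lemma deleted_edgesP f : reflect (exists x y, [/\ f = [set x; y], e x y, x != v & y != v]) (f \in E).
Proof.
apply: (iffP imsetP) => [[[x y]]|[x [y [-> exy xv yv]]]].
  by rewrite inE /= => /and3P[exy xv yv] ->; exists x, y.
by exists (x, y); rewrite // inE /= exy xv yv.
Qed.

Lemma deleted_edge_pair x y : ([set x; y] \in E) = [&& e x y, x != v & y != v].
Proof.
apply/deleted_edgesP/and3P => [[a [b [/setP ab eab av bv]]]|[exy xv yv]]; last by exists x, y.
have nab : a != b by apply: contraTneq eab => ->; rewrite ie.
have := ab x; have := ab y; have := ab a; have := ab b.
rewrite !inE !eqxx !orbT /= => /orP hb /orP ha /esym/orP hy /esym/orP hx.
case: hx => /eqP xE; case: hy => /eqP yE; subst x y.
- by case: hb => /eqP ba; rewrite ba eqxx in nab.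
- by split.
- by rewrite se; split.
- by case: ha => /eqP ba; rewrite ba eqxx in nab.
Qed.

Lemma deleted_edges2 : edge_family E.
Proof.
move=> f /deleted_edgesP[x [y [-> exy _ _]]]; rewrite cards2.
by have -> : x != y by apply: contraTneq exy => ->; rewrite ie.
Qed.

Lemma deleted_edgesW f : f \in E -> f \subset W.
Proof.
move=> /deleted_edgesP[x [y [-> _ xv yv]]].
by rewrite subUset !sub1set !inE xv yv.
Qed.

Definition uncovered (s : seq {set T}) :=
  [set f in E | all (fun X : {set T} => ~~ (f \subset X)) s].

Lemma uncovered_sub s : {subset uncovered s <= E}.
Proof. by move=> f; rewrite inE => /andP[]. Qed.

Lemma uncovered_degree s u : u \in W ->
  degin W u <= #|nbrs (uncovered s) u| + \sum_(X <- s | u \in X) degin X u.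
Proof.
rewrite !inE => uv.
elim: s => [|X s IH].
  rewrite big_nil addn0; apply/subset_leq_card/subsetP => z; rewrite !inE andbT => /andP[zv uz].
  by rewrite deleted_edge_pair uz uv zv !andbT; apply: contraTneq uz => ->; rewrite ie.
rewrite big_cons; have [uX|uX] := boolP (u \in X).
  apply: leq_trans IH _; rewrite addnA leq_add2r.
  apply: (@leq_trans #|nbrs (uncovered (X :: s)) u :|: [set z in X | e u z]|); last first.
    by rewrite cardsU leq_subr.
  apply/subset_leq_card/subsetP => z; rewrite !inE => /and3P[zu zE all_s].
  rewrite zu zE /= all_s andbT; case: (boolP (_ \subset X)) => //=.
  rewrite subUset !sub1set => /andP[_ ->]; move: zE; rewrite deleted_edge_pair.
  by case/and3P.
apply: leq_trans IH _; rewrite leq_add2r; apply/subset_leq_card/subsetP => z.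
rewrite !inE => /and3P[-> -> all_s] /=; rewrite all_s andbT.
by apply: contra uX; rewrite subUset !sub1set => /andP[].
Qed.

Lemma sum_degin_W : \sum_(u in W) degin W u + k = k * #|W|.
Proof.
have h u : u \in W -> degin W u + degin [set v] u = k.
  by move=> _; have := deginC reg W u; rewrite setCK.
rewrite -[X in _ = X]mulnC -sum_nat_const -(eq_bigr _ h) big_split /=; congr (_ + _).
rewrite (sum_degin se) big_set1 -(reg v); apply: eq_card => z; rewrite !inE.
by case: eqP => [->|//]; rewrite ie.
Qed.

Lemma sum_uncovered s : 2 * #|uncovered s| = \sum_(u in W) #|nbrs (uncovered s) u|.
Proof.
have u2 : edge_family (uncovered s) by move=> f /uncovered_sub/deleted_edges2.
rewrite -(@handshake _ _ W) // => [|f /uncovered_sub/deleted_edgesW //].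
by apply: eq_bigr => u _; rewrite card_nbrs.
Qed.

Lemma exchange_cover (s : seq {set T}) (F : {set T} -> T -> nat) : (forall X, X \in s -> X \subset W) ->
  \sum_(u in W) \sum_(X <- s | u \in X) F X u = \sum_(X <- s) \sum_(u in X) F X u.
Proof.
move=> sW; under eq_bigr => u _ do rewrite big_mkcond.
rewrite exchange_big /= !big_seq; apply: eq_bigr => X /sW/subsetP XW.
rewrite -big_mkcondr /=; apply: eq_bigl => u.
by have [uX|] := boolP (u \in X); rewrite ?andbF // andbT XW.
Qed.

Lemma sum_degin_self (X : {set T}) : \sum_(u in X) degin X u + boundary X = k * #|X|.
Proof.
rewrite -big_split /= (eq_bigr (fun _ => k)) => [|x _]; last exact: (deginC reg).
by rewrite sum_nat_const mulnC.
Qed.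

Lemma proper_W (X : {set T}) : X \subset W -> X != W -> 2 <= #|~: X|.
Proof.
move=> XW nX; have [y yW yX] : exists2 y, y \in W & y \notin X.
  by apply/subsetPn; apply: contra nX => WX; rewrite eqEsubset XW.
apply: (@leq_trans #|[set v; y]|).
  by rewrite cards2 eq_sym; move: yW; rewrite !inE => ->.
apply/subset_leq_card; rewrite subUset !sub1set !inE yX andbT.
by apply/negP => /(subsetP XW); rewrite !inE eqxx.
Qed.

Lemma cover_full (s : seq {set T}) (U : nat) : W \in s -> (forall X, X \in s -> 1 < #|X|) ->
  2 * #|W| <= \sum_(X <- s) (2 * #|X| - 3) + U + 3.
Proof.
by move=> Ws s2; rewrite (big_rem W) //=; have := s2 W Ws; lia.
Qed.

(** A cut of [3k/2] edges makes the degree sum inside [X] at most [(k/2) (2 |X| - 3)]. An uncovered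
    edge contributes 2 to the degree sum, at most [k/2], so the total degree [k |W| - k] gives the
    bound. *)
Lemma cover_bound_generic (s : seq {set T}) : k != 5 ->
  (forall X, X \in s -> 1 < #|X| /\ X \subset W) ->
  2 * #|W| <= \sum_(X <- s) (2 * #|X| - 3) + #|uncovered s| + 3.
Proof.
move=> k5 sP; have [Ws|Ws] := boolP (W \in s); first by apply: cover_full => // X /sP[].
have D1 X : X \in s -> 4 * (\sum_(u in X) degin X u) <= 2 * k * (2 * #|X| - 3).
  move=> Xs; have [X2 XW] := sP X Xs.
  have X2' : 2 <= #|~: X| by apply: proper_W => //; apply: contraNneq Ws => <-.
  have [/(_ k5) h _] := boundary_bound X2 X2'; have := sum_degin_self X.
  move: X2 h; move: #|X| (boundary X) (\sum_(u in X) _) => n s' t n2 h1 h2.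
  rewrite mulnBr; have -> : 2 * k * (2 * n) = 4 * (k * n) by ring.
  by rewrite -h2; lia.
have h1 : \sum_(u in W) degin W u <= 2 * #|uncovered s| + \sum_(X <- s) \sum_(u in X) degin X u.
  rewrite sum_uncovered -exchange_cover => [|X /sP[] //]; rewrite -big_split /=.
  by apply: leq_sum => u uW; apply: uncovered_degree.
have h2 : 4 * (\sum_(X <- s) \sum_(u in X) degin X u) <= 2 * k * \sum_(X <- s) (2 * #|X| - 3).
  by rewrite !big_distrr /= !big_seq; apply: leq_sum.
move: h1 h2 sum_degin_W; set a := \sum_(u in W) degin W u.
set t := \sum_(X <- s) \sum_(u in X) degin X u; set S := \sum_(X <- s) (2 * #|X| - 3).
move: a t S #|uncovered s| #|W| => a t S U w h1 h2 h3; clear -k4 h1 h2 h3.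
have h4 : k * (2 * w) <= k * (S + U + 2).
  have : 8 * U <= 2 * k * U by rewrite leq_mul2r; lia.
  by lia.
by move: h4; rewrite leq_pmul2l; lia.
Qed.

(** With only six cut edges, degrees inside [X] are discounted by one: the sum becomes at most
    [4 |X| - 6 = 2 (2 |X| - 3)]. The discount is affordable once all inner degrees are at least
    three, and a vertex of smaller inner degree can be removed from its set without raising the
    right-hand side. *)
Lemma cover_bound_five (s : seq {set T}) : k = 5 ->
  (forall X, X \in s -> 1 < #|X| /\ X \subset W) ->
  2 * #|W| <= \sum_(X <- s) (2 * #|X| - 3) + #|uncovered s| + 3.
Proof.
move=> k5; have [n] := ubnP (\sum_(X <- s) #|X|); elim: n s => // n IH s sn sP.
have [Ws|Ws] := boolP (W \in s); first by apply: cover_full => // X /sP[].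
have [[X Xs [u uX du]]|npr] := EM (exists2 X, X \in s & exists2 u, u \in X & degin X u <= 2).
  have [X2 XW] := sP X Xs.
  have remP Y : Y \in rem X s -> 1 < #|Y| /\ Y \subset W by move/mem_rem/sP.
  have unc_rem f : f \in uncovered (rem X s) -> f \notin uncovered s -> f \subset X.
    rewrite !inE => /andP[-> /allP fs] /= /allPn[Y Ys]; rewrite negbK => fY.
    have [<- //|YX] := eqVneq Y X.
    have : Y \in rem X s.
      by have := Ys; rewrite (perm_mem (perm_to_rem Xs)) inE (negPf YX).
    by move/fs; rewrite fY.
  have [Xle2|X3] := leqP #|X| 2.
    have U1 : #|uncovered (rem X s)| <= #|uncovered s| + 1.
      rewrite -(cards1 X) ; apply: leq_trans (leq_card_setU _ _); apply/subset_leq_card/subsetP => f fU.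
      rewrite !in_setU in_set1; have [//|nf] := boolP (f \in uncovered s).
      by rewrite eqEcard (unc_rem f fU nf) (deleted_edges2 (uncovered_sub fU)).
    have h : 2 * #|W| <= \sum_(Y <- rem X s) (2 * #|Y| - 3) + #|uncovered (rem X s)| + 3.
      apply: IH remP; move: sn X2; rewrite (big_rem X) //=.
      by move: #|X| (\sum_(Y <- rem X s) _); clear; lia.
    rewrite (big_rem X) //=.
    by move: h U1 X2 Xle2; move: (\sum_(Y <- rem X s) _) #|uncovered s| #|uncovered (rem X s)| #|X|; clear; lia.
  (* This lowers [2 |X| - 3] by two and uncovers at most two edges. *)
  pose s' := (X :\ u) :: rem X s.
  have cX : #|X| = #|X :\ u|.+1 by rewrite (cardsD1 u) uX.
  have s'P Y : Y \in s' -> 1 < #|Y| /\ Y \subset W.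
    rewrite inE => /orP[/eqP ->|/remP //]; split; first by move: X3; rewrite cX.
    exact: subset_trans (subsetDl _ _) XW.
  have h : 2 * #|W| <= \sum_(Y <- s') (2 * #|Y| - 3) + #|uncovered s'| + 3.
    apply: IH s'P; move: sn; rewrite /s' big_cons (big_rem X) //= cX.
    by move: #|X :\ u| (\sum_(Y <- rem X s) _); clear; lia.
  have U2 : #|uncovered s'| <= #|uncovered s| + 2.
    apply: (@leq_trans (#|uncovered s| + #|[set [set u; z] | z in [set z in X | e u z]]|)); last first.
      by rewrite leq_add2l; apply: leq_trans (leq_imset_card _ _) du.
    apply: leq_trans (leq_card_setU _ _); apply/subset_leq_card/subsetP => f fU'.
    have /andP[fXu fU] : ~~ (f \subset X :\ u) && (f \in uncovered (rem X s)).
      by move: fU'; rewrite !inE /= => /and3P[-> -> ->].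
    rewrite in_setU; have [//|nf] := boolP (f \in uncovered s).
    have fX := unc_rem f fU nf; have uf : u \in f.
      by apply: contraNT fXu => uf; rewrite subsetD1 fX.
    have /deleted_edgesP[x [y [fE exy _ _]]] := uncovered_sub fU.
    apply/imsetP; move: uf fX; rewrite fE !inE subUset !sub1set => /orP[] /eqP uE /andP[xX yX].
      by exists y; rewrite ?inE uE ?yX ?exy.
    by exists x; [rewrite !inE xX uE se | rewrite uE setUC].
  move: h; rewrite [in X in X -> _]/s' big_cons (big_rem X Xs) /=; move: U2 X3; rewrite cX -/s'.
  by move: (\sum_(Y <- rem X s) _) #|uncovered s| #|uncovered s'| #|X :\ u|; clear; lia.
have deg3 X u : X \in s -> u \in X -> 3 <= degin X u.
  by move=> Xs uX; rewrite ltnNge; apply/negP => h; apply: npr; exists X => //; exists u.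
(* If two sets of the cover contain [u], their discounted degrees already add up to four; otherwise
   at most one is lost from five. *)
have pt u : u \in W -> 4 <= #|nbrs (uncovered s) u| + \sum_(X <- s | u \in X) (degin X u - 1) + degin [set v] u.
  move=> uW; have h := uncovered_degree s uW.
  have Ku : degin W u + degin [set v] u = 5 by have := deginC reg W u; rewrite setCK k5.
  have sumE : \sum_(X <- s | u \in X) degin X u = \sum_(X <- s | u \in X) (degin X u - 1) +
      count (fun X : {set T} => u \in X) s.
    rewrite -sum1_count -big_split /= big_seq_cond [RHS]big_seq_cond; apply: eq_bigr => X /andP[Xs uX].
    by move: (deg3 X u Xs uX); move: (degin X u); clear; lia.
  have sum2 : 2 * count (fun X : {set T} => u \in X) s <= \sum_(X <- s | u \in X) (degin X u - 1).
    rewrite -sum1_count big_distrr /= big_seq_cond [X in _ <= X]big_seq_cond; apply: leq_sum => X /andP[Xs uX].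
    by move: (deg3 X u Xs uX); move: (degin X u); clear; lia.
  move: h; rewrite sumE; move: Ku sum2; move: (count _ _) (\sum_(X <- s | _) _) (degin W u) (degin _ u) #|_|.
  by clear; lia.
have D1 X : X \in s -> \sum_(u in X) (degin X u - 1) <= 2 * (2 * #|X| - 3).
  move=> Xs; have [X2 XW] := sP X Xs.
  have X2' : 2 <= #|~: X| by apply: proper_W => //; apply: contraNneq Ws => <-.
  have [_ /(_ k5) h] := boundary_bound X2 X2'; have := sum_degin_self X.
  have : \sum_(u in X) degin X u = \sum_(u in X) (degin X u - 1) + #|X|.
    by rewrite -sum1_card -big_split /=; apply: eq_bigr => u uX; move: (deg3 X u Xs uX); move: (degin X u); clear; lia.
  by rewrite k5; move: X2 h; move: #|X| (boundary X) (\sum_(u in X) degin X u) (\sum_(u in X) _); clear; lia.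
have h1 : 4 * #|W| <= 2 * #|uncovered s| + \sum_(X <- s) \sum_(u in X) (degin X u - 1) + 5.
  have <- : \sum_(u in W) degin [set v] u = 5.
    rewrite (sum_degin se) big_set1 -k5 -(reg v); apply: eq_card => z; rewrite !inE.
    by case: eqP => [->|//]; rewrite ie.
  rewrite sum_uncovered -exchange_cover => [|X /sP[] //]; rewrite -!big_split /= mulnC -sum_nat_const.
  exact: leq_sum.
have h2 : \sum_(X <- s) \sum_(u in X) (degin X u - 1) <= 2 * \sum_(X <- s) (2 * #|X| - 3).
  by rewrite !big_distrr /= !big_seq; apply: leq_sum.
move: h1 h2; set t := \sum_(X <- s) \sum_(u in X) _; set S := \sum_(X <- s) (2 * #|X| - 3).
by move: t S #|uncovered s| #|W|; clear; lia.
Qed.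

Lemma deleted_rigid p : generic_real p -> infrigid p (setT :\ v) e.
Proof.
move=> gp; have WE : setT :\ v = W by apply/setP => x; rewrite !inE andbT.
rewrite WE; apply: (infrigidS (e := edge_rel E)).
  by move=> x y; rewrite /edge_rel deleted_edge_pair => /and3P[].
apply: maximal_sparse_rigid => //.
- have : #|[set y | e v y]| <= #|W|.
    by apply/subset_leq_card/subsetP => y; rewrite !inE => vy; apply: contraTneq vy => ->; rewrite ie.
  by rewrite reg; lia.
- exact: deleted_edges2.
- exact: deleted_edgesW.
- move=> s sP; have [k5|k5] := eqVneq k 5; first exact: cover_bound_five.
  exact: cover_bound_generic.
Qed.
End DeletedVertex.

Theorem drg_globally_rigid : 0 < #|T| -> globally_rigid_graph e.
Proof.
move=> /card_gt0P[x _]; have [p [gp gr]] : exists p, generic_real p /\ globrigid p setT e.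
  apply: vertex_redundant_globrigid => //; last by move=> v p _ gp; apply: deleted_rigid.
  rewrite cardsT; apply: leq_trans (max_card (mem [set y | e x y])).
  by rewrite reg; apply: leq_trans k4.
exists p; split=> // q qe y z; apply/enorm_dist2; apply/esym; apply: gr => // a b _ _ eab.
by apply/esym/enorm_dist2/qe.
Qed.
End Sufficiency.

(** * Graphs with few edges *)

Section Continuity.
Variable n : nat.
Implicit Types (F G : ('I_n -> R) -> R) (x y : 'I_n -> R).

Definition near_vec x y (d : R) := forall i, `|y i - x i| < d.
(** Shaped like the continuity hypothesis of [continuous_min_on_compactR]. *)
Definition ctns F := forall x r, 0 < r -> exists2 d, 0 < d &
  forall y, near_vec x y d -> `|F y - F x| < r.

Lemma near_vecW x y d d' : d' <= d -> near_vec x y d' -> near_vec x y d.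
Proof. by move=> dd h i; apply: lt_le_trans (h i) dd. Qed.

Lemma ctnsC c : ctns (fun _ => c).
Proof. by move=> x r r0; exists 1 => // y _; rewrite subrr normr0. Qed.

Lemma ctnsX i : ctns (fun x => x i).
Proof. by move=> x r r0; exists r. Qed.

Lemma ctnsD F G : ctns F -> ctns G -> ctns (fun x => F x + G x).
Proof.
move=> cF cG x r r0; have r2 : 0 < r / 2 by rewrite divr_gt0.
have [d d0 dP] := cF x _ r2; have [d' d'0 d'P] := cG x _ r2.
exists (Order.min d d'); first by rewrite lt_min d0.
move=> y h; have := dP y (near_vecW _ h); rewrite ge_min lexx => /(_ isT) h1.
have := d'P y (near_vecW _ h); rewrite ge_min lexx orbT => /(_ isT) h2.
rewrite opprD addrACA; apply: le_lt_trans (ler_normD _ _) _; lra.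
Qed.

Lemma ctnsM F G : ctns F -> ctns G -> ctns (fun x => F x * G x).
Proof.
move=> cF cG x r r0.
pose B := `|F x| + `|G x| + 1.
have B0 : 0 < B by rewrite /B ltr_wpDl // addr_ge0.
pose s := Order.min 1 (r / B / 2).
have s0 : 0 < s by rewrite lt_min ltr01 !divr_gt0.
have [d d0 dP] := cF x _ s0; have [d' d'0 d'P] := cG x _ s0.
exists (Order.min d d'); first by rewrite lt_min d0.
move=> y h; have := dP y (near_vecW _ h); rewrite ge_min lexx => /(_ isT) h1.
have := d'P y (near_vecW _ h); rewrite ge_min lexx orbT => /(_ isT) h2.
have -> : F y * G y - F x * G x = (F y - F x) * (G y - G x) + (F y - F x) * G x + F x * (G y - G x) by ring.
have s1 : s <= 1 by rewrite ge_min lexx.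
have s2 : s * B <= r / 2.
  have : s <= r / B / 2 by rewrite ge_min lexx orbT.
  by move=> /(ler_wpM2r (ltW B0)); rewrite [r / B / 2 * B](_ : _ = r / 2) //; field; rewrite gt_eqF.
apply: le_lt_trans (ler_normD _ _) _; apply: le_lt_trans (lerD (ler_normD _ _) (lexx _)) _.
rewrite !normrM.
have n1 : `|F y - F x| * `|G y - G x| <= s * 1.
  by apply: ler_pM; rewrite ?(ltW h1) // (le_trans (ltW h2)).
have n2 : `|F y - F x| * `|G x| <= s * `|G x| by apply: ler_wpM2r; rewrite // ltW.
have n3 : `|F x| * `|G y - G x| <= `|F x| * s by apply: ler_wpM2l; rewrite // ltW.
move: s2; rewrite /B !mulrDr (mulrC s `|F x|) => s2; lra.
Qed.

Lemma ctnsN F : ctns F -> ctns (fun x => - F x).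
Proof. by move=> cF x r r0; have [d d0 dP] := cF x r r0; exists d => // y /dP; rewrite -opprD normrN. Qed.

Lemma ctnsB F G : ctns F -> ctns G -> ctns (fun x => F x - G x).
Proof. by move=> cF cG; apply: ctnsD => //; apply: ctnsN. Qed.

Lemma ctns_sum (I : Type) (s : seq I) (P : pred I) (F : I -> ('I_n -> R) -> R) :
  (forall i, ctns (F i)) -> ctns (fun x => \sum_(i <- s | P i) F i x).
Proof.
move=> cF; elim: s => [|i s IH].
  by under boolp.eq_fun do rewrite big_nil; apply: ctnsC.
under boolp.eq_fun do rewrite big_cons; case: (P i); [exact: ctnsD | exact: IH].
Qed.

Lemma ctns_prod (I : Type) (s : seq I) (F : I -> ('I_n -> R) -> R) :
  (forall i, ctns (F i)) -> ctns (fun x => \prod_(i <- s) F i x).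
Proof.
move=> cF; elim: s => [|i s IH].
  by under boolp.eq_fun do rewrite big_nil; apply: ctnsC.
by under boolp.eq_fun do rewrite big_cons; apply: ctnsM.
Qed.

Lemma ctnsXn F k : ctns F -> ctns (fun x => F x ^+ k).
Proof.
move=> cF; elim: k => [|k IH].
  by under boolp.eq_fun do rewrite expr0; apply: ctnsC.
by under boolp.eq_fun do rewrite exprS; apply: ctnsM.
Qed.

Lemma ctns_rev (P : {mpoly rat[n]}) : ctns (rev P).
Proof.
rewrite /rev /mmap; apply: ctns_sum => m; apply: ctnsM; first exact: ctnsC.
by apply: ctns_prod => i; apply: ctnsXn; apply: ctnsX.
Qed.

Lemma ctns_det k (A : 'I_k -> 'I_k -> ('I_n -> R) -> R) :
  (forall i j, ctns (A i j)) -> ctns (fun x => \det (\matrix_(i, j) A i j x)).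
Proof.
move=> cA; rewrite /determinant; apply: ctns_sum => s; apply: ctnsM; first exact: ctnsC.
by under boolp.eq_fun do under eq_bigr do rewrite mxE; apply: ctns_prod.
Qed.
End Continuity.

Lemma finite_radius (I : finType) (P : I -> R -> Prop) :
  (forall i d d', d' <= d -> P i d -> P i d') -> (forall i, exists2 d, 0 < d & P i d) ->
  exists2 d, 0 < d & forall i, P i d.
Proof.
move=> mono ex.
suff [d d0 dP] : exists2 d, 0 < d & forall i, i \in enum I -> P i d.
  by exists d => // i; apply: dP; rewrite mem_enum.
elim: (enum I) => [|j s [d d0 dP]]; first by exists 1.
have [d' d'0 d'P] := ex j; exists (Order.min d d'); first by rewrite lt_min d0.
move=> i; rewrite inE => /orP[/eqP ->|/dP]; last by apply: mono; rewrite ge_min lexx.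
by apply: mono d'P; rewrite ge_min lexx orbT.
Qed.

(** Writing [g] as [a + b X + X^2 s] with [s] bounded near zero, a small step against the sign of
    [b] would decrease [g]. *)
Lemma local_min_deriv0 (g : {poly R}) (eta : R) : 0 < eta ->
  (forall t, `|t| < eta -> g.[0] <= g.[t]) -> g^`().[0] = 0.
Proof.
move=> eta0 gmin.
pose a := g.[0]; pose b := g^`().[0].
have [s gE] : exists s : {poly R}, g = a%:P + b *: 'X + 'X^2 * s.
  have /factor_theorem[q1 e1] : root (g - a%:P) 0 by rewrite /root hornerD hornerN hornerC subrr.
  have q10 : q1.[0] = b.
    have -> : b = (g - a%:P)^`().[0] by rewrite derivB derivC subr0.
    by rewrite e1 derivM derivXsubC hornerD !hornerM hornerXsubC subrr mulr0 add0r hornerC mulr1.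
  have /factor_theorem[q2 e2] : root (q1 - b%:P) 0 by rewrite /root hornerD hornerN hornerC q10 subrr.
  exists q2; rewrite subr0 in e1 e2.
  have -> : g = a%:P + q1 * 'X by rewrite -e1 addrC subrK.
  have -> : q1 = b%:P + q2 * 'X by rewrite -e2 addrC subrK.
  by rewrite mulrDl mul_polyC -mulrA -expr2 addrA (mulrC q2).
have [u uP] := poly_itv_bound s (-1) 1.
have u0 : 0 <= u by apply: le_trans (normr_ge0 _) (uP 0 _); rewrite lerN10 ler01.
have key t : `|t| < eta -> `|t| <= 1 -> 0 <= t * b + t ^+ 2 * u.
  move=> te t1; have := gmin t te; rewrite -/a gE !hornerE => h.
  have st : s.[t] <= u by apply: le_trans (ler_norm _) (uP _ _); rewrite -ler_norml.
  have : t ^+ 2 * s.[t] <= t ^+ 2 * u by apply: ler_wpM2l => //; rewrite sqr_ge0.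
  by lra.
apply/eqP; apply: contraT => b0; rewrite -/b in b0.
have nb : 0 < `|b| by rewrite normr_gt0.
pose tau := Order.min (Order.min (eta / 2) 1) (`|b| / (u + 1) / 2).
have u1 : 0 < u + 1 by lra.
have tau0 : 0 < tau by rewrite !lt_min !divr_gt0 //= ltr01.
have taue : tau < eta.
  by apply: (@le_lt_trans _ _ (eta / 2)); [rewrite !ge_min lexx | lra].
have tau1 : tau <= 1 by rewrite !ge_min lexx orbT.
have taub : tau * (u + 1) <= `|b| / 2.
  have : tau <= `|b| / (u + 1) / 2 by rewrite ge_min lexx orbT.
  move=> /(ler_wpM2r (ltW u1)); rewrite [X in _ <= X -> _](_ : _ = `|b| / 2) //.
  by field; rewrite gt_eqF.
have := key (- (tau * Num.sg b)); rewrite normrN normrM normr_sg b0 mulr1 (ger0_norm (ltW tau0)).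
move=> /(_ taue tau1); rewrite sqrrN exprMn sqr_sg b0 mulr1 mulNr -mulrA -normrEsg.
have -> : - (tau * `|b|) + tau ^+ 2 * u = tau * (tau * u - `|b|) by ring.
rewrite pmulr_rge0 //; move: taub; rewrite mulrDr mulr1; lra.
Qed.

Lemma homogeneous_solution n (I : finType) (a : I -> 'I_n -> R) : (#|I| < n)%N ->
  exists h : 'I_n -> R, (exists i, h i != 0) /\ forall r, \sum_i a r i * h i = 0.
Proof.
move=> In; pose A : 'M[R]_(n, #|I|) := \matrix_(i, r) a (enum_val r) i.
have kA : kermx A != 0.
  rewrite -mxrank_eq0 mxrank_ker -lt0n subn_gt0.
  by apply: leq_ltn_trans (rank_leq_col A) In.
have [i ri] : exists i, row i (kermx A) != 0.
  apply: contrapT => nr; move/eqP: kA; apply; apply/row_matrixP => i.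
  by rewrite row0; apply: contrapT => /eqP h0; apply: nr; exists i.
have rA : row i (kermx A) *m A = 0 by rewrite -row_mul mulmx_ker row0.
exists (fun j => row i (kermx A) 0 j); split.
  apply: contrapT => na; move/eqP: ri; apply; apply/rowP => j; rewrite [RHS]mxE.
  by apply/eqP; apply: contrapT => /negP h0; apply: na; exists j.
move=> r; have /rowP/(_ (enum_rank r)) := rA; rewrite !mxE => h; rewrite -[RHS]h.
by apply: eq_bigr => j _; rewrite [A _ _]mxE enum_rankK mulrC.
Qed.

(** Over the reals [v M M^T = 0] forces [v M = 0]. Independence of rows thus becomes one
    determinant, both polynomial and continuous in the entries. *)
Lemma row_free_gram m n (M : 'M[R]_(m, n)) : row_free M = (\det (M *m M^T) != 0).
Proof.
rewrite -unitfE -unitmxE -row_free_unit; apply/idP/idP => fM.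
  rewrite -kermx_eq0; apply/eqP/row_matrixP => i; rewrite row0.
  have : row i (kermx (M *m M^T)) *m (M *m M^T) = 0 by rewrite -row_mul mulmx_ker row0.
  move: (row i _) => v vM; have vM0 : v *m M = 0.
    have : (v *m M) *m (v *m M)^T = 0 by rewrite trmx_mul mulmxA -(mulmxA v) vM mul0mx.
    move=> /matrixP/(_ 0 0); rewrite !mxE => /eqP.
    rewrite psumr_eq0 => [/allP h|j _]; last by rewrite [_^T _ _]mxE -expr2 sqr_ge0.
    apply/rowP => j; have := h j (mem_index_enum j).
    by rewrite [_^T _ _]mxE -expr2 sqrf_eq0 [RHS]mxE => /eqP.
  by apply/eqP; rewrite -(mulmx_free_eq0 v fM) vM0.
rewrite -kermx_eq0 -(mulmx_free_eq0 _ fM) mulmxA mulmx_ker mul0mx //.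
Qed.

Lemma sqr_near_eq (u v : R) : u ^+ 2 = v ^+ 2 -> `|u - v| < `|v| -> u = v.
Proof.
move=> /eqP; rewrite eqf_sqr => /orP[/eqP //|/eqP ->].
rewrite -opprD normrN -mulr2n normrMn mulr2n => h.
by have := normr_ge0 v; lra.
Qed.

Lemma cross_sqr a b c : 4 * cross a b c ^+ 2 =
  4 * dist2 a b * dist2 a c - (dist2 a b + dist2 a c - dist2 b c) ^+ 2.
Proof. by rewrite /cross /dist2; ring. Qed.

Section Underbraced.
Variables (T : finType) (e : rel T).
Hypothesis se : ssrbool.symmetric e.
Local Notation N := #|{: T * 'I_2}|.
Local Notation J := ((T * T) + (T * 'I_2))%type.

(** Each edge once, directed by the enumeration of [T]. *)
Definition oriented := [set u : T * T | e u.1 u.2 & (enum_rank u.1 < enum_rank u.2)%N].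

Variables (p : realisation T) (w1 w2 : T).
Hypotheses (gp : generic_real p) (w12 : w1 != w2).
Local Notation S := (system setT e w1 w2).
Let x0 := vec p.

Lemma exists_flex : (#|oriented| + 3 < 2 * #|T|)%N -> exists m : realisation T,
  (exists i, vec m i != 0) /\ forall r, gradient (S r) p m = 0.
Proof.
move=> hc.
pose I := ({u | u \in oriented} + 'I_3)%type.
pose pin (j : 'I_3) : 'I_N := enum_rank
  (if j == 0 :> nat then (w1, ord0) else if j == 1 :> nat then (w1, ord_max) else (w2, ord0)).
pose a (r : I) (i : 'I_N) : R := match r with
  | inl u => rev (edge_poly (val u).1 (val u).2)^`M(i) x0 | inr j => (i == pin j)%:R end.
have [|h [hn0 hP]] := @homogeneous_solution N I a.
  by rewrite card_sum card_sig card_ord card_prod card_ord mulnC.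
exists (unvec h); split; first by case: hn0 => i; exists i; rewrite unvecK.
apply/system_flexP.
have pinP j : h (pin j) = 0.
  have := hP (inr j); rewrite /a (bigD1 (pin j)) //= eqxx mul1r big1 ?addr0 // => i /negPf ->.
  by rewrite mul0r.
have st x y : e x y -> (enum_rank x < enum_rank y)%N -> strain p (unvec h) x y = 0.
  move=> exy xy; have uo : (x, y) \in oriented by rewrite inE /= exy xy.
  have /eqP : gradient (edge_poly x y) p (unvec h) = 0.
    rewrite -[RHS](hP (inl (exist _ (x, y) uo))); apply: eq_bigr => i _.
    by congr (_ * _); apply: unvecK.
  by rewrite gradient_edge mulf_eq0 pnatr_eq0 => /eqP.
split.
- move=> x y _ _ exy; case: (ltngtP (enum_rank x) (enum_rank y)) => xy.
  + exact: st.
  + by rewrite strainC st // se.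
  + by rewrite (enum_rank_inj (val_inj xy)) strainxx.
- by have := pinP (@Ordinal 3 0 isT).
- by have := pinP (@Ordinal 3 1 isT).
- by have := pinP (@Ordinal 3 2 isT).
- by move=> x; rewrite inE.
Qed.

Hypothesis gr : globally_rigid_real e p.

(** A solution is an equivalent realisation, hence congruent to [p]. The pins leave only
    reflections, and these reverse the sign of some [Fc], a height difference or an orientation,
    which cannot happen near [x0]. *)
Lemma locally_unique : exists2 rho, 0 < rho & forall y,
  (forall i, `|y i - x0 i| <= rho) -> (forall r, rev (S r) y = rev (S r) x0) -> y =1 x0.
Proof.
pose X (x : T) (y : 'I_N -> R) := y (enum_rank (x, ord0)).
pose Y (x : T) (y : 'I_N -> R) := y (enum_rank (x, ord_max)).
pose Fc (o : option T) (y : 'I_N -> R) := if o is Some x then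
  (X w2 y - X w1 y) * (Y x y - Y w1 y) - (Y w2 y - Y w1 y) * (X x y - X w1 y) else Y w2 y - Y w1 y.
have cX x : ctns (X x) by apply: ctnsX.
have cY x : ctns (Y x) by apply: ctnsX.
have cFc o : ctns (Fc o).
  by case: o => [x|] /=; [apply: ctnsB; apply: ctnsM; apply: ctnsB | apply: ctnsB].
have [||d d0 dP] := @finite_radius (option T)
  (fun o d => Fc o x0 != 0 -> forall y, near_vec x0 y d -> `|Fc o y - Fc o x0| < `|Fc o x0|).
- by move=> o d d' dd h o0 y yd; apply: h => //; apply: near_vecW yd.
- move=> o; have [->|o0] := eqVneq (Fc o x0) 0; first by exists 1.
  by have [|d d0 dP] := cFc o x0 `|Fc o x0|; [rewrite normr_gt0 | exists d].
exists (d / 2); first by rewrite divr_gt0.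
move=> y yd yS; pose q := unvec y.
have nr : near_vec x0 y d by move=> i; apply: le_lt_trans (yd i) _; lra.
have yq : vec q =1 y := unvecK y.
have qc c : pinned setT w1 w2 c -> coord_of q c = coord_of p c.
  move=> pc; have := yS (inr c); rewrite /= pc -(eq_rev _ yq) !revX /x0 /vec.
  by rewrite enum_rankK.
have q1 : q w1 = p w1.
  rewrite [LHS]surjective_pairing [RHS]surjective_pairing; congr (_, _).
    by have := qc (w1, ord0); apply; rewrite /pinned eqxx.
  by have := qc (w1, ord_max); apply; rewrite /pinned eqxx orbT.
have q21 : (q w2).1 = (p w2).1 by have := qc (w2, ord0); apply; rewrite /pinned eqxx !orbT.
have cong u v : dist2 (q u) (q v) = dist2 (p u) (p v).
  apply/esym/enorm_dist2; apply: gr => a b eab; apply/enorm_dist2.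
  have := yS (inl (a, b)); rewrite /= !inE eab /= -(eq_rev _ yq) /x0 !edge_polyE => ->.
  by [].
have qX x : X x y = (q x).1 by [].
have qY x : Y x y = (q x).2 by [].
have pX x : X x x0 = (p x).1 by rewrite /X /x0; case: (vec_rank p x).
have pY x : Y x x0 = (p x).2 by rewrite /Y /x0; case: (vec_rank p x).
have q2 : q w2 = p w2.
  rewrite [LHS]surjective_pairing [RHS]surjective_pairing q21; congr (_, _).
  have n0 : Fc None x0 != 0 by rewrite /= !pY subr_eq0 eq_sym generic_neq2.
  have := dP None n0 y nr; rewrite /= !qY !pY => near.
  have := cong w1 w2; rewrite /dist2 q1 q21 => /addrI h.
  have : (q w2).2 - (q w1).2 = (p w2).2 - (p w1).2.
    apply: sqr_near_eq near; rewrite -(sqrrN ((p w2).2 - _)) opprB -h q1.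
    by ring.
  by rewrite q1 => /addIr.
have qx x : q x = p x.
  have [->//|x1] := eqVneq x w1; have [->//|x2] := eqVneq x w2.
  have FE : Fc (Some x) x0 = cross (p w1) (p w2) (p x) by rewrite /= !pX !pY /cross.
  have FqE : Fc (Some x) y = cross (q w1) (q w2) (q x) by [].
  have n0 : Fc (Some x) x0 != 0 by rewrite FE; apply: generic_cross; rewrite // eq_sym.
  have := dP (Some x) n0 y nr; rewrite FE FqE => near.
  have cr : cross (q w1) (q w2) (q x) = cross (p w1) (p w2) (p x).
    apply: sqr_near_eq near; have := cross_sqr (q w1) (q w2) (q x).
    by rewrite !cong -cross_sqr => /(mulfI _) -> //; rewrite pnatr_eq0.
  have d1 := cong x w1; have d2 := cong x w2.
  rewrite q1 q2 in cr d1 d2.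
  have [|||u0 v0] := @linear2_eq0 ((p w2).1 - (p w1).1) ((p w2).2 - (p w1).2)
    (- ((p w2).2 - (p w1).2)) ((p w2).1 - (p w1).1) ((q x).1 - (p x).1) ((q x).2 - (p x).2).
  - have : (p w1).1 != (p w2).1 by apply: generic_neq1.
    apply: contra_neq => h; have h' : dist2 (p w1) (p w2) = 0 by rewrite -[RHS]h /dist2; ring.
    by rewrite (dist2_eq0 h').
  - by move: d1 d2; rewrite /dist2; lra.
  - by move: cr; rewrite /cross; lra.
  by rewrite [LHS]surjective_pairing [RHS]surjective_pairing; congr (_, _); lra.
by move=> i; rewrite -yq /x0 /vec /coord_of !qx.
Qed.

Let a (r : J) (i : 'I_N) (y : 'I_N -> R) := rev (S r)^`M(i) y.
Let A (y : 'I_N -> R) : 'M[R]_(#|{: J}|, N) := \matrix_(r, i) a (enum_val r) i y.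

(** A nonzero Gram determinant of rows at [y] stays nonzero at the generic [p]. *)
Lemma rank_max y : (\rank (A y) <= \rank (A x0))%N.
Proof.
pose f := maxrankfun (A y).
pose g (q : realisation T) := \det (\matrix_(i, j) \sum_k a (enum_val (f i)) k (vec q) * a (enum_val (f j)) k (vec q)).
have gE z : g (unvec z) = \det (rowsub f (A z) *m (rowsub f (A z))^T).
  congr (\det _); apply/matrixP => i j; rewrite !mxE; apply: eq_bigr => k _; rewrite !mxE /a.
  by rewrite !(eq_rev _ (unvecK z)).
have gp0 : g p != 0.
  apply: (@generic_neq0 T g p (unvec y)) => //.
    apply: polyfun_det => i j; apply: polyfun_sum => k; apply: polyfunM; exact: polyfun_rev.
  by rewrite gE -row_free_gram maxrowsub_free.
have : row_free (rowsub f (A x0)).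
  rewrite row_free_gram -gE; suff -> : unvec x0 = p by [].
  by apply: funext => x; rewrite /unvec /x0; have [-> ->] := vec_rank p x; rewrite -surjective_pairing.
move=> /eqP <-; apply: mxrankS.
by apply/row_subP => i; rewrite row_rowsub row_sub.
Qed.

(** At [x0] the flex is orthogonal to all rows, hence independent of a maximal free family; this
    persists nearby. Were the flex in the row space at [y], the rank there would exceed the
    maximum. *)
Lemma flex_not_in_rows m : (exists i, vec m i != 0) -> (forall r, gradient (S r) p m = 0) ->
  exists2 d, 0 < d & forall y, near_vec x0 y d -> ~~ ((\row_i vec m i) <= A y)%MS.
Proof.
move=> [i0 mi0] mP; pose f := maxrankfun (A x0); pose r0 := \rank (A x0).
pose cv : 'rV[R]_N := \row_i vec m i.
pose M y : 'M[R]_(1 + r0, N) := col_mx cv (rowsub f (A y)).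
pose Mf (y : 'I_N -> R) (i : 'I_(1 + r0)) k := match split i with
  | inl _ => vec m k | inr j => a (enum_val (f j)) k y end.
have ME y i k : M y i k = Mf y i k.
  by rewrite /M /Mf mxE; case: split => j; rewrite !mxE.
pose g y := \det (\matrix_(i, j) \sum_k Mf y i k * Mf y j k).
have gE y : g y = \det (M y *m (M y)^T).
  by congr (\det _); apply/matrixP => i j; rewrite !mxE; apply: eq_bigr => k _; rewrite -!ME [_^T _ _]mxE.
have cg : ctns g.
  apply: ctns_det => i j; apply: ctns_sum => k; rewrite /Mf.
  by apply: ctnsM; case: split => l; (exact: ctnsC || exact: ctns_rev).
have g0 : g x0 != 0.
  rewrite gE /M tr_col_mx mul_col_row.
  have Bc : rowsub f (A x0) *m cv^T = 0.
    apply/colP => j; rewrite !mxE -[RHS](mP (enum_val (f j))) /gradient.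
    by apply: eq_bigr => k _; rewrite !mxE.
  have cB : cv *m (rowsub f (A x0))^T = 0 by rewrite -[cv]trmxK -trmx_mul Bc trmx0.
  rewrite Bc det_ublock mulf_neq0 //; last by rewrite -row_free_gram maxrowsub_free.
  rewrite det_mx11 mxE psumr_neq0 => [|j _]; last by rewrite [_^T _ _]mxE -expr2 sqr_ge0.
  apply/hasP; exists i0; first exact: mem_index_enum.
  by rewrite [_^T _ _]mxE -expr2 mxE /= exprn_even_gt0.
have [|d d0 dP] := cg x0 `|g x0|; first by rewrite normr_gt0.
exists d => // y /dP gy; apply/negP => cA.
have : row_free (M y).
  rewrite row_free_gram -gE; apply: contraTneq gy => ->.
  by rewrite sub0r normrN ltxx.
move=> /eqP rM; have : (\rank (M y) <= \rank (A y))%N.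
  apply: mxrankS; rewrite col_mx_sub cA /=.
  by apply/row_subP => i; rewrite row_rowsub row_sub.
by rewrite rM => /leq_trans/(_ (rank_max y)); rewrite -/r0 add1n ltnn.
Qed.

Theorem underbraced_not_rigid : (#|oriented| + 3 < 2 * #|T|)%N -> False.
Proof.
move=> hc; have [m [mn0 mP]] := exists_flex hc.
have [rho rho0 rhoP] := locally_unique; have [d1 d10 d1P] := flex_not_in_rows mn0 mP.
pose d := Order.min d1 (rho / 2).
have d0 : 0 < d by rewrite lt_min d10 divr_gt0.
pose G (y : 'I_N -> R) := \sum_r (rev (S r) y - rev (S r) x0) ^+ 2.
have cG : ctns G.
  by apply: ctns_sum => r; apply: ctnsXn; apply: ctnsD; [apply: ctns_rev | apply: ctnsC].
have G0 y : 0 <= G y by apply: sumr_ge0 => r _; rewrite sqr_ge0.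
pose K1 (y : 'I_N -> R) := forall i, `|y i - x0 i| <= rho.
pose K2 (y : 'I_N -> R) := K1 y /\ exists i, d <= `|y i - x0 i|.
pose bnd := \sum_i `|x0 i| + rho.
have K1b y : K1 y -> forall i, `|y i| <= bnd.
  move=> yK i; have -> : y i = x0 i + (y i - x0 i) by ring.
  apply: le_trans (ler_normD _ _) _; apply: lerD (yK i).
  by rewrite (bigD1 i) //= lerDl sumr_ge0.
have K1c y : (forall r, 0 < r -> exists2 z, K1 z & forall i, `|z i - y i| < r) -> K1 y.
  move=> h i; apply/ler_addgt0Pr => r r0; have [z zK zy] := h r r0.
  have -> : y i - x0 i = (z i - x0 i) - (z i - y i) by ring.
  by apply: le_trans (ler_normB _ _) _; apply: lerD (zK i) (ltW (zy i)).
have K2c y : (forall r, 0 < r -> exists2 z, K2 z & forall i, `|z i - y i| < r) -> K2 y.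
  move=> h; split; first by apply: K1c => r /h[z [zK _] zy]; exists z.
  apply: contrapT => nd.
  have [||r r0 rP] := @finite_radius 'I_N (fun i r => `|y i - x0 i| + r <= d).
  - by move=> i u v uv; apply: le_trans; rewrite lerD2l.
  - move=> i; exists (d - `|y i - x0 i|); last by rewrite addrC subrK.
    by rewrite subr_gt0 ltNge; apply/negP => di; apply: nd; exists i.
  have [z [_ [i zi]] zy] := h r r0.
  have := rP i; have := zy i; have : `|z i - x0 i| <= `|z i - y i| + `|y i - x0 i|.
    by apply: le_trans (ler_normD _ _); rewrite addrA subrK.
  by lra.
(* On the shell between [d] and [rho] the error [G] has no zero and is bounded below. With the
   weight [Mb] the penalty there exceeds the variation [C] of the linear term, so the minimum of
   [Phi] falls inside the shell. *)
have [mu mu0 muP] : exists2 mu, 0 < mu & forall y, K2 y -> mu <= G y.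
  have [ne|ne] := EM (exists y, K2 y); last by exists 1 => // y yK; case: ne; exists y.
  have [y yK ymin] := @continuous_min_on_compactR N K2 G bnd ne
    (fun y yK => K1b y yK.1) K2c cG.
  exists (G y) => //; rewrite lt_neqAle G0 andbT eq_sym; apply/eqP => Gy.
  have : y =1 x0.
    apply: rhoP; first exact: yK.1.
    move=> r; apply/eqP; rewrite -subr_eq0 -sqrf_eq0; move/eqP: Gy.
    rewrite psumr_eq0 => [/allP/(_ r)|? _]; last by rewrite sqr_ge0.
    by rewrite mem_index_enum => /(_ isT).
  by move=> e0; case: yK.2 => i; rewrite e0 subrr normr0 leNgt d0.
pose C := \sum_i `|vec m i| * rho.
pose Mb := (C + 1) / mu.
have C0 : 0 <= C by apply: sumr_ge0 => i _; rewrite mulr_ge0 // ltW.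
have Mb0 : 0 <= Mb by rewrite divr_ge0 ?(ltW mu0) //; lra.
pose Phi (y : 'I_N -> R) := - (\sum_i vec m i * y i) + Mb * G y.
have cPhi : ctns Phi.
  apply: ctnsD; last by apply: ctnsM => //; apply: ctnsC.
  apply: ctnsN; apply: ctns_sum => i; apply: ctnsM; [exact: ctnsC | exact: ctnsX].
have x0K : K1 x0 by move=> i; rewrite subrr normr0 ltW.
have [y yK ymin] := @continuous_min_on_compactR N K1 Phi bnd (ex_intro _ x0 x0K) K1b K1c cPhi.
have yd i : `|y i - x0 i| < d.
  rewrite ltNge; apply/negP => di; have yK2 : K2 y by split=> //; exists i.
  have := ymin x0 x0K; rewrite /Phi.
  have -> : G x0 = 0 by apply: big1 => r _; rewrite subrr expr0n.
  have h1 : C + 1 <= Mb * G y.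
    have -> : C + 1 = Mb * mu by rewrite /Mb divfK // gt_eqF.
    by apply: ler_wpM2l => //; apply: muP.
  have h2 : \sum_i vec m i * y i - \sum_i vec m i * x0 i <= C.
    rewrite -sumrB; apply: ler_sum => j _; rewrite -mulrBr; apply: le_trans (ler_norm _) _.
    by rewrite normrM ler_wpM2l.
  by rewrite mulr0; lra.
have near1 : near_vec x0 y d1.
  by move=> i; apply: lt_le_trans (yd i) _; rewrite ge_min lexx.
have := d1P y near1; case/negP.
(* The coefficients come from differentiating [Mb * G]: the minimum is interior, so every partial
   derivative of [Phi] vanishes. *)
pose lam (r : 'I_#|{: J}|) := Mb * 2 * (rev (S (enum_val r)) y - rev (S (enum_val r)) x0).
suff -> : \row_i vec m i = (\row_r lam r) *m A y by apply: submxMl.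
apply/rowP => i; rewrite !mxE.
pose dir (j : 'I_N) : R := (j == i)%:R.
pose g : {poly R} := (- \sum_j vec m j * y j)%:P - vec m i *: 'X +
  Mb *: \sum_r ((restrict (S r) y dir - (rev (S r) x0)%:P) * (restrict (S r) y dir - (rev (S r) x0)%:P)).
have gE t : g.[t] = Phi (fun j => y j + t * dir j).
  rewrite /g /Phi !hornerE horner_sum; congr (_ + _ * _); last first.
    by apply: eq_bigr => r _; rewrite !hornerE restrictE expr2.
  rewrite -opprD; congr (- _); under [RHS]eq_bigr => j _ do rewrite mulrDr.
  rewrite big_split /=; congr (_ + _); rewrite (bigD1 i) //= /dir eqxx mulr1 big1 ?addr0 //.
  by move=> j /negPf ->; rewrite !mulr0.
have : g^`().[0] = 0.
  apply: (@local_min_deriv0 g (rho / 2)); first by rewrite divr_gt0.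
  move=> t tr; rewrite !gE.
  have -> : Phi (fun j => y j + 0 * dir j) = Phi y.
    by congr Phi; apply: funext => j; rewrite mul0r addr0.
  apply: ymin => j; have -> : y j + t * dir j - x0 j = (y j - x0 j) + t * dir j by ring.
  apply: le_trans (ler_normD _ _) _.
  have hd : d <= rho / 2 by rewrite ge_min lexx orbT.
  have : `|t * dir j| <= `|t| by rewrite normrM /dir; case: (j == i); rewrite ?normr1 ?normr0 ?mulr1 ?mulr0.
  by have := yd j; lra.
rewrite /g derivD derivB derivC sub0r !derivZ derivX hornerD hornerN !hornerZ hornerC mulr1.
rewrite raddf_sum /= horner_sum => h.
have -> : vec m i = Mb * \sum_r ((restrict (S r) y dir - (rev (S r) x0)%:P) *
    (restrict (S r) y dir - (rev (S r) x0)%:P))^`().[0] by lra.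
rewrite (reindex (@enum_val J predT)) /=; last first.
  by exists enum_rank => r _; [rewrite enum_valK | rewrite enum_rankK].
rewrite mulr_sumr; apply: eq_bigr => r _; rewrite !mxE derivM derivB derivC subr0 hornerD !hornerM.
rewrite deriv_restrict !hornerD !hornerN !hornerC restrictE.
have -> : rev (S (enum_val r)) (fun j => y j + 0 * dir j) = rev (S (enum_val r)) y.
  by apply: eq_rev => j; rewrite mul0r addr0.
have -> : \sum_j rev (S (enum_val r))^`M(j) y * dir j = a (enum_val r) i y.
  rewrite (bigD1 i) //= /dir eqxx mulr1 big1 ?addr0 // => j /negPf ->.
  by rewrite mulr0.
by rewrite /lam; ring.
Qed.
End Underbraced.

(** * The complete bipartite graph on six vertices *)

(** The reflection in the perpendicular bisector fixes all points equidistant from [w] and [a], so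
    points can be put in place one by one. *)
Lemma bisector_reflection (w a : R * R) : exists f : R * R -> R * R,
  [/\ forall x y, dist2 (f x) (f y) = dist2 x y, f w = a &
      forall x, dist2 x w = dist2 x a -> f x = x].
Proof.
have [->|wa] := eqVneq w a; first by exists id.
have L0 : dist2 w a != 0 by apply: contra_neq wa => /dist2_eq0.
pose k x := (dist2 x a - dist2 x w) / dist2 w a.
exists (fun x => (x.1 - k x * (w.1 - a.1), x.2 - k x * (w.2 - a.2))); split=> [x y||x h].
- by move: L0; rewrite /k /dist2 /= => L0; field.
- by rewrite /k dist2xx subr0 divff // !mul1r !subKr -surjective_pairing.
- by rewrite /k h subrr !mul0r !subr0 -surjective_pairing.
Qed.

Lemma three_point_isometry (v a : I3 -> R * R) :
  (forall i j, dist2 (v i) (v j) = dist2 (a i) (a j)) ->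
  exists f : R * R -> R * R, (forall x y, dist2 (f x) (f y) = dist2 x y) /\ forall i, f (v i) = a i.
Proof.
move=> va; have [f [fi f0 _]] := bisector_reflection (v i0) (a i0).
have [g [gi g1 gfix]] := bisector_reflection (f (v i1)) (a i1).
have g0 : g (a i0) = a i0 by apply: gfix; rewrite -{1}f0 fi va.
have [h [hi h2 hfix]] := bisector_reflection (g (f (v i2))) (a i2).
exists (fun x => h (g (f x))); split=> [x y|[]]; first by rewrite hi gi fi.
- by rewrite f0 g0 hfix // -{1}g0 gi -{1}f0 fi va.
- by rewrite g1 hfix // -{1}g1 gi fi va.
- exact: h2.
Qed.

(** The Gram vectors have the third centre at the origin; the isometry that carries them to the
    [Q i] carries the origin to the required third centre. *)
Lemma second_placementR (t0 : R) (P : I3 -> R * R) (b : R * R) :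
  0 < t0 -> (forall i, (P i).2 != 0) -> (P i0).1 + (P i0).1 != t0 ->
  cross b (P i0) (P i1) != 0 -> cross b (P i0) (P i2) != 0 ->
  cross (P i0) (P i1) (P i2) != 0 ->
  (forall (m : I3 -> R * R) (c : R * R),
    (forall i, (P i).1 * (m i).1 + (P i).2 * (m i).2 = 0) ->
    (forall i, ((P i).1 - t0) * ((m i).1 - 1) + (P i).2 * (m i).2 = 0) ->
    (forall i, ((P i).1 - b.1) * ((m i).1 - c.1) + ((P i).2 - b.2) * ((m i).2 - c.2) = 0) -> False) ->
  exists t (Q : I3 -> R * R) c, [/\ 0 < t,
    forall i, dist2 (Q i) (0, 0) = dist2 (P i) (0, 0),
    forall i, dist2 (Q i) (t, 0) = dist2 (P i) (t0, 0),
    forall i, dist2 (Q i) c = dist2 (P i) b &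
    t <> t0 \/ exists i j, dist2 (Q i) (Q j) <> dist2 (P i) (P j)].
Proof.
move=> t0p y0 x0 c01 c02 c012 rig.
have [|||||||t [A [B [v [v' [tp [d0 [d1 [d2 [dv ne]]]]]]]]]] :=
  @second_placement t0 b.1 b.2 (fun i => (P i).1) (fun i => (P i).2).
- exact/RltP.
- by move=> i; apply/eqP.
- exact/eqP.
- exact/eqP.
- exact/eqP.
- exact/eqP.
- by move=> a a' c d h0 h1 h2; apply: (rig (fun i => (a i, a' i)) (c, d)).
have [|f [fi fv]] := @three_point_isometry (fun i => (v i, v' i)) (fun i => (A i, B i)).
  by move=> i j; rewrite /dist2 /= !expr2; exact: dv.
exists t, (fun i => (A i, B i)), (f (0, 0)); split.
- exact/RltP.
- by move=> i; rewrite /dist2 /= !expr2 !subr0; exact: d0.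
- by move=> i; rewrite /dist2 /= !expr2 !subr0; exact: d1.
- by move=> i; rewrite -fv fi /dist2 /= !subr0 !expr2; exact: d2.
- case: ne => [n|[i [j n]]]; [by left | right; exists i, j].
  by rewrite /dist2 /= !expr2.
Qed.

Section Biclique.
Variable T : finType.
Implicit Types (p q m : realisation T) (A B : {set T}).

Definition biclique A B : rel T := fun x y => (x \in A) && (y \in B) || (x \in B) && (y \in A).

(** There are [9 = 2 * 6 - 3] edges, and [a b <= 2 (a + b) - 3] for [a, b <= 3] with [a + b >= 2],
    so Laman's theorem applies. *)
Lemma biclique33_infrigid p A B : generic_real p -> #|A| = 3%N -> #|B| = 3%N -> [disjoint A & B] ->
  infrigid p (A :|: B) (biclique A B).
Proof.
move=> gp A3 B3 dAB.
pose F := [set [set u.1; u.2] | u in setX A B].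
have AB x y : x \in A -> y \in B -> x != y.
  by move=> xA yB; apply: contraTneq yB => <-; rewrite (disjointFr dAB).
have FP f : reflect (exists x y, [/\ x \in A, y \in B & f = [set x; y]]) (f \in F).
  apply: (iffP imsetP) => [[[x y]]|[x [y [xA yB ->]]]].
    by rewrite inE /= => /andP[xA yB] ->; exists x, y.
  by exists (x, y); rewrite ?inE /= ?xA.
have F2 : edge_family F by move=> f /FP[x [y [xA yB ->]]]; rewrite cards2 AB.
have FW f : f \in F -> f \subset A :|: B.
  by case/FP=> x [y [xA yB ->]]; apply/subsetP => z; rewrite !inE => /orP[] /eqP ->; rewrite ?xA ?yB ?orbT.
have inj : {in setX A B &, injective (fun u : T * T => [set u.1; u.2])}.
  move=> [x y] [x' y']; rewrite !inE /= => /andP[xA yB] /andP[xA' yB'] E.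
  have : x \in [set x'; y'] by rewrite -E !inE eqxx.
  rewrite !inE (negPf (AB _ _ xA yB')) orbF => /eqP xx.
  have : y \in [set x'; y'] by rewrite -E !inE eqxx orbT.
  by rewrite !inE [y == x']eq_sym (negPf (AB _ _ xA' yB)) /= xx => /eqP ->.
have F9 : #|F| = 9%N by rewrite card_in_imset // cardsX A3 B3.
have sF : sparse F.
  move=> X X2.
  have i1 : (#|inner F X| <= #|X :&: A| * #|X :&: B|)%N.
    rewrite -cardsX; apply: leq_trans (leq_imset_card (fun u : T * T => [set u.1; u.2]) _).
    apply: subset_leq_card; apply/subsetP => f; rewrite inE => /andP[/FP[x [y [xA yB ->]]] /subsetP fX].
    by apply/imsetP; exists (x, y) => //; rewrite !inE /= xA yB !fX ?inE ?eqxx ?orbT.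
  have i2 : (#|X :&: A| + #|X :&: B| <= #|X|)%N.
    rewrite -cardsUI [X in (_ + X)%N](_ : _ = 0%N) ?addn0; last first.
      apply/eqP; rewrite cards_eq0 -subset0; apply/subsetP => z; rewrite !inE => /andP[/andP[_ zA] /andP[_ zB]].
      by have := AB _ _ zA zB; rewrite eqxx.
    by apply: subset_leq_card; apply/subsetP => z; rewrite !inE => /orP[] /andP[].
  have : (#|X :&: A| <= 3)%N by rewrite -A3 subset_leq_card // subsetIr.
  have : (#|X :&: B| <= 3)%N by rewrite -B3 subset_leq_card // subsetIr.
  move: i1 i2 X2; move: #|inner F X| #|X| #|X :&: A| #|X :&: B|; clear.
  by move=> i x [|[|[|[|a]]]] [|[|[|[|b]]]] //; rewrite ?mulnE /=; lia.
have W6 : #|A :|: B| = 6%N.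
  by rewrite cardsU A3 B3 (_ : A :&: B = set0) ?cards0 //; apply/eqP; rewrite setI_eq0.
apply: (@infrigidS _ _ _ (edge_rel F)).
  move=> x y /FP[a [b [aA bB E]]]; rewrite /biclique.
  have : x \in [set a; b] by rewrite -E !inE eqxx.
  have : y \in [set a; b] by rewrite -E !inE eqxx orbT.
  have xy : x != y.
    by apply: contraTneq (AB _ _ aA bB) => xy; have := cards2 a b; rewrite -E xy setUid cards1; case: (a == b).
  rewrite !inE => /orP[] /eqP yE /orP[] /eqP xE; move: xy; rewrite xE yE ?eqxx ?aA ?bB ?orbT //.
by apply: laman; rewrite ?W6 ?F9.
Qed.

Section Hexagon.
Variables (e : rel T) (p : realisation T) (a : I3 -> T) (b0 b1 b2 : T).
Hypothesis gp : generic_real p.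
Hypothesis distinct : uniq [:: a i0; a i1; a i2; b0; b1; b2].
Let A := [set a i0; a i1; a i2].
Let B := [set b0; b1; b2].
Hypothesis eP : forall x y, e x y -> biclique A B x y.

Lemma hexagon_distinct : [/\ injective a, forall i, [/\ a i != b0, a i != b1 & a i != b2],
  b0 != b1, b0 != b2 & b1 != b2].
Proof.
split.
- by case=> [] [] // E; move: distinct; rewrite /= !inE E eqxx ?orbT ?andbF.
- by case; split; apply/eqP => E; move: distinct; rewrite /= !inE E eqxx ?orbT ?andbF.
- by apply/eqP => E; move: distinct; rewrite /= !inE E eqxx ?orbT ?andbF.
- by apply/eqP => E; move: distinct; rewrite /= !inE E eqxx ?orbT ?andbF.
- by apply/eqP => E; move: distinct; rewrite /= !inE E eqxx ?orbT ?andbF.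
Qed.

Lemma hexagon_place (y0 y1 y2 : R * R) (z : I3 -> R * R) : exists m : realisation T,
  [/\ m b0 = y0, m b1 = y1, m b2 = y2 & forall i, m (a i) = z i].
Proof.
have [inj ab b01 b02 b12] := hexagon_distinct.
exists (fun x => if x == b0 then y0 else if x == b1 then y1 else if x == b2 then y2 else
  if x == a i0 then z i0 else if x == a i1 then z i1 else z i2).
have bF i : ((a i == b0) = false) * ((a i == b1) = false) * ((a i == b2) = false).
  by case: (ab i) => /negPf -> /negPf -> /negPf ->.
have aF i j : (a i == a j) = eq3 i j.
  by apply/eqP/idP => [/inj ->|]; [case: j | case: i j => [] []].
split; rewrite ?eqxx // ?[b1 == b0]eq_sym ?[b2 == b0]eq_sym ?[b2 == b1]eq_sym.
- by rewrite (negPf b01).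
- by rewrite (negPf b02) (negPf b12).
- by move=> i; rewrite !bF !aF; case: i.
Qed.

(** An isometry puts [b0] and [b1] on the horizontal axis, so that [B] provides the three centres.
    Genericity gives the nondegeneracy conditions and infinitesimal rigidity the condition on
    velocities. *)
Lemma biclique33_not_rigid : ~ globally_rigid_real e p.
Proof.
have [inj ab b01 b02 b12] := hexagon_distinct.
have an i j : eq3 i j = false -> a i != a j by case: i j => [] [] // _; apply/eqP => /inj.
have A3 : #|A| = 3%N by rewrite /A -setUA !cardsU1 cards1 !inE negb_or !an.
have B3 : #|B| = 3%N by rewrite /B -setUA !cardsU1 cards1 !inE negb_or b01 b02 b12.
have memA z : z \in A -> exists i, z = a i.
  by rewrite !inE => /orP[/orP[]|] /eqP ->; [exists i0 | exists i1 | exists i2].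
have dAB : [disjoint A & B].
  have aB i : a i \notin B by rewrite !inE; case: (ab i) => /negPf -> /negPf -> /negPf ->.
  rewrite -setI_eq0 -subset0; apply/subsetP => z /setIP[/memA[i ->]].
  by rewrite (negPf (aB i)).
have ir := biclique33_infrigid gp A3 B3 dAB.
pose t0 := Num.sqrt (dist2 (p b1) (p b0)).
have D0 : 0 < dist2 (p b1) (p b0).
  rewrite lt0r addr_ge0 ?sqr_ge0 // andbT; apply: contraNneq (generic_neq1 gp b01) => /dist2_eq0 ->.
  by rewrite eqxx.
have t0p : 0 < t0 by rewrite sqrtr_gt0.
have tn : t0 != 0 by rewrite gt_eqF.
have t02 : t0 ^+ 2 = dist2 (p b1) (p b0) by rewrite sqr_sqrtr // ltW.
pose o := p b0; pose d := (((p b1).1 - o.1) / t0, ((p b1).2 - o.2) / t0).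
pose f (z : R * R) := ((z.1 - o.1) * d.1 + (z.2 - o.2) * d.2, d.1 * (z.2 - o.2) - d.2 * (z.1 - o.1)).
have d1 : d.1 ^+ 2 + d.2 ^+ 2 = 1.
  by rewrite /d /= !exprMn !exprVn -mulrDl t02 divff // gt_eqF.
have fi y z : dist2 (f y) (f z) = dist2 y z.
  by rewrite -[RHS]mul1r -d1 /dist2 /f /=; ring.
have fcr x y z : cross (f x) (f y) (f z) = cross x y z.
  by rewrite -[RHS]mul1r -d1 /cross /f /=; ring.
have fb0 : f (p b0) = (0, 0) by rewrite /f !subrr !mul0r !mulr0 subrr addr0.
have fb1 : f (p b1) = (t0, 0).
  congr pair; last by rewrite /d /=; ring.
  rewrite /d /= !mulrA -mulrDl -!expr2; apply: (mulIf tn).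
  by rewrite mulfVK // -expr2 t02.
have [|||||||t [Q [c [tp Q0 Q1 Q2 ne]]]] := @second_placementR t0 (fun i => f (p (a i))) (f (p b2)).
- exact: t0p.
- move=> i; have := @generic_cross _ p b0 b1 (a i) gp b01.
  have [h0 h1 _] := ab i; rewrite ![_ == a i]eq_sym => /(_ h0 h1).
  by rewrite -fcr fb0 fb1; apply: contra_neq => h; rewrite /cross h /=; ring.
- have : dist2 (p (a i0)) (p b0) - dist2 (p (a i0)) (p b1) != 0.
    have polyd x y : polyfun (fun p : realisation T => dist2 (p x) (p y)).
      rewrite /dist2; under eq_fun do rewrite !expr2.
      by apply: polyfunD; apply: polyfunM; apply: polyfunB; (exact: polyfunX1 || exact: polyfunX2).
    apply: (@generic_neq0 _ (fun p => dist2 (p (a i0)) (p b0) - dist2 (p (a i0)) (p b1)) p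
      (fun z => ((z == b1)%:R, 0))) => //; first exact: polyfunB.
    have [h0 h1 _] := ab i0; rewrite /dist2 /= (negPf h1) (negPf b01) eqxx.
    by rewrite !subr0 sub0r expr0n /= !addr0 sub0r sqrrN expr1n oppr_eq0 oner_neq0.
  rewrite -!(fi (p (a i0))) fb0 fb1; cbv beta; move: (f (p (a i0))) => [x1 x2]; apply: contra_neq => /= h.
  by rewrite /dist2 /= -h; ring.
- by rewrite fcr; apply: generic_cross => //; rewrite ?an // eq_sym; [case: (ab i0) | case: (ab i1)].
- by rewrite fcr; apply: generic_cross => //; rewrite ?an // eq_sym; [case: (ab i0) | case: (ab i2)].
- by rewrite fcr; apply: generic_cross => //; rewrite an.
- move=> m c h0 h1 h2.
  have [M [M0 M1 M2 Ma]] := hexagon_place (0, 0) (1, 0) c m.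
  (* The velocities [M] refer to the frame of [f]; [rM] turns them back to the original frame. *)
  pose rM x : R * R := ((M x).1 * d.1 - (M x).2 * d.2, (M x).1 * d.2 + (M x).2 * d.1).
  have st x y : strain p rM x y = ((f (p x)).1 - (f (p y)).1) * ((M x).1 - (M y).1) +
      ((f (p x)).2 - (f (p y)).2) * ((M x).2 - (M y).2).
    by rewrite /strain /rM /f /=; ring.
  have sab i y : y \in B -> strain p rM (a i) y = 0.
    rewrite !inE st Ma => /orP[/orP[]|] /eqP ->.
    - by rewrite M0 fb0 -[RHS](h0 i) /=; ring.
    - by rewrite M1 fb1 -[RHS](h1 i) /=; ring.
    - by rewrite M2 -[RHS](h2 i) /=; ring.
  have sAB x y : x \in A -> y \in B -> strain p rM x y = 0.
    by move=> /memA[i ->]; apply: sab.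
  have [|al [be [ga tr]]] := ir rM.
    by move=> x y _ _ /orP[] /andP[xA yB]; [|rewrite strainC]; apply: sAB.
  (* A trivial flex would keep the distance from [b0] to [b1], but [b1] moves away at unit speed. *)
  have : strain p rM b0 b1 = 0.
    by apply: (@trivial_strain _ _ _ (A :|: B)); rewrite ?inE ?eqxx ?orbT //; exists al, be, ga.
  by rewrite st M0 M1 fb0 fb1 /= subr0 mulr0 addr0 !sub0r mulrNN mulr1 => /eqP; rewrite (negPf tn).
have [q [q0 q1 q2 qa]] := hexagon_place (0, 0) (t, 0) c Q.
move=> gr.
have qab i y : y \in B -> dist2 (q (a i)) (q y) = dist2 (p (a i)) (p y).
  rewrite !inE qa -(fi (p _)) => /orP[/orP[]|] /eqP ->.
  - by rewrite q0 fb0.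
  - by rewrite q1 fb1.
  - by rewrite q2.
have qAB x y : x \in A -> y \in B -> dist2 (p x) (p y) = dist2 (q x) (q y).
  by move=> /memA[i ->] yB; symmetry; apply: qab.
have cg : congruent_real p q.
  apply: gr => x y /eP xy; apply/enorm_dist2.
  by case/orP: xy => /andP[xA yB]; [|rewrite dist2C [RHS]dist2C]; apply: qAB.
have cgd x y : dist2 (f (p x)) (f (p y)) = dist2 (q x) (q y) by rewrite fi; apply/enorm_dist2/cg.
case: ne => [[]|[i [j []]]]; last by rewrite cgd !qa.
have := cgd b1 b0; rewrite fb0 fb1 q0 q1 /dist2 /= !subr0 expr0n /= !addr0 => /eqP.
by rewrite eqrXn2 ?ltW // => /eqP.
Qed.
End Hexagon.
End Biclique.

(** * Regular graphs of small degree, and the conclusion *)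

Local Open Scope nat_scope.

Section Regular.
Variables (T : finType) (e : rel T) (k : nat).
Hypotheses (se : ssrbool.symmetric e) (ie : ssrbool.irreflexive e).
Hypothesis reg : forall x, #|[set y | e x y]| = k.

Lemma regular_card_oriented : 2 * #|oriented e| = k * #|T|.
Proof.
pose E := [set u : T * T | e u.1 u.2].
have cE : #|E| = k * #|T|.
  transitivity (\sum_x \sum_(y | e x y) 1); first by rewrite pair_big_dep sum1dep_card.
  rewrite (eq_bigr (fun _ => k)) => [|x _]; first by rewrite sum_nat_const mulnC.
  by rewrite sum1dep_card reg.
rewrite -cE -(cardsID (oriented e) E) mul2n -addnn; congr (_ + _).
  by apply: eq_card => u; rewrite !inE; case: (e _ _).
pose sw (u : T * T) := (u.2, u.1); have swK : involutive sw by case.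
rewrite -(card_imset _ (inv_inj swK)); apply: eq_card => -[x y].
rewrite -[(x, y) in LHS]swK (mem_imset _ _ (inv_inj swK)) !inE /= se.
case xy: (e x y); rewrite ?andbF //= andbT -leqNgt [RHS]leq_eqVlt.
by rewrite (inj_eq (@ord_inj _)) (inj_eq enum_rank_inj); case: eqP xy => [->|//]; rewrite ie.
Qed.

Lemma closed_setT (S : {set T}) x : connected_graph e -> x \in S ->
  (forall y z, y \in S -> e y z -> z \in S) -> S = setT.
Proof.
move=> ce xS cl; apply/setP => y; rewrite inE; have /connectP[q eq ->] := ce x y.
by elim: q x xS eq => //= z q IH x xS /andP[xz /IH]; apply; apply: cl xz.
Qed.
End Regular.

(** Every edge lies in the same number [b] of triangles. A neighbourhood induces a [b]-regular graph
    on three vertices, so [b] is 0 or 2, and [b = 2] would make a vertex with its neighbours a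
    component of four vertices. Without triangles, the neighbourhoods of two adjacent vertices are
    the parts of [K_{3,3}]. *)
Lemma cubic_six_not_rigid (T : finType) (e : rel T) (p : realisation T) :
  ssrbool.symmetric e -> ssrbool.irreflexive e -> connected_graph e -> distance_regular e ->
  (forall x, #|[set y | e x y]| = 3) -> #|T| = 6 -> generic_real p -> ~ globally_rigid_real e p.
Proof.
move=> se ie ce dr reg T6 gp.
have [b bP] : exists b, forall x y, e x y -> #|[set z | e x z & e y z]| = b.
  have [b bP] := dr 1 1 1; exists b => x y xy.
  rewrite -(bP x y) ?(gdist_ge1 ie ce) //; apply: eq_card => z.
  by rewrite !inE !(gdist_eq1 ie ce).
have /card_gt0P[x _] : 0 < #|T| by rewrite T6.
have /card_gt0P[y] : 0 < #|[set y | e x y]| by rewrite reg.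
rewrite inE => xy.
have b3 : ~~ odd (3 * b).
  have := @sum_degin_even T e se ie [set z | e x z].
  rewrite (eq_bigr (fun _ => b)); first by rewrite sum_nat_const reg.
  by move=> z; rewrite inE => /bP <-; apply: eq_card => w; rewrite !inE.
have b_le : b < 3.
  rewrite -(bP _ _ xy) -(reg x) [X in _ < X](cardsD1 y) inE xy ltnS.
  apply: subset_leq_card; apply/subsetP => z; rewrite !inE => /andP[-> yz].
  by rewrite andbT; apply: contraTneq yz => ->; rewrite ie.
have b0 : b = 0.
  have : b != 2; last by move: b3 b_le; case: b {bP} => [|[|[|]]].
  apply/eqP => b2; pose S := x |: [set z | e x z].
  have S4 : #|S| = 4 by rewrite cardsU1 inE ie reg.
  suff ST : S = setT by move: S4; rewrite ST cardsT T6.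
  apply: (@closed_setT _ _ _ x) => //; first by rewrite !inE eqxx.
  move=> u v; rewrite !inE => /orP[/eqP ->|xu uv]; first by move=> ->; rewrite orbT.
  have sub : x |: [set z | e x z & e u z] \subset [set z | e u z].
    by apply/subsetP => z; rewrite !inE => /orP[/eqP ->|/andP[]] //; rewrite se.
  have : x |: [set z | e x z & e u z] == [set z | e u z].
    by rewrite eqEcard sub reg cardsU1 !inE ie bP ?b2.
  move=> /eqP/setP/(_ v); rewrite !inE uv => /orP[->//|/andP[-> _]]; exact: orbT.
have tf u v w : e u v -> e u w -> ~~ e v w.
  move=> uv uw; apply/negP => vw; have := bP _ _ uv; rewrite b0 => /eqP.
  by rewrite cards_eq0 => /eqP/setP/(_ w); rewrite !inE uw vw.
pose A := [set z | e y z]; pose B := [set z | e x z].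
have dAB : [disjoint A & B].
  rewrite -setI_eq0; apply/eqP/setP => z; rewrite !inE; apply/negP => /andP[yz xz].
  by have := tf _ _ _ xy xz; rewrite yz.
have ABT : A :|: B = setT.
  apply/eqP; rewrite eqEcard subsetT cardsT T6 cardsU !reg.
  by move: dAB; rewrite -setI_eq0 => /eqP ->; rewrite cards0.
have eAB u v : e u v -> biclique A B u v.
  move=> uv; have : u \in A :|: B by rewrite ABT inE.
  have : v \in A :|: B by rewrite ABT inE.
  rewrite /biclique !inE; case yu: (e y u); case yv: (e y v); case xu: (e x u); case xv: (e x v) => //= _ _;
  by (have := tf _ _ _ yu yv; rewrite uv) || (have := tf _ _ _ xu xv; rewrite uv).
have enum3 (C : {set T}) : #|C| = 3 -> exists c0 c1 c2, enum C = [:: c0; c1; c2].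
  by rewrite cardE; case: (enum C) => [|c0 [|c1 [|c2 []]]] //= _; exists c0, c1, c2.
have [a0 [a1 [a2 Ae]]] := enum3 A (reg y); have [c0 [c1 [c2 Be]]] := enum3 B (reg x).
pose a i := match i with i0 => a0 | i1 => a1 | i2 => a2 end.
have AE : A = [set a i0; a i1; a i2] by apply/setP => z; rewrite -mem_enum Ae !inE orbA.
have BE : B = [set c0; c1; c2] by apply/setP => z; rewrite -mem_enum Be !inE orbA.
apply: (@biclique33_not_rigid T e p a c0 c1 c2) => //; last by rewrite -AE -BE.
rewrite -[[:: _; _; _; _; _; _]]/([:: a0; a1; a2] ++ [:: c0; c1; c2]) -Ae -Be cat_uniq !enum_uniq andbT /=.
by apply/hasPn => z; rewrite !mem_enum => zB; rewrite (disjointFl dAB).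
Qed.

Theorem theorem1p3 (T : finType) (e : rel T) (k : nat) :
  simple_graph e -> connected_graph e -> distance_regular e ->
  (forall x : T, #|[set y | e x y]| = k) ->
  (globally_rigid_graph e <-> (4 <= k)%N \/ complete_graph e).
Proof.
move=> [se ie] ce dr reg; have [T0|Tn0] := posnP #|T|.
  have noT (x : T) : False by move/card0_eq/(_ x): T0; rewrite inE.
  split=> _; first by right=> x; case: (noT x).
  have [p gp] := generic_exists T; exists p; split=> // q _ x; case: (noT x).
split=> [[p [gp gr]]|[k4|ec]].
- have [k4|k3] := leqP 4 k; first by left.
  right; apply: contrapT => /existsNP[x /existsNP[y /not_implyP[xy /negP nxy]]].
  have n2 : k + 2 <= #|T|.
    have <- : #|x |: (y |: [set z | e x z])| = k + 2.
      by rewrite !cardsU1 !inE negb_or xy ie nxy reg /= !add1n addn2.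
    exact: max_card.
  have E := regular_card_oriented se ie reg.
  have [lt|ge] := ltnP (#|oriented e| + 3) (2 * #|T|).
    exact: (@underbraced_not_rigid T e se p x y gp xy).
  (* The count gives [(4 - k) n <= 6] with [n >= k + 2]; parity of [k n] rules out [k = 3],
     [n = 5]. *)
  have [k3' T6] : k = 3 /\ #|T| = 6.
    by move: n2 k3 E ge; move: #|oriented e| #|T|; case: k {reg} => [|[|[|[|]]]] //; clear; lia.
  apply: (@cubic_six_not_rigid T e p) => //; rewrite -?k3' //.
- exact: (@drg_globally_rigid T e k).
- have [p gp] := generic_exists T; exists p; split=> // q qe x y.
  have [->|/ec/qe //] := eqVneq x y.
  by apply/enorm_dist2; rewrite !dist2xx.
Qed.
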